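(* Fix $m_3>0$ and a positive integer $k_0$, and put $r_3=\cosh(m_3/2)$, $s_3=\sinh(m_3/2)$. For $n\in\{1,\dots,k_0\}$ let $K_n$ be the set defined in the context, regarded as a set of points $(m_1,m_2,\alpha)\in\mathbb{R}^3$ through $r_j=\cosh(m_j/2)$, $j=1,2$. Then $K_1,\dots,K_{k_0}$ is a family of semi-analytic subsets of $\mathbb{R}^3$ such that: (a) Every point $(m_1,m_2,\alpha)\in K_n$ corresponds, via the explicit polar vectors $n_1,n_2,n_3$ given in the context, to three complex reflections $R_1,R_2,R_3\in\mathrm{PU}(2,1)$ (with polar vectors $n_1,n_2,n_3$) such that $\iota_j\mapsto R_j$ is a complex hyperbolic $[m_1,m_2,m_3]$-triangle group representation with angular invariant $\alpha$. (b) Each $K_n$ is defined (inside the parameter domain) by the $4+k_0$ inequalities listed in the context: the $k_0$ inequalities $t_n\le t_k$ ($1\le k\le k_0+1$, $k\ne n$) and the four inequalities (i)–(iv), expressed in the quantities $r_j=\cosh(m_j/2)$ and $s_j=\sinh(m_j/2)$. (c) The representation corresponding to a point of $K_n$ is discrete and faithful if and only if the isometry $R_1(R_2R_1)^nR_3$ is non-elliptic.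
   Context: **Complex hyperbolic plane.** $\mathbb{C}^{2,1}$ is $\mathbb{C}^3$ with the Hermitian form $\langle z,w\rangle=z_1\overline w_1+z_2\overline w_2-z_3\overline w_3$; $\mathbf{H}^2_{\mathbb C}$ and $\partial\mathbf{H}^2_{\mathbb C}$ are the projectivizations of the negative vectors and of the nonzero null vectors. The metric is $\cosh^2(\rho(z,w)/2)=\frac{\langle z,w\rangle\langle w,z\rangle}{\langle z,z\rangle\langle w,w\rangle}$. $\mathrm{PU}(2,1)$ is the holomorphic isometry group. An element is parabolic if it has exactly one fixed point on $\partial\mathbf{H}^2_{\mathbb C}$, loxodromic if it has exactly two, and elliptic otherwise. A complex geodesic $C$ is the intersection of $\mathbf{H}^2_{\mathbb C}$ with the projectivization of $n^\perp$ for a positive vector $n$ (a polar vector of $C$, normalized if $\langle n,n\rangle=1$). The complex reflection with mirror $C$ is $R_C(z)=-z+2\frac{\langle z,n\rangle}{\langle n,n\rangle}n$ (up to projectivization). **Triangle groups.** Let $R_1,R_2,R_3$ be complex reflections whose mirrors $C_1,C_2,C_3$ are distinct and pairwise ultra-parallel (no common point in $\mathbf{H}^2_{\mathbb C}\cup\partial\mathbf{H}^2_{\mathbb C}$) or asymptotic (meeting only on $\partial\mathbf{H}^2_{\mathbb C}$). With $m_j=\rho(C_{j-1},C_{j+1})$ (indices mod 3), ordered so that $m_1\ge m_2\ge m_3\ge0$, the group $\langle R_1,R_2,R_3\rangle$ is called a complex hyperbolic ultra-parallel $[m_1,m_2,m_3]$-triangle group. For normalized polar vectors, $\cosh(m_j/2)=|\langle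 n_{j-1},n_{j+1}\rangle|$. Let $\Gamma=\langle\iota_1,\iota_2,\iota_3\mid\iota_j^2=1\rangle$. A complex hyperbolic $[m_1,m_2,m_3]$-triangle group representation is a homomorphism $\Gamma\to\mathrm{PU}(2,1)$, $\iota_j\mapsto R_j$, where $R_1,R_2,R_3$ are complex reflections whose mirrors $C_1,C_2,C_3$ are distinct and pairwise ultra-parallel or asymptotic, with $\rho(C_{j-1},C_{j+1})=m_j$ for $j=1,2,3$ (indices mod 3) and $m_1\ge m_2\ge m_3\ge0$; it is discrete if its image is discrete, and faithful if it is injective. The angular invariant is $\alpha=\arg(\langle n_1,n_3\rangle\langle n_2,n_1\rangle\langle n_3,n_2\rangle)$, and one restricts to $\alpha\in[0,\pi]$. Write $r_j=\cosh(m_j/2)$, $s_j=\sinh(m_j/2)$. **Explicit parameterization** ($m_3>0$). A triangle group with given $m_1,m_2,m_3,\alpha$ exists if and only if $\cos\alpha\le\frac{r_1^2+r_2^2+r_3^2-1}{2r_1r_2r_3}$, and then the polar vectors are normalized as $$n_1=(0,r_3,s_3)^T,\quad n_2=(0,1,0)^T,\quad n_3=\Big(\sqrt{|\beta|^2-r_1^2+1},\ r_1,\ \beta\Big)^T,\quad \beta=s_3^{-1}(r_1r_3-r_2e^{-i\alpha}).$$ **The quantities $t_n$.** For a positive integer $n$, $$t_n=\frac{A_0+A_1+A_2}{2r_1r_2s_3\big((r_3+s_3)^{2n+1}+(r_3-s_3)^{2n+1}-2r_3\big)},$$ $A_0=(r_3-s_3)^{2n+2}\big((2r_1^2r_3^2-r_1^2+r_2^2)s_3+2r_1^2r_3(r_3^2-1)\big)$,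 $A_1=(r_3+s_3)^{2n+2}\big((2r_1^2r_3^2-r_1^2+r_2^2)s_3-2r_1^2r_3(r_3^2-1)\big)$, $A_2=-2s_3(r_1^2+r_2^2+2r_3^2-2)$. **Further quantities.** $a_0=4r_1^2r_2^2r_3^4+r_3^2(r_1^2-r_2^2)^2-r_1^2-r_2^2-r_3^2+1$, $a_1=2r_1r_2r_3(1-2r_3^2(r_1^2+r_2^2))$, $a_2=4r_1^2r_2^2r_3^2$; $v_j=\frac{(r_3+s_3)^j-(r_3-s_3)^j}{(r_3+s_3)^j+(r_3-s_3)^j}$; $f(t)=\frac{\sqrt{x_0-x_1t}-\sqrt{y_0-y_1t}}{\sqrt{x_0-x_1t}+\sqrt{y_0-y_1t}}$ with $x_0=r_1^2(r_3+s_3)^2+r_2^2$, $x_1=2r_1r_2(r_3+s_3)$, $y_0=r_1^2(r_3-s_3)^2+r_2^2$, $y_1=2r_1r_2(r_3-s_3)$. **The sets $K_n$.** The parameter domain consists of the $(r_1,r_2,\alpha)$ with $\alpha\in[0,\pi]$, $1<r_3\le r_2\le r_1$, and $\cos\alpha\le\frac{r_1^2+r_2^2+r_3^2-1}{2r_1r_2r_3}$ (so that $\alpha$ is the angular invariant of an actual triangle group). For $1\le n\le k_0$, $K_n$ is the set of points of this domain satisfying $t_n\le t_k$ for all integers $k\neq n$ with $1\le k\le k_0+1$, and (i) $r_1^2+r_2^2-2r_1r_2r_3t_n\ge0$; (ii) $2r_3^2(r_1^2+r_2^2)-4r_1r_2r_3t_n-1\ge0$; (iii) $a_2t_n^2+a_1t_n+a_0\ge0$;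 (iv) $v_{k_0+2}-f(1)\ge0$. *)

(* Defs.v *)
From HB Require Import structures.
From mathcomp Require Import all_boot all_order all_algebra.
From mathcomp Require Import complex ring.
From mathcomp Require Import all_classical all_reals all_analysis.

Set Implicit Arguments.
Unset Strict Implicit.
Unset Printing Implicit Defensive.

Import Order.TTheory GRing.Theory Num.Theory.
Import numFieldNormedType.Exports.

Local Open Scope classical_set_scope.
Local Open Scope quotient_scope.
Local Open Scope ring_scope.
Local Open Scope complex_scope.

Definition cosh (R : realType) (x : R) : R := (expR x + expR (- x)) / 2.
Definition sinh (R : realType) (x : R) : R := (expR x - expR (- x)) / 2.

Definition boxsum (R : realType) d (g : ('I_d -> nat) -> R) (N : nat) : R :=
  \sum_(nu : {ffun 'I_d -> 'I_N}) g (fun i => nu i : nat).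

(* Near a, f is the sum of a power series in x - a, indexed by the multi-indices
   nu. The sums over the boxes {nu | forall i, nu i < N} are required to be
   absolutely bounded as well: convergence of the box sums alone would not imply
   analyticity. *)
Definition analytic_at (R : realType) d (f : 'rV[R]_d -> R) (a : 'rV[R]_d) :=
  exists c : ('I_d -> nat) -> R,
    let term (x : 'rV[R]_d) (nu : 'I_d -> nat) :=
      c nu * \prod_(i < d) (x 0 i - a 0 i) ^+ nu i in
    \forall x \near a,
      (exists M : R, forall N, boxsum (fun nu => `|term x nu|) N <= M) /\
      boxsum (term x) @ \oo --> f x.

(* Lojasiewicz: around every point of the ambient space (not only of X), X is a
   finite union of finite intersections of sets {f = 0} or {f > 0}. *)
Definition semianalytic (R : realType) d (X : set 'rV[R]_d) :=
  forall a : 'rV[R]_d, exists (U : set 'rV[R]_d) (p q : nat)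
      (eqn : 'I_p -> 'I_q -> bool) (f : 'I_p -> 'I_q -> 'rV[R]_d -> R),
    [/\ open U, U a,
        (forall i j x, U x -> analytic_at (f i j) x) &
        (forall x, U x -> (X x <-> exists i, forall j,
            if eqn i j then f i j x = 0 else 0 < f i j x))].

(* Gamma = <iota_1, iota_2, iota_3 | iota_j^2 = 1> is the set of words in the
   generators modulo the congruence generated by the relators; the inverse of a
   word is its reversal. *)
Inductive Gamma_rel : seq 'I_3 -> seq 'I_3 -> Prop :=
| Gamma_refl w : Gamma_rel w w
| Gamma_sym w1 w2 : Gamma_rel w1 w2 -> Gamma_rel w2 w1
| Gamma_trans w1 w2 w3 : Gamma_rel w1 w2 -> Gamma_rel w2 w3 -> Gamma_rel w1 w3
| Gamma_cancel u v j : Gamma_rel (u ++ [:: j; j] ++ v) (u ++ v).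

Lemma Gamma_rel_cat u1 u2 v1 v2 :
  Gamma_rel u1 u2 -> Gamma_rel v1 v2 -> Gamma_rel (u1 ++ v1) (u2 ++ v2).
Proof.
move=> Hu Hv; apply: (@Gamma_trans _ (u2 ++ v1)).
  elim: Hu => [w|w1 w2 _ +|w1 w2 w3 _ + _ +|u v j];
    [exact: Gamma_refl|exact: Gamma_sym|exact: Gamma_trans|].
  by rewrite -!catA; exact: Gamma_cancel.
elim: Hv => [w|w1 w2 _ +|w1 w2 w3 _ + _ +|u v j];
  [exact: Gamma_refl|exact: Gamma_sym|exact: Gamma_trans|].
by rewrite !(catA u2); exact: Gamma_cancel.
Qed.

Lemma Gamma_rel_rev u v : Gamma_rel u v -> Gamma_rel (rev u) (rev v).
Proof.
elim=> [w|w1 w2 _ +|w1 w2 w3 _ + _ +|{}u {}v j];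
  [exact: Gamma_refl|exact: Gamma_sym|exact: Gamma_trans|].
by rewrite !rev_cat -catA; exact: Gamma_cancel.
Qed.

Lemma Gamma_rel_revl u : Gamma_rel (rev u ++ u) [::].
Proof.
elim: u => [|j u IH]; first exact: Gamma_refl.
rewrite rev_cons cat_rcons; apply: Gamma_trans IH.
exact: (Gamma_cancel (rev u) u j).
Qed.

Definition Gamma_relb (u v : seq 'I_3) : bool := `[< Gamma_rel u v >].

Lemma Gamma_equiv_class : equiv_class_of Gamma_relb.
Proof.
split=> [u|u v|v u w].
- exact/asboolP/Gamma_refl.
- by apply/asboolP/asboolP; exact: Gamma_sym.
- by move=> /asboolP uv /asboolP vw; exact/asboolP/(Gamma_trans uv vw).
Qed.

Canonical Gamma_equiv := EquivRelPack Gamma_equiv_class.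

Definition Gamma : Type := {eq_quot Gamma_equiv}.
HB.instance Definition _ := Choice.on Gamma.
HB.instance Definition _ := Quotient.on Gamma.
HB.instance Definition _ := EqQuotient.on Gamma.

Definition Gamma_one : Gamma := \pi_Gamma [::].
Definition Gamma_mul (x y : Gamma) : Gamma := \pi_Gamma (repr x ++ repr y).
Definition Gamma_inv (x : Gamma) : Gamma := \pi_Gamma (rev (repr x)).

Lemma Gamma_eqP u v : \pi_Gamma u = \pi_Gamma v <-> Gamma_rel u v.
Proof. by split=> [/eqmodP/asboolP|uv] //; exact/eqmodP/asboolP. Qed.

Lemma Gamma_piM u v :
  Gamma_mul (\pi_Gamma u) (\pi_Gamma v) = \pi_Gamma (u ++ v).
Proof.
by apply/Gamma_eqP/Gamma_rel_cat; apply/Gamma_eqP; rewrite reprK.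
Qed.

Lemma Gamma_piV u : Gamma_inv (\pi_Gamma u) = \pi_Gamma (rev u).
Proof. by apply/Gamma_eqP/Gamma_rel_rev/Gamma_eqP; rewrite reprK. Qed.

Lemma Gamma_piP (x : Gamma) : exists u, x = \pi_Gamma u.
Proof. by exists (repr x); rewrite reprK. Qed.

Lemma Gamma_mulA : associative Gamma_mul.
Proof.
move=> x y z; have [[u ->] [v ->] [w ->]] := And3 (Gamma_piP x) (Gamma_piP y)
  (Gamma_piP z).
by rewrite !Gamma_piM catA.
Qed.

Lemma Gamma_mul1 : left_id Gamma_one Gamma_mul.
Proof. by move=> x; have [u ->] := Gamma_piP x; rewrite Gamma_piM. Qed.

Lemma Gamma_mulr1 : right_id Gamma_one Gamma_mul.
Proof. by move=> x; have [u ->] := Gamma_piP x; rewrite Gamma_piM cats0. Qed.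

Lemma Gamma_mulV : left_inverse Gamma_one Gamma_inv Gamma_mul.
Proof.
move=> x; have [u ->] := Gamma_piP x; rewrite Gamma_piV Gamma_piM.
exact/Gamma_eqP/Gamma_rel_revl.
Qed.

Lemma Gamma_mulrV : right_inverse Gamma_one Gamma_inv Gamma_mul.
Proof.
move=> x; have [u ->] := Gamma_piP x; rewrite Gamma_piV Gamma_piM; apply/Gamma_eqP.
by rewrite -{1}[u]revK; exact: Gamma_rel_revl.
Qed.

HB.instance Definition _ := isGroup.Build Gamma Gamma_mulA Gamma_mul1
  Gamma_mulr1 Gamma_mulV Gamma_mulrV.

Definition iota_ (j : 'I_3) : Gamma := \pi_Gamma [:: j].

(* The library only equips the alias R[i]^o with a topology (that of the norm). *)
HB.instance Definition _ (R : realType) := NormedModule.copy R[i] (R[i])^o.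

Definition herm (R : realType) (z w : 'cV[R[i]]_3) : R[i] :=
  z 0 0 * (w 0 0)^* + z 1 0 * (w 1 0)^* - z 2 0 * (w 2 0)^*.

Definition U21_set (R : realType) : set 'M[R[i]]_3 :=
  [set A | A \in unitmx /\
           forall z w, herm (A *m z) (A *m w) = herm z w].

(* set_type carries the topology induced by the space of matrices. *)
Definition U21 (R : realType) : Type := set_type (@U21_set R).

HB.instance Definition _ (R : realType) := Topological.on (U21 R).
HB.instance Definition _ (R : realType) := SubType.on (U21 R).

Definition mkU21 (R : realType) (A : 'M[R[i]]_3) (HA : U21_set A) : U21 R :=
  exist _ A (mem_set HA).

Lemma U21P (R : realType) (A : U21 R) : U21_set (val A).
Proof. exact/set_mem/valP. Qed.

Section U21Group.
Variable R : realType.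

Lemma U21_set1 : U21_set (1%:M : 'M[R[i]]_3).
Proof. by split=> [|z w]; rewrite ?unitmx1 // !mul1mx. Qed.

Lemma U21_setM (A B : 'M[R[i]]_3) : U21_set A -> U21_set B -> U21_set (A *m B).
Proof.
move=> [Au AU] [Bu BU]; split=> [|z w]; first by rewrite unitmx_mul Au.
by rewrite -!mulmxA AU BU.
Qed.

Lemma U21_setV (A : 'M[R[i]]_3) : U21_set A -> U21_set (invmx A).
Proof.
move=> [Au AU]; split=> [|z w]; first by rewrite unitmx_inv.
by rewrite -AU !mulmxA mulmxV // !mul1mx.
Qed.

Definition U21_one : U21 R := mkU21 U21_set1.
Definition U21_mul (A B : U21 R) : U21 R := mkU21 (U21_setM (U21P A) (U21P B)).
Definition U21_inv (A : U21 R) : U21 R := mkU21 (U21_setV (U21P A)).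

Lemma U21_mulA : associative U21_mul.
Proof. by move=> A B C; apply: val_inj; rewrite /= mulmxA. Qed.
Lemma U21_mul1 : left_id U21_one U21_mul.
Proof. by move=> A; apply: val_inj; rewrite /= mul1mx. Qed.
Lemma U21_mulr1 : right_id U21_one U21_mul.
Proof. by move=> A; apply: val_inj; rewrite /= mulmx1. Qed.
Lemma U21_mulV : left_inverse U21_one U21_inv U21_mul.
Proof.
by move=> A; apply: val_inj; rewrite /= mulVmx //; case: (U21P A).
Qed.
Lemma U21_mulrV : right_inverse U21_one U21_inv U21_mul.
Proof.
by move=> A; apply: val_inj; rewrite /= mulmxV //; case: (U21P A).
Qed.

HB.instance Definition _ := isGroup.Build (U21 R) U21_mulA U21_mul1
  U21_mulr1 U21_mulV U21_mulrV.

Definition PU21_rel (A B : U21 R) : bool :=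
  `[< exists c : R[i], c != 0 /\ val A = c *: val B >].

Lemma PU21_equiv_class : equiv_class_of PU21_rel.
Proof.
have sym A B : PU21_rel A B -> PU21_rel B A.
  move=> /asboolP[c [c0 cE]]; apply/asboolP; exists c^-1.
  by rewrite invr_eq0 c0 cE scalerA mulVf // scale1r.
split=> [A|A B|B A C].
- by apply/asboolP; exists 1; rewrite oner_neq0 scale1r.
- by apply/idP/idP; exact: sym.
- move=> /asboolP[c [c0 cE]] /asboolP[d [d0 dE]]; apply/asboolP.
  by exists (c * d); rewrite mulf_neq0 // cE dE scalerA.
Qed.

Canonical PU21_equiv := EquivRelPack PU21_equiv_class.

End U21Group.

(* PU(2,1) = U(2,1) / scalars, with the quotient topology. *)
Definition PU21 (R : realType) : Type :=
  quotient_topology {eq_quot (@PU21_equiv R)}.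
HB.instance Definition _ (R : realType) := Topological.on (PU21 R).
HB.instance Definition _ (R : realType) := Quotient.on (PU21 R).

Section PU21Group.
Variable R : realType.
Notation PU := (PU21 R).

Definition PU21_one : PU := \pi_PU (1%g : U21 R).
Definition PU21_mul (x y : PU) : PU := \pi_PU (repr x * repr y)%g.
Definition PU21_inv (x : PU) : PU := \pi_PU ((repr x)^-1)%g.

Lemma PU21_eqP (A B : U21 R) :
  \pi_PU A = \pi_PU B <-> exists c : R[i], c != 0 /\ val A = c *: val B.
Proof.
split=> [|AB]; first by move=> /(eqmodP (PU21_equiv R))/asboolP.
exact/(eqmodP (PU21_equiv R))/asboolP.
Qed.

Lemma PU21_piM (A B : U21 R) :
  PU21_mul (\pi_PU A) (\pi_PU B) = \pi_PU (A * B)%g.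
Proof.
have /PU21_eqP[c [c0 cE]] := reprK (\pi_PU A).
have /PU21_eqP[d [d0 dE]] := reprK (\pi_PU B).
apply/PU21_eqP; exists (c * d); split; first by rewrite mulf_neq0.
by rewrite /= cE dE -scalemxAl -scalemxAr scalerA.
Qed.

Lemma PU21_piV (A : U21 R) : PU21_inv (\pi_PU A) = \pi_PU (A^-1)%g.
Proof.
have /PU21_eqP[c [c0 cE]] := reprK (\pi_PU A).
apply/PU21_eqP; exists c^-1; split; first by rewrite invr_eq0.
by rewrite /= cE invmxZ // unitmxZ ?unitfE //; case: (U21P A).
Qed.

Lemma PU21_piP (x : PU) : exists A, x = \pi_PU A.
Proof. by exists (repr x); rewrite reprK. Qed.

Lemma PU21_mulA : associative PU21_mul.
Proof.
move=> x y z; have [[A ->] [B ->] [C ->]] := And3 (PU21_piP x) (PU21_piP y)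
  (PU21_piP z).
by rewrite !PU21_piM mulgA.
Qed.

Lemma PU21_mul1 : left_id PU21_one PU21_mul.
Proof. by move=> x; have [A ->] := PU21_piP x; rewrite PU21_piM mul1g. Qed.

Lemma PU21_mulr1 : right_id PU21_one PU21_mul.
Proof. by move=> x; have [A ->] := PU21_piP x; rewrite PU21_piM mulg1. Qed.

Lemma PU21_mulV : left_inverse PU21_one PU21_inv PU21_mul.
Proof.
by move=> x; have [A ->] := PU21_piP x; rewrite PU21_piV PU21_piM mulVg.
Qed.

Lemma PU21_mulrV : right_inverse PU21_one PU21_inv PU21_mul.
Proof.
by move=> x; have [A ->] := PU21_piP x; rewrite PU21_piV PU21_piM mulgV.
Qed.

HB.instance Definition _ := isGroup.Build PU PU21_mulA PU21_mul1
  PU21_mulr1 PU21_mulV PU21_mulrV.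

End PU21Group.

(* A point of the projective plane is a line of C^3, as a {vspace}. *)
Notation pline R := {vspace 'cV[R[i]]_3}.

Definition H2C (R : realType) : set (pline R) :=
  [set <[z]>%VS | z in [set z | herm z z < 0]].

Definition bdH2C (R : realType) : set (pline R) :=
  [set <[z]>%VS | z in [set z | z != 0 /\ herm z z = 0]].

Definition proj_perp (R : realType) (n : 'cV[R[i]]_3) : set (pline R) :=
  [set <[z]>%VS | z in [set z | z != 0 /\ herm z n = 0]].

(* The distance of two points of H2C: the d >= 0 such that
   cosh^2(d/2) = <z,w><w,z> / (<z,z><w,w>) for representatives z and w. *)
Definition rho (R : realType) (p q : pline R) : R :=
  let z := vpick p in let w := vpick q in
  xget 0 [set d : R | 0 <= d /\
    ((cosh (d / 2) ^+ 2)%:C =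
       herm z w * herm w z / (herm z z * herm w w))%R].

Definition set_dist (R : realType) (C D : set (pline R)) : R :=
  inf [set rho p q | p in C & q in D].

(* Independent of the representative matrix, as proportional matrices act in the
   same way on lines. *)
Definition act (R : realType) (g : PU21 R) (p : pline R) : pline R :=
  (linfun (mulmx (val (repr g)) : 'cV[R[i]]_3 -> 'cV[R[i]]_3) @: p)%VS.

Definition bdfix (R : realType) (g : PU21 R) : set (pline R) :=
  [set p | bdH2C p /\ act g p = p].

Definition parabolic (R : realType) (g : PU21 R) : Prop :=
  exists p, bdfix g = [set p].

Definition loxodromic (R : realType) (g : PU21 R) : Prop :=
  exists p q, p <> q /\ bdfix g = [set p] `|` [set q].

Definition elliptic (R : realType) (g : PU21 R) : Prop :=
  ~ parabolic g /\ ~ loxodromic g.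

(* The complex geodesic with polar vector n (for n positive). *)
Definition cgeod (R : realType) (n : 'cV[R[i]]_3) : set (pline R) :=
  H2C (R := R) `&` proj_perp n.

(* The complex geodesic together with its points at infinity. *)
Definition cgeod_closure (R : realType) (n : 'cV[R[i]]_3) : set (pline R) :=
  (H2C (R := R) `|` bdH2C (R := R)) `&` proj_perp n.

Definition ultra_parallel (R : realType) (n n' : 'cV[R[i]]_3) : Prop :=
  cgeod_closure n `&` cgeod_closure n' = set0.

Definition asymptotic (R : realType) (n n' : 'cV[R[i]]_3) : Prop :=
  cgeod_closure n `&` cgeod_closure n' !=set0 /\
  cgeod_closure n `&` cgeod_closure n' `<=` bdH2C (R := R).

Definition reflv (R : realType) (n z : 'cV[R[i]]_3) : 'cV[R[i]]_3 :=
  - z + (2 * (herm z n / herm n n)) *: n.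

Section ComplexReflection.
Variable R : realType.
Implicit Types (n z w : 'cV[R[i]]_3) (a : R[i]).

Lemma hermDl z w n : herm (z + w) n = herm z n + herm w n.
Proof. by rewrite /herm !mxE; ring. Qed.

Lemma hermZl a z n : herm (a *: z) n = a * herm z n.
Proof. by rewrite /herm !mxE; ring. Qed.

Lemma herm_conj z w : (herm z w)^* = herm w z.
Proof.
rewrite /herm !rmorphB !rmorphD !rmorphM /= !conjcK.
by ring.
Qed.

Lemma hermNl z n : herm (- z) n = - herm z n.
Proof. by rewrite /herm !mxE; ring. Qed.

Lemma hermDr z w n : herm n (z + w) = herm n z + herm n w.
Proof. by rewrite -herm_conj hermDl rmorphD /= !herm_conj. Qed.

Lemma hermNr z n : herm n (- z) = - herm n z.
Proof. by rewrite -herm_conj hermNl rmorphN /= herm_conj. Qed.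

Lemma hermZr a z n : herm n (a *: z) = a^* * herm n z.
Proof. by rewrite -herm_conj hermZl rmorphM /= !herm_conj. Qed.

Lemma reflv_lin n a z w : reflv n (a *: z + w) = a *: reflv n z + reflv n w.
Proof.
apply/colP=> i; rewrite /reflv hermDl hermZl !mxE; ring.
Qed.

Lemma reflvK n : involutive (reflv n).
Proof.
move=> z; rewrite /reflv hermDl hermNl hermZl; apply/colP=> i; rewrite !mxE.
have [->|k0] := eqVneq (herm n n) 0; first by rewrite !invr0; ring.
by field.
Qed.

Lemma reflv_herm n z w : herm (reflv n z) (reflv n w) = herm z w.
Proof.
have kC : (herm n n)^* = herm n n by rewrite herm_conj.
rewrite /reflv !(hermDl, hermNl, hermZl, hermDr, hermNr, hermZr).
have conjE (x : R[i]) : Num.conj x = x^* by [].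
rewrite !rmorphM fmorphV rmorph_nat /= !conjE kC herm_conj.
have [->|k0] := eqVneq (herm n n) 0; first by rewrite !invr0; ring.
by field.
Qed.

Definition refl_mx n : 'M[R[i]]_3 :=
  \matrix_(i, j) reflv n (delta_mx j 0) i 0.

Lemma refl_mxE n z : refl_mx n *m z = reflv n z.
Proof.
have -> : refl_mx n *m z = \sum_j z j 0 *: reflv n (delta_mx j 0).
  by apply/colP=> i; rewrite !mxE summxE; apply: eq_bigr => j _; rewrite !mxE mulrC.
have {2}-> : z = \sum_j z j 0 *: delta_mx j 0.
  by rewrite [LHS]matrix_sum_delta; apply: eq_bigr => j _; rewrite big_ord1.
elim/big_rec2: _ => [|j v y _ ->]; last by rewrite reflv_lin.
by rewrite /reflv -[0](scale0r n) hermZl !scale0r !(mul0r, mulr0, scale0r) oppr0 addr0.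
Qed.

Lemma refl_mx_U21 n : U21_set (refl_mx n).
Proof.
split=> [|z w]; last by rewrite !refl_mxE reflv_herm.
suff /mulmx1_unit[] : refl_mx n *m refl_mx n = 1%:M by [].
apply/matrixP=> i j.
have := congr1 (fun v : 'cV_3 => v i 0) (reflvK n (delta_mx j 0)).
rewrite -!refl_mxE mulmxA -colE !mxE => ->.
by rewrite eqxx andbT.
Qed.

Definition crefl n : PU21 R := \pi_(PU21 R) (mkU21 (refl_mx_U21 n)).

End ComplexReflection.

(* The complex number z has argument a, in the convention a \in ]-pi, pi]. *)
Definition is_arg (R : realType) (z : R[i]) (a : R) : Prop :=
  [/\ z != 0, - pi < a <= pi & z = `|z| * (cos a +i* sin a)].

(* The indices 1, 2, 3 are the elements 0, 1, 2 of 'I_3 = Z/3Z, so that j - 1 and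
   j + 1 are taken mod 3. *)
Definition triangle_rep (R : realType) (m : 'I_3 -> R)
    (n : 'I_3 -> 'cV[R[i]]_3) (phi : {multiplicative Gamma -> PU21 R}) : Prop :=
  [/\ [/\ m 0 >= m 1, m 1 >= m 2 & m 2 >= 0],
      forall j, 0 < herm (n j) (n j),
      forall j, phi (iota_ j) = crefl (n j),
      forall j k, j != k -> cgeod (n j) <> cgeod (n k) /\
        (ultra_parallel (n j) (n k) \/ asymptotic (n j) (n k)) &
      forall j, set_dist (cgeod (n (j - 1))) (cgeod (n (j + 1))) = m j].

Definition discrete_rep (R : realType) (phi : Gamma -> PU21 R) : Prop :=
  isolated (range phi) = range phi.

Definition faithful_rep (R : realType) (phi : Gamma -> PU21 R) : Prop :=
  injective phi.

Definition angular_invariant (R : realType) (n : 'I_3 -> 'cV[R[i]]_3) (a : R) :=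
  is_arg (herm (n 0) (n 2) * herm (n 1) (n 0) * herm (n 2) (n 1)) a.

Definition triple (T : Type) (x y z : T) (j : 'I_3) : T :=
  tnth [tuple x; y; z] j.

Section KSets.
Variable R : realType.
Implicit Types (r s alpha t : R) (n k j : nat).

Definition beta r1 r2 r3 s3 alpha : R[i] :=
  (s3^-1)%:C * ((r1 * r3)%:C - r2%:C * (cos alpha -i* sin alpha)).

Definition polar_vec r1 r2 r3 s3 alpha : 'I_3 -> 'cV[R[i]]_3 :=
  let b := beta r1 r2 r3 s3 alpha in
  triple (\col_i triple 0 r3%:C s3%:C i)
         (\col_i triple 0 1 0 i)
         (\col_i triple (Num.sqrt (Normc.normc b ^+ 2 - r1 ^+ 2 + 1))%:C
                        r1%:C b i).

Definition A0 r1 r2 r3 s3 n : R := (r3 - s3) ^+ (2 * n + 2) *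
  ((2 * r1 ^+ 2 * r3 ^+ 2 - r1 ^+ 2 + r2 ^+ 2) * s3
   + 2 * r1 ^+ 2 * r3 * (r3 ^+ 2 - 1)).

Definition A1 r1 r2 r3 s3 n : R := (r3 + s3) ^+ (2 * n + 2) *
  ((2 * r1 ^+ 2 * r3 ^+ 2 - r1 ^+ 2 + r2 ^+ 2) * s3
   - 2 * r1 ^+ 2 * r3 * (r3 ^+ 2 - 1)).

Definition A2 r1 r2 r3 s3 : R :=
  - 2 * s3 * (r1 ^+ 2 + r2 ^+ 2 + 2 * r3 ^+ 2 - 2).

Definition t_ r1 r2 r3 s3 n : R :=
  (A0 r1 r2 r3 s3 n + A1 r1 r2 r3 s3 n + A2 r1 r2 r3 s3) /
  (2 * r1 * r2 * s3 *
    ((r3 + s3) ^+ (2 * n + 1) + (r3 - s3) ^+ (2 * n + 1) - 2 * r3)).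

Definition a0 r1 r2 r3 : R :=
  4 * r1 ^+ 2 * r2 ^+ 2 * r3 ^+ 4 + r3 ^+ 2 * (r1 ^+ 2 - r2 ^+ 2) ^+ 2
  - r1 ^+ 2 - r2 ^+ 2 - r3 ^+ 2 + 1.

Definition a1 r1 r2 r3 : R :=
  2 * r1 * r2 * r3 * (1 - 2 * r3 ^+ 2 * (r1 ^+ 2 + r2 ^+ 2)).

Definition a2 r1 r2 r3 : R := 4 * r1 ^+ 2 * r2 ^+ 2 * r3 ^+ 2.

Definition v_ r3 s3 j : R :=
  ((r3 + s3) ^+ j - (r3 - s3) ^+ j) / ((r3 + s3) ^+ j + (r3 - s3) ^+ j).

Definition x0 r1 r2 r3 s3 : R := r1 ^+ 2 * (r3 + s3) ^+ 2 + r2 ^+ 2.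
Definition x1 r1 r2 r3 s3 : R := 2 * r1 * r2 * (r3 + s3).
Definition y0 r1 r2 r3 s3 : R := r1 ^+ 2 * (r3 - s3) ^+ 2 + r2 ^+ 2.
Definition y1 r1 r2 r3 s3 : R := 2 * r1 * r2 * (r3 - s3).

Definition f_ r1 r2 r3 s3 t : R :=
  let x := Num.sqrt (x0 r1 r2 r3 s3 - x1 r1 r2 r3 s3 * t) in
  let y := Num.sqrt (y0 r1 r2 r3 s3 - y1 r1 r2 r3 s3 * t) in
  (x - y) / (x + y).

Definition domain r1 r2 r3 alpha : Prop :=
  [/\ 0 <= alpha <= pi, 1 < r3, r3 <= r2, r2 <= r1 &
      cos alpha <= (r1 ^+ 2 + r2 ^+ 2 + r3 ^+ 2 - 1) / (2 * r1 * r2 * r3)].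

(* The left-hand sides of the inequalities "... >= 0" that cut K_n out of the
   domain. *)
Definition K_lhs r1 r2 r3 s3 (k0 n : nat) : seq R :=
  let t := t_ r1 r2 r3 s3 in
  [seq t k - t n | k <- iota 1 k0.+1 & k != n] ++
  [:: r1 ^+ 2 + r2 ^+ 2 - 2 * r1 * r2 * r3 * t n;
      2 * r3 ^+ 2 * (r1 ^+ 2 + r2 ^+ 2) - 4 * r1 * r2 * r3 * t n - 1;
      a2 r1 r2 r3 * t n ^+ 2 + a1 r1 r2 r3 * t n + a0 r1 r2 r3;
      v_ r3 s3 (k0 + 2) - f_ r1 r2 r3 s3 1].

Definition in_K r1 r2 r3 s3 alpha (k0 n : nat) : Prop :=
  let t := t_ r1 r2 r3 s3 in
  domain r1 r2 r3 alpha /\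
  (forall k : nat, (1 <= k <= k0.+1)%N -> k != n -> t n <= t k) /\
  [/\ r1 ^+ 2 + r2 ^+ 2 - 2 * r1 * r2 * r3 * t n >= 0,
      2 * r3 ^+ 2 * (r1 ^+ 2 + r2 ^+ 2) - 4 * r1 * r2 * r3 * t n - 1 >= 0,
      a2 r1 r2 r3 * t n ^+ 2 + a1 r1 r2 r3 * t n + a0 r1 r2 r3 >= 0 &
      v_ r3 s3 (k0 + 2) - f_ r1 r2 r3 s3 1 >= 0].

(* In the coordinates p = (m1, m2, alpha) of R^3. *)
Definition K (m3 : R) (k0 n : nat) : set 'rV[R]_3 :=
  [set p | [/\ 0 <= p 0 0, 0 <= p 0 1 &
     in_K (cosh (p 0 0 / 2)) (cosh (p 0 1 / 2)) (cosh (m3 / 2)) (sinh (m3 / 2))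
          (p 0 2) k0 n]].

Definition polar_of (m3 : R) (p : 'rV[R]_3) : 'I_3 -> 'cV[R[i]]_3 :=
  polar_vec (cosh (p 0 0 / 2)) (cosh (p 0 1 / 2)) (cosh (m3 / 2))
    (sinh (m3 / 2)) (p 0 2).

End KSets.

(* Main.v *)
(** Let L be the complex line z_1 = 0, which R_1 and R_2 preserve; on it they act
    as half-turns generating an infinite dihedral group of an axis. Let V be the
    inverse image, under the orthogonal projection to L, of the disc of L cut out
    by |<z, n_3>_L|^2 < e q_L(z), where e = |(n_3)_1|^2. If e >= 1 then R_3 maps
    the complement of V into V, and V is disjoint from its translates under the
    dihedral group as soon as the vector n_3 is far from its images: then a
    ping-pong argument on reduced words shows that the group is discrete and the
    free product of its three generators. For the half-turns R_1 (R_2 R_1)^k the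
    distance condition says that the product with R_3 is non-elliptic, that is
    cos alpha <= t_k; on K_n it follows from the case k = n for k <= k_0 + 1, from
    (iv) for larger k, and from r_1, r_2 > 1 for the half-turns with k <= 0. For
    the translations it follows from (ii) and (iii), and e >= 1 follows from (i).
    Conversely, an elliptic product of two reflections has eigenvalues of modulus
    1, so that its powers return arbitrarily close to the identity, while the
    corresponding element of Gamma has infinite order. *)

(* Ping-pong alone shows that non-trivial reduced words act non-trivially; discreteness asks for a
   neighbourhood in [PU21] of each image that misses all the others. To get it, two test points are
   placed in two different translates of V. A reduced word ending in R_3 moves both into one common
   translate, so it cannot keep each in its own; a word with another ending is first conjugated by
   R_3. Keeping the points in place is a strict inequality, stable under scaling of the matrix,
   hence an open condition in the quotient. The constants t_n and v_j come from one function. Put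
   theta = m_3/2 and let P, Q be the squared moduli of the null coordinates of n_3 on L. For the
   k-th half-turn, with polar vector c, 4 (|<n_3, c>|^2 - 1) = F(k) - 2 (1 + e), where F(k) = P e^(2
   k theta) + Q e^(-2 k theta). This is affine in cos alpha, and t_n is its zero for k = n + 1.
   Condition (iv) places the minimum of F over real k at or before k_0 + 2. Conditions (ii) and
   (iii) say that the quadratic governing the translations is nonincreasing up to t_n and
   nonnegative there. *)
Require Import Defs.
From HB Require Import structures.
From mathcomp Require Import all_boot all_order all_algebra.
From mathcomp Require Import complex ring lra zify.
From mathcomp Require Import all_classical all_reals all_analysis.
Set Implicit Arguments.
Unset Strict Implicit.
Unset Printing Implicit Defensive.
Import Order.TTheory GRing.Theory Num.Theory.
Import numFieldNormedType.Exports.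
Local Open Scope classical_set_scope.
Local Open Scope quotient_scope.
Local Open Scope ring_scope.
Local Open Scope complex_scope.
Local Notation Re := complex.Re.
Local Notation Im := complex.Im.
Local Notation "x ^*" := (conjc x) : ring_scope.

(** * The Hermitian form *)

Section HermitianForm.
Variable R : realType.
Implicit Types (x y c : R[i]) (z w n v : 'cV[R[i]]_3).

(** Real-valued, unlike [|x|], so that order arguments take place in [R]. *)
Definition csq (x : R[i]) : R := Re x ^+ 2 + Im x ^+ 2.

Lemma realcD (a b : R) : (a + b)%:C = a%:C + b%:C.
Proof. exact: rmorphD. Qed.

Lemma realcB (a b : R) : (a - b)%:C = a%:C - b%:C.
Proof. exact: rmorphB. Qed.

Lemma realcM (a b : R) : (a * b)%:C = a%:C * b%:C.
Proof. exact: rmorphM. Qed.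

Lemma realcV (a : R) : (a^-1)%:C = a%:C^-1.
Proof. exact: fmorphV. Qed.

Lemma realc_eq0 (a : R) : (a%:C == 0) = (a == 0).
Proof. by rewrite eq_complex /= eqxx andbT. Qed.

Lemma conj0c : (0 : R[i])^* = 0.
Proof. exact: rmorph0. Qed.

Lemma conjcD x y : (x + y)^* = x^* + y^*.
Proof. exact: rmorphD. Qed.

Lemma conjcN x : (- x)^* = - x^*.
Proof. exact: rmorphN. Qed.

Lemma conjcB x y : (x - y)^* = x^* - y^*.
Proof. exact: rmorphB. Qed.

Lemma conjcM x y : (x * y)^* = x^* * y^*.
Proof. exact: rmorphM. Qed.

Lemma mulcJ x : x * x^* = (csq x)%:C.
Proof. by case: x => a b; apply/eqP; rewrite eq_complex /csq /=; apply/andP; split; apply/eqP; ring. Qed.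

Lemma csq_ge0 x : 0 <= csq x.
Proof. by rewrite addr_ge0 // sqr_ge0. Qed.

Lemma csqM x y : csq (x * y) = csq x * csq y.
Proof. by case: x y => a b [c d]; rewrite /csq /=; ring. Qed.

Lemma csqN x : csq (- x) = csq x.
Proof. by case: x => a b; rewrite /csq /=; ring. Qed.

Lemma csqJ x : csq x^* = csq x.
Proof. by case: x => a b; rewrite /csq /=; ring. Qed.

Lemma csqR (a : R) : csq a%:C = a ^+ 2.
Proof. by rewrite /csq /=; ring. Qed.

Lemma csq0 : csq 0 = 0. Proof. by rewrite /csq /= !expr0n addr0. Qed.

Lemma csq1 : csq 1 = 1. Proof. by rewrite /csq /= expr1n expr0n addr0. Qed.

Lemma csq_eq0 x : (csq x == 0) = (x == 0).
Proof. by rewrite paddr_eq0 ?sqr_ge0 // !sqrf_eq0 eq_complex. Qed.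

Lemma csq_gt0 x : (0 < csq x) = (x != 0).
Proof. by rewrite lt0r csq_eq0 csq_ge0 andbT. Qed.

Lemma csqV x : csq x^-1 = (csq x)^-1.
Proof.
have [->|x0] := eqVneq x 0; first by rewrite !(invr0, csq0).
have c0 : csq x != 0 by rewrite csq_eq0.
by apply: (mulfI c0); rewrite -csqM !mulfV // csq1.
Qed.

Lemma csqX x k : csq (x ^+ k) = csq x ^+ k.
Proof. by elim: k => [|k IH]; rewrite ?expr0 ?csq1 // !exprS csqM IH. Qed.

Lemma csqD x y : csq (x + y) = csq x + csq y + 2 * Re (x * y^*).
Proof. by case: x y => a b [c d]; rewrite /csq /=; ring. Qed.

(** The triangle inequality in squared form, which avoids square roots of [csq]. *)
Lemma csqD_le x y a b : 0 <= a -> 0 <= b -> csq x <= a ^+ 2 -> csq y <= b ^+ 2 ->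
  csq (x + y) <= (a + b) ^+ 2.
Proof.
move=> a0 b0 xa yb; rewrite csqD.
suff H : Re (x * y^*) <= a * b by nra.
apply: le_trans (ler_norm _) _.
rewrite -ler_sqr ?nnegrE ?mulr_ge0 // real_normK ?num_real //.
apply: (@le_trans _ _ (csq x * csq y)).
  by rewrite -(csqJ y) -csqM /csq lerDl sqr_ge0.
by rewrite exprMn ler_pM ?csq_ge0.
Qed.

Lemma csqE_normc x : csq x = Normc.normc x ^+ 2.
Proof. by case: x => a b; rewrite /= sqr_sqrtr // addr_ge0 ?sqr_ge0. Qed.

Lemma normcE_csq x : `|x| = (Num.sqrt (csq x))%:C.
Proof. by rewrite normc_def. Qed.

Definition hq z : R := csq (z 0 0) + csq (z 1 0) - csq (z 2 0).

Lemma herm_conjc z w :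
  herm z w = z 0 0 * (w 0 0)^* + z 1 0 * (w 1 0)^* - z 2 0 * (w 2 0)^*.
Proof. by []. Qed.

Lemma hermE z : herm z z = (hq z)%:C.
Proof. by rewrite /herm !mulcJ -realcD -realcB. Qed.

Lemma hermBl z w n : herm (z - w) n = herm z n - herm w n.
Proof. by rewrite hermDl hermNl. Qed.

Lemma hermBr z w n : herm n (z - w) = herm n z - herm n w.
Proof. by rewrite hermDr hermNr. Qed.

Lemma csq_hermC z w : csq (herm z w) = csq (herm w z).
Proof. by rewrite -herm_conj csqJ. Qed.

Lemma hqZ c z : hq (c *: z) = csq c * hq z.
Proof. by rewrite /hq !mxE !csqM; ring. Qed.

Lemma hqD z w : hq (z + w) = hq z + hq w + 2 * Re (herm z w).
Proof.
have : herm (z + w) (z + w) = herm z z + herm w w + (herm z w + (herm z w)^*).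
  by rewrite herm_conj !(hermDl, hermDr); ring.
move=> /(congr1 (@Re R)); rewrite !hermE addcJ.
case: (herm z w) => a b /= ->; ring.
Qed.

Lemma hq0 : hq 0 = 0. Proof. by rewrite /hq !mxE csq0; ring. Qed.

Lemma col3_eq0 z : z 0 0 = 0 -> z 1 0 = 0 -> z 2 0 = 0 -> z = 0.
Proof.
move=> h0 h1 h2; apply/colP => i; rewrite mxE.
by case: i => -[|[|[|//]]] lti; [rewrite -[RHS]h0|rewrite -[RHS]h1|rewrite -[RHS]h2];
  congr (z _ 0); apply: val_inj.
Qed.

(** Orthogonality expresses w_2 conj(z_2) through the two positive coordinates; Cauchy-Schwarz for
    these, together with the negativity of z, bounds |w_2|. *)
Lemma herm_orth_neg w z : hq z < 0 -> herm w z = 0 -> w != 0 -> 0 < hq w.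
Proof.
move=> z0 wz w0; rewrite /hq subr_gt0.
have e : w 2 0 * (z 2 0)^* = w 0 0 * (z 0 0)^* + w 1 0 * (z 1 0)^*.
  by apply/eqP; rewrite eq_sym -subr_eq0; apply/eqP.
have := congr1 csq e; rewrite csqM csqJ => {}e.
have cs : csq (w 2 0) * csq (z 2 0) <=
    (csq (w 0 0) + csq (w 1 0)) * (csq (z 0 0) + csq (z 1 0)).
  rewrite e csqD !csqM !csqJ.
  set a := w 0 0; set b := w 1 0; set c := z 0 0; set d := z 1 0.
  (* Lagrange's identity: the gap in the Cauchy-Schwarz inequality is |a d - b c|^2. *)
  have := csq_ge0 (a * d - b * c).
  have -> : csq (a * d - b * c) = csq a * csq d + csq b * csq c
      - 2 * Re (a * c^* * (b * d^*)^*).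
    case: a b c d => [a a'] [b b'] [c c'] [d d'].
    by rewrite /csq /=; ring.
  by lra.
move: z0; rewrite /hq subr_lt0 => z0.
have [p|] := ltrP 0 (csq (w 0 0) + csq (w 1 0)).
  have z2 : 0 < csq (z 2 0) by apply: le_lt_trans z0; rewrite addr_ge0 // csq_ge0.
  rewrite -(ltr_pM2r z2); apply: le_lt_trans cs _.
  by rewrite ltr_pM2l.
move=> le0; have {le0}[] : csq (w 0 0) = 0 /\ csq (w 1 0) = 0.
  by have := csq_ge0 (w 0 0); have := csq_ge0 (w 1 0); lra.
move=> w00 w10; move: cs; rewrite w00 w10 addr0 mul0r => cs.
have z2 : 0 < csq (z 2 0) by apply: le_lt_trans z0; rewrite addr_ge0 // csq_ge0.
have : csq (w 2 0) = 0.
  by apply/eqP; rewrite eq_le csq_ge0 andbT -(pmulr_lle0 _ z2).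
move=> /eqP; rewrite csq_eq0 => /eqP h2.
move/eqP: w00; rewrite csq_eq0 => /eqP h0.
move/eqP: w10; rewrite csq_eq0 => /eqP h1.
by case/eqP: w0; apply: col3_eq0.
Qed.

Lemma herm_orth_neg_ge0 w z : hq z < 0 -> herm w z = 0 -> 0 <= hq w.
Proof.
move=> z0 wz; have [->|w0] := eqVneq w 0; first by rewrite hq0.
by rewrite ltW // (@herm_orth_neg _ z).
Qed.

(** The component of w orthogonal to z has nonnegative square hq w - |<w, z>|^2 / hq z; multiplying
    by hq z < 0 reverses the inequality. *)
Lemma reverse_cauchy_schwarz z w : hq z < 0 -> hq z * hq w <= csq (herm z w).
Proof.
move=> z0; have zN : (hq z)%:C != 0 by rewrite realc_eq0 lt_eqF.
pose v := w - (herm w z / herm z z) *: z.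
have vz : herm v z = 0 by rewrite hermBl hermZl divfK ?subrr // hermE.
have := herm_orth_neg_ge0 z0 vz.
have hv : herm v v = herm w w - herm w z * (herm w z)^* / herm z z.
  rewrite {2}/v hermBr hermZr vz mulr0 subr0 /v hermBl hermZl herm_conj.
  by rewrite mulrAC.
move/(congr1 (@Re R)): hv; rewrite mulcJ !hermE -realcV -realcM -realcB /= => ->.
rewrite csq_hermC subr_ge0 ler_ndivrMr //.
by rewrite mulrC.
Qed.

End HermitianForm.

(** * Ping-pong domains *)

Section PingPongDomain.
Variable R : realType.
Implicit Types (c : R[i]) (z w n y : 'cV[R[i]]_3) (e x : R).

Lemma hq_reflv n z : hq (reflv n z) = hq z.
Proof. by have := congr1 (@Re R) (reflv_herm n z z); rewrite !hermE. Qed.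

Definition hermL z w : R[i] := z 1 0 * (w 1 0)^* - z 2 0 * (w 2 0)^*.
Definition qL z : R := csq (z 2 0) - csq (z 1 0).
Definition inV e y z : Prop := csq (hermL z y) < e * qL z.

Lemma hermLC z w : hermL w z = (hermL z w)^*.
Proof. by rewrite /hermL rmorphB !rmorphM /= !conjcK mulrC [w 2 0 * _]mulrC. Qed.

Lemma hermL_split z w : herm z w = z 0 0 * (w 0 0)^* + hermL z w.
Proof. by rewrite /herm /hermL; ring. Qed.

Lemma hq_qL z : hq z = csq (z 0 0) - qL z.
Proof. by rewrite /hq /qL; ring. Qed.

Lemma hermLE z : hermL z z = (- qL z)%:C.
Proof. by rewrite /hermL !mulcJ -realcB /qL opprB. Qed.

Lemma hermLDr z y1 y2 c :
  hermL z (y1 + c *: y2) = hermL z y1 + c^* * hermL z y2.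
Proof. by rewrite /hermL !mxE !rmorphD !rmorphM /=; ring. Qed.

Lemma qLD y1 y2 c :
  qL (y1 + c *: y2) = qL y1 + csq c * qL y2 - 2 * Re (c^* * hermL y1 y2).
Proof.
rewrite /qL /hermL !mxE.
case: (y1 1 0) (y1 2 0) (y2 1 0) (y2 2 0) c => [a a'] [b b'] [p p'] [q q'] [r r'].
by rewrite /csq /=; ring.
Qed.

(** Lagrange's identity in signature (1,1); dropping the determinant term gives the reverse
    Cauchy-Schwarz inequality on L. *)
Lemma hermL_lagrange z y :
  csq (hermL z y) = csq (z 1 0 * y 2 0 - z 2 0 * y 1 0) + qL z * qL y.
Proof.
rewrite /qL /hermL.
case: (z 1 0) (z 2 0) (y 1 0) (y 2 0) => [a a'] [b b'] [p p'] [q q'].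
by rewrite /csq /=; ring.
Qed.

Lemma inVZ e y c z : c != 0 -> inV e y (c *: z) <-> inV e y z.
Proof.
move=> c0; rewrite /inV.
have -> : hermL (c *: z) y = c * hermL z y by rewrite /hermL !mxE; ring.
have -> : qL (c *: z) = csq c * qL z by rewrite /qL !mxE !csqM; ring.
by rewrite csqM mulrCA ltr_pM2l // csq_gt0.
Qed.

(* The reflection exchanges the region and its complement because
   |B'|^2 - |A'|^2 = |A|^2 - |B|^2 + 2 (2 e - 1) |A + B|^2,
   where A = <z, y>_L, B = z_1 conj(n_1) and A', B' are their images. *)
Lemma inV_reflv n z : hq n = 1 -> 1 <= csq (n 0 0) -> hq z < 0 ->
  ~ inV (csq (n 0 0)) n z -> inV (csq (n 0 0)) n (reflv n z).
Proof.
move=> n1 e1 z0; rewrite /inV => /negP; rewrite -leNgt.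
set e := csq (n 0 0) in e1 *; set A := hermL z n; set B := z 0 0 * (n 0 0)^*.
have hn : hermL n n = (1 - e)%:C.
  by rewrite hermLE; congr (_%:C); move: n1; rewrite hq_qL -/e; lra.
have hz : herm z n / herm n n = A + B.
  by rewrite hermL_split hermE n1 divr1 addrC.
have -> : hermL (reflv n z) n = - A + (2 * (1 - e))%:C * (A + B).
  transitivity (- A + 2 * (herm z n / herm n n) * hermL n n).
    by rewrite /A /reflv /hermL !mxE; ring.
  by rewrite hz hn realcM; ring.
have B' : (reflv n z) 0 0 * (n 0 0)^* = - B + (2 * e)%:C * (A + B).
  transitivity (- B + 2 * (herm z n / herm n n) * (n 0 0 * (n 0 0)^*)).
    by rewrite /B /reflv !mxE; ring.
  by rewrite hz mulcJ -/e realcM; ring.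
have -> : e * qL (reflv n z) = csq (- B + (2 * e)%:C * (A + B)) - e * hq z.
  by rewrite -B' csqM csqJ -/e -(hq_reflv n z) hq_qL; ring.
have -> : e * qL z = csq B - e * hq z.
  by rewrite csqM csqJ -/e hq_qL; ring.
have : csq (- B + (2 * e)%:C * (A + B)) - csq (- A + (2 * (1 - e))%:C * (A + B))
    = csq A - csq B + 2 * (2 * e - 1) * csq (A + B).
  by case: A B {hz B'} => [a a'] [b b']; rewrite /csq /=; ring.
have := csq_ge0 (A + B); set ab := csq (A + B); nra.
Qed.

(** For z in both regions the triangle inequality gives |<z, y1 + c y2>|^2 < 4 e q_L(z) for every
    unimodular c. For the phase c that makes q_L(y1 + c y2) = 2 (e - 1) + 2 |<y1, y2>|, which is at
    least 4 e, the reverse Cauchy-Schwarz inequality says the opposite. *)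
Lemma inV_disjoint e y1 y2 z : 0 <= e -> qL y1 = e - 1 -> qL y2 = e - 1 ->
  (e + 1) ^+ 2 <= csq (hermL y1 y2) -> inV e y1 z -> inV e y2 z -> False.
Proof.
move=> e0 q1 q2; set h := hermL y1 y2 => hh i1 i2.
pose r := Num.sqrt (csq h).
have rr : r ^+ 2 = csq h by rewrite sqr_sqrtr ?csq_ge0.
have r0 : 0 <= r by rewrite sqrtr_ge0.
have re : e + 1 <= r by rewrite -(@ler_sqr R) ?nnegrE // ?rr // addr_ge0.
have rp : 0 < r by apply: lt_le_trans re; rewrite ltr_wpDl.
have rN : r != 0 by rewrite gt_eqF.
pose c := (- r^-1)%:C * h.
have c1 : csq c = 1 by rewrite csqM csqR -rr; field.
have qy : qL (y1 + c *: y2) = 2 * (e - 1) + 2 * r.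
  rewrite qLD c1 q1 q2.
  have -> : c^* * hermL y1 y2 = (- r)%:C.
    rewrite /c conjcM conjc_real -mulrA [_ * h]mulrC mulcJ -rr.
    by rewrite -realcM; congr (_%:C); field.
  by rewrite /=; ring.
have zN : 0 < e * qL z by apply: le_lt_trans i1; rewrite csq_ge0.
have ep : 0 < e by rewrite lt_neqAle e0 andbT; apply: contraTneq zN => <-; rewrite mul0r ltxx.
have qp : 0 < qL z by rewrite -(pmulr_rgt0 _ ep).
have low : 4 * e * qL z <= csq (hermL z (y1 + c *: y2)).
  rewrite hermL_lagrange qy.
  have := csq_ge0 (z 1 0 * (y1 + c *: y2) 2 0 - z 2 0 * (y1 + c *: y2) 1 0).
  nra.
pose a := Num.sqrt (csq (hermL z y1)); pose b := Num.sqrt (csq (hermL z y2)).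
have aa : a ^+ 2 = csq (hermL z y1) by rewrite sqr_sqrtr ?csq_ge0.
have bb : b ^+ 2 = csq (hermL z y2) by rewrite sqr_sqrtr ?csq_ge0.
have a0 : 0 <= a by rewrite sqrtr_ge0.
have b0 : 0 <= b by rewrite sqrtr_ge0.
have := @csqD_le _ (hermL z y1) (c^* * hermL z y2) a b a0 b0.
rewrite csqM csqJ c1 mul1r aa bb -hermLDr => /(_ (lexx _) (lexx _)) up.
rewrite /inV -aa in i1; rewrite /inV -bb in i2.
(* This gives (a + b)^2 <= 2 (a^2 + b^2) < 4 e q_L(z), against [low]. *)
have : 0 <= (a - b) ^+ 2 by rewrite sqr_ge0.
by nra.
Qed.

End PingPongDomain.

(** * The dihedral orbit of n_3 in null coordinates of L *)

Section DihedralOrbit.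
Variable R : realType.
Implicit Types (z w n y : 'cV[R[i]]_3) (e x theta : R) (k c : int) (u : seq 'I_3).

Definition nvec x : 'cV[R[i]]_3 := \col_i triple 0 (cosh x)%:C (sinh x)%:C i.

Lemma nvec0E x : nvec x 0 0 = 0. Proof. by rewrite mxE. Qed.
Lemma nvec1E x : nvec x 1 0 = (cosh x)%:C. Proof. by rewrite mxE. Qed.
Lemma nvec2E x : nvec x 2 0 = (sinh x)%:C. Proof. by rewrite mxE. Qed.
Definition nvecE := (nvec0E, nvec1E, nvec2E).

Lemma coshD_sinh x : cosh x + sinh x = expR x.
Proof. by rewrite /cosh /sinh; field. Qed.

Lemma coshB_sinh x : cosh x - sinh x = expR (- x).
Proof. by rewrite /cosh /sinh; field. Qed.

Lemma cosh2_sinh2 x : cosh x ^+ 2 - sinh x ^+ 2 = 1.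
Proof. by rewrite subr_sqr coshB_sinh coshD_sinh -expRD addNr expR0. Qed.

Lemma nvec_unit x : herm (nvec x) (nvec x) = 1.
Proof.
rewrite hermE /hq !nvecE csq0 !csqR add0r cosh2_sinh2 //.
Qed.

(** Null coordinates of L. The reflection in [nvec x] exchanges them up to the factors e^(-2x) and
    e^(2x), so translations along the axis become diagonal. *)
Definition lcP z : R[i] := z 1 0 - z 2 0.
Definition lcQ z : R[i] := z 1 0 + z 2 0.

Lemma hermL_lc z w : 2 * hermL z w = lcP z * (lcQ w)^* + lcQ z * (lcP w)^*.
Proof. by rewrite /hermL /lcP /lcQ conjcD conjcB; ring. Qed.

Lemma qL_lc z : qL z = - Re (lcP z * (lcQ z)^*).
Proof.
rewrite /qL /lcP /lcQ; case: (z 1 0) (z 2 0) => [a a'] [b b'].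
by rewrite /csq /=; ring.
Qed.

Lemma herm_nvec z x :
  2 * herm z (nvec x) = lcP z * (expR x)%:C + lcQ z * (expR (- x))%:C.
Proof.
rewrite herm_conjc !nvecE conj0c mulr0 add0r !conjc_real -coshD_sinh -coshB_sinh.
by rewrite realcD realcB /lcP /lcQ; ring.
Qed.

Lemma reflv_nvec x z : [/\ reflv (nvec x) z 0 0 = - z 0 0,
  lcP (reflv (nvec x) z) = (expR (- x) ^+ 2)%:C * lcQ z &
  lcQ (reflv (nvec x) z) = (expR x ^+ 2)%:C * lcP z].
Proof.
have ab : (expR x)%:C * (expR (- x))%:C = 1 by rewrite -realcM -expRD subrr expR0.
rewrite /reflv nvec_unit divr1 herm_nvec /lcP /lcQ !mxE /=.
rewrite -[triple 0 _ _ 1]/((cosh x)%:C) -[triple 0 _ _ 2]/((sinh x)%:C).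
rewrite -[triple 0 _ _ 0]/(0 : R[i]) mulr0 addr0; split; first split=> //.
  transitivity (- (z 1 0 - z 2 0) + (lcP z * (expR x)%:C + lcQ z * (expR (- x))%:C)
      * ((cosh x)%:C - (sinh x)%:C)); first by rewrite /lcP /lcQ; ring.
  rewrite -realcB coshB_sinh mulrDl -mulrA ab mulr1 expr2 realcM /lcP /lcQ; ring.
transitivity (- (z 1 0 + z 2 0) + (lcP z * (expR x)%:C + lcQ z * (expR (- x))%:C)
    * ((cosh x)%:C + (sinh x)%:C)); first by rewrite /lcP /lcQ; ring.
rewrite -realcD coshD_sinh mulrDl -[_ * (expR (- x))%:C * _]mulrA.
by rewrite [(expR (- x))%:C * _]mulrC ab mulr1 expr2 realcM /lcP /lcQ; ring.
Qed.

Definition expk theta k : R := expR (2 * theta * k%:~R).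

Lemma expkD theta k c : expk theta (k + c) = expk theta k * expk theta c.
Proof. by rewrite /expk rmorphD /= mulrDr expRD. Qed.

Lemma expk0 theta : expk theta 0 = 1.
Proof. by rewrite /expk mulr0 expR0. Qed.

Lemma expkNK theta k : expk theta k * expk theta (- k) = 1.
Proof. by rewrite -expkD subrr expk0. Qed.

Lemma expk_gt0 theta k : 0 < expk theta k. Proof. exact: expR_gt0. Qed.

Lemma expk1 theta : expk theta 1 = expR theta ^+ 2.
Proof. by rewrite /expk mulr1 mulrC mulr_natr mulr2n expRD. Qed.

Lemma expkN1 theta : expk theta (- 1) = expR (- theta) ^+ 2.
Proof. by rewrite /expk rmorphN mulrN mulr1 mulrC mulr_natr mulr2n opprD expRD. Qed.

(** The two sides are 4 sinh^2(2 theta) and 4 sinh^2(2 theta k): among the non-trivial translations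
    the generating one is the worst case. *)
Lemma sinh_expk_mono theta k : 0 < theta -> k != 0 ->
  (expk theta 1 - expk theta (- 1)) ^+ 2 <= (expk theta k - expk theta (- k)) ^+ 2.
Proof.
move=> t0; wlog k1 : k / 1 <= k.
  move=> H k0; have [k1|k1] := ltP 0 k; first by apply: H => //; lia.
  rewrite -[leRHS]sqrrN opprB -{2}[k]opprK; apply: H; last by rewrite oppr_eq0.
  by lia.
move=> _.
have h1 : expk theta 1 <= expk theta k.
  by rewrite ler_expR ler_pM2l ?mulr_gt0 // ler_int.
have h2 : expk theta (- k) <= expk theta (- 1).
  by rewrite ler_expR ler_pM2l ?mulr_gt0 // ler_int lerN2.
have h3 : expk theta (- 1) <= expk theta 1.
  by rewrite ler_expR ler_pM2l ?mulr_gt0 // ler_int.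
by rewrite ler_sqr ?nnegrE; lra.
Qed.

(** The fourth condition bounds the L-pairing of n with its image under each half-turn below by 1 +
    e. The fifth is the same bound, squared, for the generating translation, with 16 e = 4 (1 + e)^2
    - 4 (1 - e)^2. *)
Definition well_separated theta n : Prop :=
  [/\ 0 < theta, hq n = 1, 1 <= csq (n 0 0),
      forall k, 2 * (1 + csq (n 0 0)) <=
        csq (lcP n) * expk theta k + csq (lcQ n) * expk theta (- k) &
      16 * csq (n 0 0) <= (expk theta 1 - expk theta (- 1)) ^+ 2
        * csq (lcP n) * csq (lcQ n)].

(** Describes the L-part of a dihedral image y of n: [s] tells whether a half-turn, which exchanges
    the null coordinates, has been applied, and [c] is the position on the axis in steps of 2 theta.
    The region [inV e y] depends on nothing else of y. *)
Definition has_state theta n (s : bool) c y : Prop :=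
  qL y = csq (n 0 0) - 1 /\
  (lcP y = (expk theta (- c))%:C * (if s then lcQ n else lcP n) /\
   lcQ y = (expk theta c)%:C * (if s then lcP n else lcQ n)).

Lemma has_state_refl theta n s c y x k : (expR x ^+ 2 = expk theta k) ->
  has_state theta n s c y ->
  has_state theta n (~~ s) (k - c) (reflv (nvec x) y).
Proof.
move=> xk [qy [Py Qy]].
have xNk : expR (- x) ^+ 2 = expk theta (- k).
  by rewrite expRN exprVn xk; apply: (mulfI (lt0r_neq0 (expk_gt0 theta k)));
     rewrite expkNK mulfV // gt_eqF // expk_gt0.
have [h0 hP hQ] := reflv_nvec x y; split.
  have := hq_reflv (nvec x) y; rewrite !hq_qL h0 csqN.
  by rewrite -qy => /addrI/oppr_inj.
rewrite hP hQ Py Qy xk xNk opprB !mulrA -!realcM -!expkD.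
by rewrite [- k + c]addrC; case: s {Py Qy}.
Qed.

(** One of the states may be taken to be a translation. Against a half-turn the pairing is real and
    the fourth condition applies. Against another translation, with z = lcP n conj(lcQ n) and a b =
    1, |2 <y1, y2>|^2 = 4 (Re z)^2 + (a - b)^2 |z|^2, where Re z = 1 - e, and the fifth condition
    applies. *)
Lemma states_far theta n s1 c1 s2 c2 y1 y2 : well_separated theta n ->
  ~~ (s1 && s2) -> (s1, c1) != (s2, c2) ->
  has_state theta n s1 c1 y1 -> has_state theta n s2 c2 y2 ->
  (csq (n 0 0) + 1) ^+ 2 <= csq (hermL y1 y2).
Proof.
move=> [t0 n1 e1 hk ht]; wlog s1F : s1 c1 s2 c2 y1 y2 / s1 = false.
  move=> H; case s1E : s1; case s2E : s2 => //= _ neq st1 st2.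
    by rewrite hermLC csqJ; apply: (H false c2 true c1); rewrite // eq_sym.
  + by apply: (H false c1 true c2).
  + by apply: (H false c1 false c2).
rewrite {s1}s1F => _ neq [q1 [P1 Q1]] [q2 [P2 Q2]].
have P2C := congr1 (@conjc R) P2; have Q2C := congr1 (@conjc R) Q2.
rewrite conjcM conjc_real in P2C; rewrite conjcM conjc_real in Q2C.
have E := hermL_lc y1 y2; rewrite P1 Q1 P2C Q2C in E.
have c4 : csq (2 * hermL y1 y2) = 4 * csq (hermL y1 y2).
  by rewrite csqM; congr (_ * _); rewrite /csq /=; ring.
case: s2 neq P2 Q2 P2C Q2C E => neq P2 Q2 P2C Q2C E.
  have {}E : 2 * hermL y1 y2 = (csq (lcP n) * expk theta (c2 - c1)
       + csq (lcQ n) * expk theta (- (c2 - c1)))%:C.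
    rewrite E realcD !realcM opprB !expkD !realcM -!mulcJ; ring.
  move: c4; rewrite E csqR => c4.
  have := hk (c2 - c1); nra.
pose z := lcP n * (lcQ n)^*.
have zR : Re z = 1 - csq (n 0 0) by have := n1; rewrite hq_qL qL_lc -/z; lra.
have zz : csq (lcP n) * csq (lcQ n) = csq z by rewrite csqM csqJ.
have k0 : c2 - c1 != 0.
  by apply: contraNneq neq => /subr0_eq ->.
have {}E : 2 * hermL y1 y2 = (expk theta (c2 - c1))%:C * z +
    (expk theta (- (c2 - c1)))%:C * z^*.
  by rewrite E opprB !expkD !realcM /z conjcM conjcK; ring.
have ab := expkNK theta (c2 - c1).
have mono := sinh_expk_mono t0 k0.
move: c4; rewrite E.
move: (expk theta (c2 - c1)) (expk theta (- (c2 - c1))) ab mono => a b ab mono.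
have -> : csq (a%:C * z + b%:C * z^*) =
    4 * (a * b) * Re z ^+ 2 + (a - b) ^+ 2 * csq z.
  by case: (z) => p q; rewrite /csq /=; ring.
rewrite ab mulr1 zR -zz.
move: ht; set X := csq (lcP n) * csq (lcQ n) => ht.
have X0 : 0 <= X by rewrite mulr_ge0 // csq_ge0.
have : (expk theta 1 - expk theta (-1)) ^+ 2 * X <= (a - b) ^+ 2 * X by rewrite ler_wpM2r.
rewrite /X mulrA in ht *; nra.
Qed.

End DihedralOrbit.

(** * Ping-pong on reduced words *)

Section PingPong.
Variable R : realType.
Implicit Types (z w n y : 'cV[R[i]]_3) (e x theta : R) (k c : int) (u v : seq 'I_3).

Definition reduced u : bool := sorted (fun i j : 'I_3 => i != j) u.

(** R_2 is placed at parameter 0 of the axis and R_1 at [theta], which will be m_3/2. *)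
Definition gen theta n : 'I_3 -> 'cV[R[i]]_3 := triple (nvec theta) (nvec 0) n.

Definition evalw (nv : 'I_3 -> 'cV[R[i]]_3) u z := foldr (fun j => reflv (nv j)) z u.

(* The affine map x |-> c + x or x |-> c - x by which a word in the first two
   reflections acts on the axis, in units of 2 theta. *)
Definition wstate u : bool * int :=
  foldr (fun (j : 'I_3) (sc : bool * int) =>
    (~~ sc.1, (if j == 0 then 1 else 0) - sc.2)) (false, 0) u.

(** Words act from the right, so the letters to the left of the first R_3 form the dihedral element
    that is applied last; it names the translate of V in which a point ends up. *)
Fixpoint prefix01 u : seq 'I_3 :=
  if u is j :: u' then if j == 2 then [::] else j :: prefix01 u' else [::].

Lemma prefix01_all u : all (fun j => j != 2) (prefix01 u).
Proof. by elim: u => //= j u IH; case: ifP => //= ->. Qed.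

Lemma wstate_reduced u : all (fun j => j != 2) u -> reduced u -> u != [::] ->
  wstate u != (false, 0).
Proof.
case: u => // j u al red _.
(* Strengthened for the induction: the position is at least 1 after a leading R_1 and at most 0
   after a leading R_2, so that alternating letters never cancel. *)
suff [h0 h1 h2] : [/\ j = 0 -> 1 <= (wstate (j :: u)).2,
    j != 0 -> (wstate (j :: u)).2 <= 0 &
    ~~ (wstate (j :: u)).1 -> (wstate (j :: u)).2 != 0].
  by apply/eqP => E; move: h2; rewrite E => /(_ isT); rewrite eqxx.
elim: u j al red => [j _ _|i u IH j /andP[j2 al] /andP[ji red]].
  by split=> //= [->|/negPf ->].
have [i0 i1 i2] := IH i al red.
have i2' : i != 2 by case/andP: al.
have -> : wstate (j :: i :: u) = (~~ (wstate (i :: u)).1,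
    (if j == 0 then 1 else 0) - (wstate (i :: u)).2) by [].
move: (wstate (i :: u)) i0 i1 i2 => s i0 i1 i2.
have [ij|ij] := eqVneq j 0.
  have iN : i != 0 by rewrite ij eq_sym in ji.
  have := i1 iN => {}i1; split; rewrite /= ?eqxx //; lia.
have iE : i = 0.
  apply/eqP; move: ji j2 i2' ij; rewrite -!val_eqE /=.
  by case: i {IH al red i0 i1 i2} => -[|[|[|]]] //= ?; case: j => -[|[|[|]]].
have := i0 iE => {}i0; rewrite /=; split; [by move=> j0; rewrite j0 eqxx in ij|lia|lia].
Qed.

Lemma has_state_evalw theta n u : hq n = 1 -> all (fun j => j != 2) u ->
  has_state theta n (wstate u).1 (wstate u).2 (evalw (gen theta n) u n).
Proof.
move=> n1; elim: u => [_|j u IH /= /andP[j2 /IH st]].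
  by split; [move: n1; rewrite hq_qL /=; lra|rewrite oppr0 expk0 !mul1r].
have [-> /=|j0] := eqVneq j 0.
  by apply: has_state_refl st; rewrite expk1.
have -> : j = 1.
  apply/eqP; move: j2 j0; rewrite -!val_eqE /=.
  by case: j => -[|[|[|]]].
by apply: has_state_refl st; rewrite expR0 expk0 expr1n.
Qed.

Lemma inV_refl01 theta n e y z j : j != 2 -> inV e y z ->
  inV e (reflv (gen theta n j) y) (reflv (gen theta n j) z).
Proof.
have H x : inV e y z -> inV e (reflv (nvec x) y) (reflv (nvec x) z).
  have [h0 _ _] := reflv_nvec x z; have [g0 _ _] := reflv_nvec x y.
  rewrite /inV; have -> : qL (reflv (nvec x) z) = qL z.
    by have := hq_reflv (nvec x) z; rewrite !hq_qL h0 csqN => /addrI/oppr_inj.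
  suff -> : hermL (reflv (nvec x) z) (reflv (nvec x) y) = hermL z y by [].
  have := reflv_herm (nvec x) z y; rewrite !hermL_split h0 g0 conjcN mulrNN.
  by move=> /addrI.
move=> j2; have [-> |j0] := eqVneq j 0; first exact: H.
have -> : j = 1; last exact: H.
by apply/eqP; move: j2 j0; rewrite -!val_eqE /=; case: j => -[|[|[|]]].
Qed.

Lemma hq_evalw nv u z : hq (evalw nv u z) = hq z.
Proof. by elim: u => //= j u IH; rewrite hq_reflv. Qed.

Lemma prefix01_reduced u : reduced u -> reduced (prefix01 u).
Proof.
elim: u => //= j u IH red.
have := IH (path_sorted red); case: ifP => // _.
case: u red {IH} => //= i u /andP[ji _]; case: ifP => //= _ ->.
by rewrite ji.
Qed.

(** Induction from the right end of the word. The first R_3 sends z from outside V into V, the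
    letters R_1 and R_2 only move the translate, and each later R_3 meets a point of a translate
    different from V, hence a point outside V. *)
Lemma pingpong theta n u z : well_separated theta n -> reduced u -> last 0 u = 2 ->
  hq z < 0 -> ~ inV (csq (n 0 0)) n z ->
  inV (csq (n 0 0)) (evalw (gen theta n) (prefix01 u) n) (evalw (gen theta n) u z).
Proof.
move=> sep; have [_ n1 e1 _ _] := sep => + + z0 zV; elim: u => // j u IH red lst.
have [u0|u0] := eqVneq u [::].
  by move: lst; rewrite u0 /= => ->; rewrite eqxx; apply: inV_reflv.
have {IH} := IH (path_sorted red).
have -> : last 0 u = 2 by case: u u0 lst {red}.
move=> /(_ erefl) Vu; rewrite /=; case: ifPn => [/eqP j2|j2]; last exact: inV_refl01.
rewrite j2; apply: inV_reflv; rewrite ?hq_evalw //.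
have stn := has_state_evalw theta n1 (isT : all (fun j => j != 2) [::]).
have stu := has_state_evalw theta n1 (prefix01_all u).
(* The letter after R_3 in a reduced word is R_1 or R_2, so the translate containing the point is
   named by a non-empty prefix and is disjoint from V. *)
move=> V; apply: (inV_disjoint _ stn.1 stu.1 _ V Vu); first exact: le_trans ler01 e1.
apply: states_far stn stu => //.
rewrite eq_sym -surjective_pairing wstate_reduced ?prefix01_all //.
  by apply: prefix01_reduced; exact: path_sorted red.
by clear -red u0 j2; case: u red u0 => //= i u /andP[]; rewrite j2 eq_sym => /negPf ->.
Qed.

(** A word ending in R_3 sends the two test points, both outside V, into the single translate named
    by its prefix, while the test regions are two distinct translates. *)
Lemma separation theta n : well_separated theta n ->
  exists (w1 w2 y1 y2 : 'cV[R[i]]_3), let e := csq (n 0 0) in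
  [/\ hq w1 < 0 /\ hq w2 < 0, inV e y1 w1 /\ inV e y2 w2 &
    forall u, reduced u -> last 0 u = 2 ->
      ~ (inV e y1 (evalw (gen theta n) u w1) /\ inV e y2 (evalw (gen theta n) u w2))].
Proof.
move=> sep; have [_ n1 e1 _ _] := sep.
have [w0 [w00 w0V]] : exists w0, hq w0 < 0 /\ inV (csq (n 0 0)) n w0.
  pose z : 'cV[R[i]]_3 := \col_i triple 0 0 1 i.
  have zN : hq z < 0 by rewrite /hq !mxE csq0 csq1; lra.
  have [|h] := pselect (inV (csq (n 0 0)) n z); first by exists z.
  by exists (reflv n z); rewrite hq_reflv; split=> //; apply: inV_reflv.
have e0 : 0 <= csq (n 0 0) := le_trans ler01 e1.
pose ev u := evalw (gen theta n) u.
(* Two different non-trivial translations: they move V off itself and to disjoint places. *)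
pose t1 : seq 'I_3 := [:: 0; 1]; pose t2 : seq 'I_3 := [:: 0; 1; 0; 1].
have inVt u : all (fun j => j != 2) u -> inV (csq (n 0 0)) (ev u n) (ev u w0).
  by elim: u => //= j u IH /andP[j2 /IH]; exact: inV_refl01.
have st u (al : all (fun j => j != 2) u) := has_state_evalw theta n1 al.
have far u v : all (fun j => j != 2) u -> all (fun j => j != 2) v ->
    ~~ ((wstate u).1 && (wstate v).1) -> wstate u != wstate v ->
    forall z, inV (csq (n 0 0)) (ev u n) z -> inV (csq (n 0 0)) (ev v n) z -> False.
  move=> au av ns nst z; apply: inV_disjoint (st _ au).1 (st _ av).1 _ => //.
  by apply: states_far (st _ au) (st _ av); rewrite // -!surjective_pairing.
exists (ev t1 w0), (ev t2 w0), (ev t1 n), (ev t2 n); split.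
- by rewrite !hq_evalw.
- by split; apply: inVt.
move=> u red lst [V1 V2].
have nV t : all (fun j => j != 2) t -> ~~ (wstate t).1 -> wstate t != (false, 0) ->
    ~ inV (csq (n 0 0)) n (ev t w0).
  move=> at' nt tN V; apply: (far t [::] at' isT _ tN _ (inVt t at') V).
  by rewrite (negPf nt).
have U t : all (fun j => j != 2) t -> ~~ (wstate t).1 -> wstate t != (false, 0) ->
    inV (csq (n 0 0)) (ev t n) (ev u (ev t w0)) -> wstate (prefix01 u) = wstate t.
  move=> at' nt tN V; apply/eqP/negP => neq.
  apply: (far (prefix01 u) t (prefix01_all u) at' _ _ _ _ V).
  + by rewrite (negPf nt) andbF.
  + exact/negP.
  + by apply: pingpong; rewrite ?hq_evalw //; exact: nV.
by have := U t1 isT isT isT V1; rewrite (U t2 isT isT isT V2).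
Qed.

End PingPong.

(** * Words and representations *)

Section Words.
Variable R : realType.
Implicit Types (nv : 'I_3 -> 'cV[R[i]]_3) (u v : seq 'I_3) (z : 'cV[R[i]]_3).

Lemma Gamma_rel_cons j u v : Gamma_rel u v -> Gamma_rel (j :: u) (j :: v).
Proof. exact: (Gamma_rel_cat (Gamma_refl [:: j])). Qed.

Lemma Gamma_reduced u : exists2 v, reduced v & Gamma_rel u v.
Proof.
elim: u => [|j u [v red uv]]; first by exists [::] => //; exact: Gamma_refl.
have juv := Gamma_rel_cons j uv.
case: v red uv juv => [|i v] red uv juv; first by exists [:: j].
have [ji|ji] := eqVneq j i; last by exists (j :: i :: v); rewrite //= ji.
exists v; first exact: path_sorted red.
by apply: Gamma_trans juv _; rewrite ji; exact: (Gamma_cancel [::] v i).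
Qed.

Definition wordU nv u : U21 R :=
  foldr (fun j A => (mkU21 (refl_mx_U21 (nv j)) * A)%g) 1%g u.

Lemma wordU_evalw nv u z : val (wordU nv u) *m z = evalw nv u z.
Proof.
elim: u => [|j u IH] /=; first by rewrite mul1mx.
by rewrite -mulmxA IH refl_mxE.
Qed.

Lemma wordU_cat nv u v : wordU nv (u ++ v) = (wordU nv u * wordU nv v)%g.
Proof. by elim: u => [|j u IH] /=; rewrite ?mul1g // IH mulgA. Qed.

Lemma Gamma_iotaM j u : (iota_ j * \pi_Gamma u)%g = \pi_Gamma (j :: u).
Proof. exact: Gamma_piM. Qed.

Lemma morph1 (phi : {multiplicative Gamma -> PU21 R}) : phi 1%g = 1%g.
Proof. by apply: (mulgI (phi 1%g)); rewrite -gmulfM !mulg1. Qed.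

Lemma morph_word (phi : {multiplicative Gamma -> PU21 R}) nv :
  (forall j, phi (iota_ j) = crefl (nv j)) ->
  forall u, phi (\pi_Gamma u) = \pi_(PU21 R) (wordU nv u).
Proof.
move=> phiE; elim=> [|j u IH]; first exact: morph1.
by rewrite -Gamma_iotaM gmulfM phiE IH; exact: PU21_piM.
Qed.

Lemma refl_mxK n : refl_mx n *m refl_mx n = 1%:M :> 'M[R[i]]_3.
Proof.
apply/matrixP => i j.
have := congr1 (fun v : 'cV_3 => v i 0) (reflvK n (delta_mx j 0)).
by rewrite /= -!refl_mxE mulmxA -colE !mxE => ->; rewrite eqxx andbT.
Qed.

Lemma wordU_rel nv u v : Gamma_rel u v -> wordU nv u = wordU nv v.
Proof.
elim=> [//|w1 w2 _ -> //|w1 w2 w3 _ -> _ -> //|{}u {}v j].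
rewrite !wordU_cat -[RHS]/(wordU nv u * wordU nv v)%g; congr (_ * _)%g.
rewrite -[RHS]mul1g; congr (_ * _)%g; rewrite /= mulg1.
by apply: val_inj; rewrite /= refl_mxK.
Qed.

Definition word_rep nv (x : Gamma) : PU21 R := \pi_(PU21 R) (wordU nv (repr x)).

Lemma word_repM nv : {morph word_rep nv : x y / (x * y)%g}.
Proof.
move=> x y; have [u ->] := Gamma_piP x; have [v ->] := Gamma_piP y.
have E w : word_rep nv (\pi_Gamma w) = \pi_(PU21 R) (wordU nv w).
  by congr (\pi _); apply: wordU_rel; apply/Gamma_eqP; rewrite reprK.
rewrite -[(_ * _)%g]/(Gamma_mul _ _) Gamma_piM !E wordU_cat.
by rewrite -PU21_piM.
Qed.

HB.instance Definition _ nv :=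
  isMultiplicative.Build Gamma (PU21 R) (word_rep nv) (word_repM nv).

Lemma word_rep_iota nv j : word_rep nv (iota_ j) = crefl (nv j).
Proof.
have -> : crefl (nv j) = \pi_(PU21 R) (wordU nv [:: j]).
  by rewrite /crefl /= mulg1.
by congr (\pi _); apply: wordU_rel; apply/Gamma_eqP; rewrite reprK.
Qed.

Lemma rep_exists nv :
  exists phi : {multiplicative Gamma -> PU21 R}, forall j, phi (iota_ j) = crefl (nv j).
Proof. by exists (word_rep nv : {multiplicative Gamma -> PU21 R}); exact: word_rep_iota. Qed.

End Words.

(** * Open cones of matrices and the quotient topology of PU(2,1) *)

Section Topology.
Variable R : realType.
Implicit Types (z w n y : 'cV[R[i]]_3) (u v : seq 'I_3).

Lemma Re_continuous : continuous (@Re R : R[i] -> R).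
Proof.
move=> x; apply/(@cvgrPdist_lt _ _ _ _ (@nbhs_filter R[i] x)) => e e0.
apply/(@nbhs_ballP R[i]); exists e%:C => /=; first by rewrite ltcR.
move=> y xy; rewrite -ltcR; apply: le_lt_trans xy.
have -> : Re x - Re y = Re (x - y) by case: x y => a b [c d].
exact: normc_ge_Re.
Qed.

Lemma Im_continuous : continuous (@Im R : R[i] -> R).
Proof.
have -> : (@Im R : R[i] -> R) = (@Re R) \o (fun x => - 'i%C * x).
  by apply/funext => -[a b] /=; ring.
move=> x; apply: continuous_comp; last exact: Re_continuous.
by apply: (@cvgM R[i] _ _ (@nbhs_filter R[i] x)); [exact: cvg_cst|exact: cvg_id].
Qed.

Lemma csq_continuous : continuous (@csq R).
Proof.
have -> : @csq R = (fun x => Re x * Re x + Im x * Im x).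
  by apply/funext => x; rewrite /csq !expr2.
move=> x; apply: (@cvgD R _ _ _ (@nbhs_filter R[i] x)).
  by apply: (@cvgM R _ _ (@nbhs_filter R[i] x)); exact: Re_continuous.
by apply: (@cvgM R _ _ (@nbhs_filter R[i] x)); exact: Im_continuous.
Qed.

Section ContinuousOperations.
Variables (K : numFieldType) (T : topologicalType).
Implicit Types f g : T -> K.

Lemma fct_cst_continuous (k : K) : continuous (fun _ : T => k).
Proof. exact: cst_continuous. Qed.

Lemma fct_mul_continuous f g : continuous f -> continuous g ->
  continuous (fun x => f x * g x).
Proof. by move=> cf cg x; exact: (@cvgM _ _ _ (nbhs_filter x) _ _ _ _ (cf x) (cg x)). Qed.

Lemma fct_sub_continuous f g : continuous f -> continuous g ->
  continuous (fun x => f x - g x).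
Proof. by move=> cf cg x; exact: (@cvgB _ _ _ _ (nbhs_filter x) _ _ _ _ (cf x) (cg x)). Qed.

Lemma fct_sum_continuous (I : finType) (F : I -> T -> K) :
  (forall i, continuous (F i)) -> continuous (fun x => \sum_i F i x).
Proof. by move=> cF; apply: (continuous_big (@add_continuous K)) => i _. Qed.

End ContinuousOperations.

Lemma mulmx_coord_continuous (B : 'M[R[i]]_3) (x : 'cV[R[i]]_3) i :
  continuous (fun A : 'M[R[i]]_3 => (B *m (A *m x)) i 0).
Proof.
have -> : (fun A : 'M[R[i]]_3 => (B *m (A *m x)) i 0) =
    (fun A => \sum_j B i j * \sum_k A j k * x k 0).
  by apply/funext => A; rewrite mxE; apply: eq_bigr => j _; rewrite mxE.
apply: fct_sum_continuous => j; apply: fct_mul_continuous.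
  exact: fct_cst_continuous.
apply: fct_sum_continuous => k; apply: fct_mul_continuous.
  exact: (@coord_continuous R[i]).
exact: fct_cst_continuous.
Qed.

Lemma inV_open e y (B : 'M[R[i]]_3) x :
  open [set A : 'M[R[i]]_3 | inV e y (B *m (A *m x))].
Proof.
pose f (A : 'M[R[i]]_3) := e * qL (B *m (A *m x)) - csq (hermL (B *m (A *m x)) y).
have csqc (g : 'M[R[i]]_3 -> R[i]) : continuous g -> continuous (fun A => csq (g A)).
  by move=> gc A; apply: (@continuous_comp _ _ _ g (@csq R)); [exact: gc|exact: csq_continuous].
have cc i : continuous (fun A : 'M[R[i]]_3 => (B *m (A *m x)) i 0).
  exact: mulmx_coord_continuous.
have fc : continuous f.
  apply: fct_sub_continuous.
    apply: fct_mul_continuous; first exact: fct_cst_continuous.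
    by apply: fct_sub_continuous; apply: csqc.
  apply: csqc; apply: fct_sub_continuous; apply: fct_mul_continuous; try exact: cc.
    exact: fct_cst_continuous.
  exact: fct_cst_continuous.
have -> : [set A : 'M[R[i]]_3 | inV e y (B *m (A *m x))] = f @^-1` [set r | 0 < r].
  by apply/seteqP; split=> A /=; rewrite /inV /f subr_gt0.
by move/continuousP: fc; apply; exact: open_gt.
Qed.

(** A set of matrices stable under non-zero scalars is saturated for the projection, so testing a
    representative is the same as testing the matrix itself. *)
Lemma PU21_nbhs (g : PU21 R) (O : set 'M[R[i]]_3) : open O ->
  (forall c A, c != 0 -> O A -> O (c *: A)) -> O (val (repr g)) ->
  nbhs g [set h : PU21 R | O (val (repr h))].
Proof.
move=> oO Oc Og; apply: open_nbhs_nbhs; split=> //.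
rewrite /open /= /quotient_open.
have -> : \pi_(PU21 R) @^-1` [set h : PU21 R | O (val (repr h))] =
    (val : U21 R -> 'M[R[i]]_3) @^-1` O.
  apply/seteqP; split=> A /=.
    have /PU21_eqP[c [c0 cE]] := reprK (\pi_(PU21 R) A); rewrite cE => OA.
    have := Oc c^-1 _ _ OA; rewrite scalerA mulVf // scale1r; apply.
    by rewrite invr_eq0.
  have /PU21_eqP[c [c0 ->]] := reprK (\pi_(PU21 R) A); exact: Oc.
by exists O.
Qed.

End Topology.

(** * From separated domains to discreteness and faithfulness *)

Section Discreteness.
Variables (R : realType) (theta : R) (n : 'cV[R[i]]_3).
Implicit Types (u v : seq 'I_3).
Let nv := gen theta n.
Let e := csq (n 0 0).

(** Conjugation by R_3 produces a reduced word ending in R_3; a leading R_3 of u cancels against the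
    new one. *)
Lemma sorted_last_cases u : reduced u -> u != [::] -> last 0 u != 2 ->
  exists2 v, (reduced v /\ last 0 v = 2) &
    forall z, evalw nv v z = evalw nv (2 :: rcons u 2) z.
Proof.
move=> red u0 l2.
have red2 : reduced (rcons u 2).
  by case: u u0 red l2 => //= j u _ red l2; rewrite rcons_path red.
case: u u0 red l2 red2 => // j u _ red l2 red2.
have [j2|j2] := eqVneq j 2.
  exists (rcons u 2) => [|z].
    by split; [exact: path_sorted red2|rewrite last_rcons].
  by rewrite /= j2 reflvK.
exists (2 :: rcons (j :: u) 2) => //; split; last by rewrite /= last_rcons.
by rewrite /= eq_sym j2.
Qed.

(** The condition on u excludes endings in R_3, the one on its conjugate excludes all other endings,
    so only the empty word is left. *)
Lemma separated_words : well_separated theta n ->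
  exists (x1 x2 y1 y2 : 'cV[R[i]]_3),
    let P (F : 'cV[R[i]]_3 -> 'cV[R[i]]_3) := inV e y1 (F x1) /\ inV e y2 (F x2) in
    P id /\ forall u, reduced u ->
      P (evalw nv u) -> P (evalw nv (2 :: rcons u 2)) -> u = [::].
Proof.
move=> /separation[x1 [x2 [y1 [y2 [_ H0 H]]]]].
exists x1, x2, y1, y2; split=> // u red P1 P2; apply/eqP/negP => /negP u0.
have [l2|l2] := eqVneq (last 0 u) 2; first exact: H red l2 P1.
have [v [redv lv] vE] := sorted_last_cases red u0 l2.
by apply: (H v redv lv); rewrite -!vE in P2.
Qed.

(** [O u] is an open cone containing the matrix of a word v only if v and u are equal in Gamma. It
    isolates the image of u, which is discreteness; and if v has the same image as u, that image
    lies in [O u], whence v and u agree in Gamma. *)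
Lemma discrete_faithful (phi : {multiplicative Gamma -> PU21 R}) :
  well_separated theta n -> (forall j, phi (iota_ j) = crefl (nv j)) ->
  discrete_rep phi /\ faithful_rep phi.
Proof.
move=> sep phiE; have phiw := morph_word phiE.
have [x1 [x2 [y1 [y2 [[P1 P2] H]]]]] := separated_words sep.
(* The reversed word is the inverse of u, so [B u] moves the test at u back to the test at the
   identity. *)
pose B u : 'M[R[i]]_3 := val (wordU nv (rev u)).
(* The same test conjugated by R_3; its right-hand factor R_3 is applied to the test points in
   [O]. *)
pose B2 u : 'M[R[i]]_3 := refl_mx (nv 2) *m B u.
pose O u : set 'M[R[i]]_3 :=
  [set A | inV e y1 (B u *m (A *m x1))] `&` [set A | inV e y2 (B u *m (A *m x2))] `&`
  ([set A | inV e y1 (B2 u *m (A *m reflv (nv 2) x1))] `&`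
   [set A | inV e y2 (B2 u *m (A *m reflv (nv 2) x2))]).
have O_open u : open (O u) by do 2?apply: openI; exact: inV_open.
have OZ u c A : c != 0 -> O u A -> O u (c *: A).
  have E (M : 'M[R[i]]_3) x : M *m (c *: A *m x) = c *: (M *m (A *m x)).
    by rewrite -scalemxAl -scalemxAr.
  move=> c0 [[h1 h2] [h3 h4]]; split; split; rewrite /= E.
  - exact: (proj2 (inVZ e y1 _ c0) h1).
  - exact: (proj2 (inVZ e y2 _ c0) h2).
  - exact: (proj2 (inVZ e y1 _ c0) h3).
  - exact: (proj2 (inVZ e y2 _ c0) h4).
have OE u v : O u (val (wordU nv v)) <->
    (inV e y1 (evalw nv (rev u ++ v) x1) /\ inV e y2 (evalw nv (rev u ++ v) x2)) /\
    (inV e y1 (evalw nv (2 :: rcons (rev u ++ v) 2) x1) /\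
     inV e y2 (evalw nv (2 :: rcons (rev u ++ v) 2) x2)).
  have E z : evalw nv (rev u ++ v) z = B u *m (val (wordU nv v) *m z).
    by rewrite -wordU_evalw wordU_cat mulmxA.
  rewrite /O /=.
  have E2 z : reflv (nv 2) (evalw nv (rcons (rev u ++ v) 2) z) =
      B2 u *m (val (wordU nv v) *m reflv (nv 2) z).
    by rewrite /evalw -cats1 foldr_cat -/(evalw _ _ _) E /= -refl_mxE mulmxA.
  by rewrite !E !E2.
have evalw_rel u v z : Gamma_rel u v -> evalw nv u z = evalw nv v z.
  by move=> uv; rewrite -!wordU_evalw (wordU_rel nv uv).
have Orefl u : O u (val (wordU nv u)).
  have uu := Gamma_rel_revl u.
  have uu2 : Gamma_rel (2 :: rcons (rev u ++ u) 2) [::].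
    apply: (Gamma_trans (w2 := [:: 2; 2])); last exact: (Gamma_cancel [::] [::] 2).
    by rewrite -cats1; apply/Gamma_rel_cons/(Gamma_rel_cat uu)/Gamma_refl.
  by apply/OE; rewrite !(evalw_rel _ _ _ uu) !(evalw_rel _ _ _ uu2).
have key u v : O u (val (wordU nv v)) -> \pi_Gamma v = \pi_Gamma u.
  have [w red vw] := Gamma_reduced (rev u ++ v).
  have vw2 : Gamma_rel (2 :: rcons (rev u ++ v) 2) (2 :: rcons w 2).
    by rewrite -!cats1; apply/Gamma_rel_cons/(Gamma_rel_cat vw)/Gamma_refl.
  move=> /OE; rewrite !(evalw_rel _ _ _ vw) !(evalw_rel _ _ _ vw2) => -[Q1 Q2].
  have w0 := H w red Q1 Q2; rewrite {}w0 {red Q1 Q2 vw2} in vw.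
  have : Gamma_rel (u ++ (rev u ++ v)) (u ++ [::]).
    by apply: Gamma_rel_cat vw; exact: Gamma_refl.
  rewrite cats0 catA => uv; apply/Gamma_eqP; apply: Gamma_trans uv.
  apply: Gamma_sym; rewrite -[X in Gamma_rel _ X]cat0s; apply: Gamma_rel_cat.
    by rewrite -{1}[u]revK; exact: Gamma_rel_revl.
  exact: Gamma_refl.
have keyphi u v : O u (val (repr (phi (\pi_Gamma v)))) -> \pi_Gamma v = \pi_Gamma u.
  rewrite phiw => Ov; apply: key.
  have /PU21_eqP[c [c0 cE]] := reprK (\pi_(PU21 R) (wordU nv v)).
  move: Ov; rewrite cE => /(OZ u c^-1); rewrite scalerA mulVf // scale1r; apply.
  by rewrite invr_eq0.
have Ophi u : O u (val (repr (phi (\pi_Gamma u)))).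
  rewrite phiw; have /PU21_eqP[c [c0 ->]] := reprK (\pi_(PU21 R) (wordU nv u)).
  exact: OZ.
split.
  apply/seteqP; split; first exact: isolatedS.
  move=> _ [a _ <-]; split; first by apply/mem_set; exists a.
  have [u ->] := Gamma_piP a.
  exists [set h : PU21 R | O u (val (repr h))]; first exact: PU21_nbhs (O_open u) (OZ u) (Ophi u).
  apply/seteqP; split=> [h [/= Ob [b _ bE]]|h /= ->].
    by rewrite -bE in Ob *; have [v vE] := Gamma_piP b; rewrite vE in Ob *; rewrite (keyphi _ _ Ob).
  by split; [exact: Ophi|exists (\pi_Gamma u)].
move=> a b; have [u ->] := Gamma_piP a; have [v ->] := Gamma_piP b => ab.
by apply/esym/keyphi; rewrite -ab; exact: Ophi.
Qed.

End Discreteness.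

(** * Products of two reflections *)

Section BoundaryFixedPoints.
Variable R : realType.
Implicit Types (z w n y a b v : 'cV[R[i]]_3) (x : R) (l c : R[i]).

Lemma mulmx_ext (A B : 'M[R[i]]_3) : (forall z : 'cV_3, A *m z = B *m z) -> A = B.
Proof. by move=> AB; apply/row_matrixP => i; apply/rowP => j; have := AB (delta_mx j 0);
  move/(congr1 (fun M : 'cV_3 => M i 0)); rewrite -!colE !mxE. Qed.

Lemma line_eq z w : z != 0 -> <[z]>%VS = <[w]>%VS -> exists2 c, c != 0 & z = c *: w.
Proof.
move=> z0 zw; have : z \in <[w]>%VS by rewrite -zw memv_line.
move=> /vlineP[c zE]; exists c => //; apply: contraNneq z0 => c0.
by rewrite zE c0 scale0r.
Qed.

Lemma line_scale c z : c != 0 -> <[c *: z]>%VS = <[z]>%VS.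
Proof.
move=> c0; apply/eqP; rewrite eqEsubv -!memvE memvZ ?memv_line //=.
by rewrite -{1}[z]scale1r -(mulVf c0) -scalerA memvZ ?memv_line.
Qed.

Lemma reflvZ n c z : reflv n (c *: z) = c *: reflv n z.
Proof. by apply/colP => i; rewrite /reflv hermZl !mxE; ring. Qed.

(** A boundary fixed point is a null eigenline. Since R_a is an involution, the eigenvalue equation
    can be written with one reflection on each side. *)
Lemma bdfix_crefl a b (p : pline R) :
  bdfix (crefl a * crefl b)%g p <-> exists z l,
    [/\ z != 0, hq z = 0, p = <[z]>%VS & reflv b z = l *: reflv a z].
Proof.
set g := (_ * _)%g.
have [c c0 cE] : exists2 c, c != 0 & val (repr g) = c *: (refl_mx a *m refl_mx b).
  have : \pi_(PU21 R) (repr g) =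
      \pi_(PU21 R) (mkU21 (refl_mx_U21 a) * mkU21 (refl_mx_U21 b))%g.
    by rewrite reprK -PU21_piM.
  by move=> /PU21_eqP[c [c0 cE]]; exists c.
have actE z : act g <[z]>%VS = <[c *: reflv a (reflv b z)]>%VS.
  by rewrite /act limg_line lfunE /= cE -scalemxAl -mulmxA !refl_mxE.
split.
  move=> [[z [z0 hz] <-]]; rewrite actE => zz.
  have [d d0 dE] := line_eq z0 (esym zz).
  exists z, (d * c)^-1; split=> //; first by move: hz; rewrite hermE => -[].
  have dc : d * c != 0 by rewrite mulf_neq0.
  rewrite {2}dE scalerA reflvZ reflvK scalerA mulVf //.
  by rewrite scale1r.
move=> [z [l [z0 hz -> E]]].
have l0 : l != 0.
  apply: contraNneq z0 => l0; move: E; rewrite l0 scale0r => /(congr1 (reflv b)).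
  by rewrite reflvK => ->; rewrite -(scale0r (0 : 'cV[R[i]]_3)) reflvZ !scale0r.
split; first by exists z => //=; rewrite hermE hz.
by rewrite actE E reflvZ reflvK scalerA line_scale // mulf_neq0.
Qed.

Section Pair.
Variables (x : R) (b : 'cV[R[i]]_3).
Hypothesis b1 : hq b = 1.
Let a := nvec x.
Let H := csq (herm b a).

Lemma reflv_unit n z : herm n n = 1 -> reflv n z = - z + (2 * herm z n) *: n.
Proof. by move=> n1; rewrite /reflv n1 divr1. Qed.

Let aa : herm a a = 1. Proof. exact: nvec_unit. Qed.
Let bb : herm b b = 1. Proof. by rewrite hermE b1. Qed.
Let ba : herm a b = (herm b a)^*. Proof. by rewrite herm_conj. Qed.
Let HE : herm b a * (herm b a)^* = H%:C. Proof. exact: mulcJ. Qed.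

(** For l != 1 this puts z in the span of a and b; for l = 1 it is a linear relation between a and
    b. *)
Lemma fixed_span z l : reflv b z = l *: reflv a z ->
  (l - 1) *: z = (2 * l * herm z a) *: a - (2 * herm z b) *: b.
Proof.
rewrite !reflv_unit // => E; apply/colP => i.
move/(congr1 (fun v : 'cV_3 => v i 0)): E; rewrite !mxE => E.
have -> : (l - 1) * z i 0 = (- z i 0 + 2 * herm z b * b i 0) + l * z i 0
   - 2 * herm z b * b i 0 by ring.
by rewrite E; ring.
Qed.

Lemma fixed_eqs z l : reflv b z = l *: reflv a z ->
  (l + 1) * herm z a = 2 * herm z b * herm b a /\
  (l + 1) * herm z b = 2 * l * herm z a * (herm b a)^*.
Proof.
move=> /fixed_span E; split.
  have := congr1 (@herm R ^~ a) E; rewrite /= hermZl hermBl !hermZl aa => {}E.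
  have -> : (l + 1) * herm z a = 2 * l * herm z a - (l - 1) * herm z a by ring.
  by rewrite E; ring.
have := congr1 (@herm R ^~ b) E; rewrite /= hermZl hermBl !hermZl bb ba => {}E.
have -> : (l + 1) * herm z b = (l - 1) * herm z b + 2 * herm z b by ring.
by rewrite E; ring.
Qed.

Lemma hermZ1 z l : reflv b z = l *: reflv a z -> l = 1 ->
  herm z b *: b = herm z a *: a.
Proof.
move=> E l1; have := fixed_span E; rewrite l1 subrr scale0r !mulr1 => /esym/eqP.
rewrite subr_eq0 -!scalerA => /eqP /(scalerI _) -> //.
Qed.

Lemma orth_a_lc z : herm z a = 0 ->
  lcQ z = (lcQ z * (expR (- x))%:C) * (expR x)%:C /\
  lcP z = - (lcQ z * (expR (- x))%:C) * (expR (- x))%:C.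
Proof.
have ab : (expR x)%:C * (expR (- x))%:C = 1 :> R[i] by rewrite -realcM -expRD subrr expR0.
move=> za; have := herm_nvec z x; rewrite za mulr0 => E.
split; first by rewrite -mulrA [X in _ * X]mulrC ab mulr1.
rewrite mulNr -[LHS]mulr1 -ab.
have -> : lcP z * ((expR x)%:C * (expR (- x))%:C) =
  (lcP z * (expR x)%:C + lcQ z * (expR (- x))%:C) * (expR (- x))%:C
  - lcQ z * (expR (- x))%:C * (expR (- x))%:C by ring.
by rewrite -E mul0r sub0r.
Qed.

(** The pairing of b with (0, sinh x, cosh x), the negative unit vector of L orthogonal to a. *)
Let kb : R[i] := (lcP b * (expR x)%:C - lcQ b * (expR (- x))%:C) / 2.

Lemma csq_kb : csq kb = csq (b 0 0) - 1 + H.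
Proof.
have hE : herm b a = (lcP b * (expR x)%:C + lcQ b * (expR (- x))%:C) / 2.
  by rewrite -herm_nvec mulrC mulKf // pnatr_eq0.
have q : csq (b 0 0) - 1 = - Re (lcP b * (lcQ b)^*).
  by have := b1; rewrite hq_qL qL_lc; lra.
have ab : expR x * expR (- x) = 1 :> R by rewrite -expRD subrr expR0.
rewrite /H hE q /kb; move: (expR x) (expR (- x)) ab => A B AB.
have half : csq (2^-1 : R[i]) = 4^-1.
  by rewrite csqV; congr (_^-1); rewrite /csq /=; ring.
rewrite !csqM half; case: (lcP b) (lcQ b) => [p p'] [q1 q1'].
rewrite /csq /=.
have -> : (p * q1 - p' * - q1') = (A * B) * (p * q1 - p' * - q1') by rewrite AB mul1r.
by field.
Qed.

Lemma orth_ab z : herm z a = 0 -> herm z b = 0 ->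
  let mu : R[i] := lcQ z * (expR (- x))%:C in
  z 0 0 * (b 0 0)^* = - mu * kb^* /\ hq z = csq (z 0 0) - csq mu.
Proof.
move=> za zb mu; have [hQ hP] := orth_a_lc za; rewrite -/mu in hQ hP; clearbody mu.
split.
  move: zb; rewrite hermL_split => /eqP; rewrite addr_eq0 => /eqP ->.
  have -> : hermL z b = (lcP z * (lcQ b)^* + lcQ z * (lcP b)^*) / 2.
    by rewrite -hermL_lc mulrC mulKf // pnatr_eq0.
  rewrite hP hQ /kb; move: (lcP b) (lcQ b) => p q; rewrite conjcM conjcB !conjcM !conjc_real.
  have -> : (2^-1 : R[i])^* = 2^-1 by rewrite conjc_inv conjc_nat.
  by field.
rewrite hq_qL qL_lc hP hQ !conjcM conjc_real.
have -> : - mu * (expR (- x))%:C * (mu^* * (expR x)%:C) =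
   - (mu * mu^*) * (expR x * expR (- x))%:C by rewrite realcM; ring.
by rewrite -expRD subrr expR0 mulr1 mulcJ /=; ring.
Qed.

(** The L-part of z is mu (sinh x, cosh x), so z is null iff |z_0| = |mu|. Orthogonality to b gives
    |mu|^2 |b_0|^2 = |mu|^2 |kb|^2, that is |mu|^2 (1 - H) = 0. *)
Lemma orth_ab_null z : H != 1 -> herm z a = 0 -> herm z b = 0 -> hq z = 0 -> z = 0.
Proof.
move=> H1 za zb hz; have [e0 e1] := orth_ab za zb.
have [hQ hP] := orth_a_lc za.
move: (lcQ z * (expR (- x))%:C) e0 e1 hQ hP => mu e0 + hQ hP.
rewrite hz => /esym/eqP; rewrite subr_eq0 => /eqP zmu.
have mu0 : mu = 0.
  have := congr1 (@csq R) e0; rewrite !csqM csqN !csqJ zmu csq_kb => mm.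
  have : csq mu * (1 - H) = 0.
    transitivity (csq mu * csq (b 0 0) - csq mu * (csq (b 0 0) - 1 + H)); first by ring.
    by rewrite mm subrr.
  by move/eqP; rewrite mulf_eq0 subr_eq0 csq_eq0 [1 == H]eq_sym (negPf H1) orbF => /eqP.
have z0 : z 0 0 = 0 by apply/eqP; rewrite -csq_eq0 zmu mu0 csq0.
rewrite mu0 ?oppr0 !mul0r in hQ hP.
have z12 : z 1 0 = 0 /\ z 2 0 = 0.
  have two : (2 : R[i]) != 0 by rewrite pnatr_eq0.
  split; apply: (mulfI two); rewrite mulr0.
    by transitivity (lcP z + lcQ z); [rewrite /lcP /lcQ; ring|rewrite hP hQ addr0].
  by transitivity (lcQ z - lcP z); [rewrite /lcP /lcQ; ring|rewrite hP hQ subr0].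
by case: z12 => z1 z2; apply: col3_eq0.
Qed.

(** The Gram determinant of a and b is 1 - H > 0, so the form is positive definite on their span. *)
Lemma hq_span s t : H < 1 -> hq (s *: a + t *: b) = 0 -> s *: a + t *: b = 0.
Proof.
move=> H1; rewrite hqD !hqZ b1 mulr1.
have -> : hq a = 1 by have := aa; rewrite hermE => -[].
rewrite mulr1 hermZl hermZr ba => E.
suff [-> ->] : s = 0 /\ t = 0 by rewrite !scale0r addr0.
set r := Re _ in E.
have r2 : r ^+ 2 <= csq s * csq t * H.
  rewrite /H -(csqJ t) -mulrA -(csqJ (herm b a)) -!csqM /csq lerDl.
  exact: sqr_ge0.
have s0 := csq_ge0 s; have t0 := csq_ge0 t.
have st : csq s * csq t = 0.
  have : 0 <= csq s * csq t by rewrite mulr_ge0.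
  have : 0 <= (csq s - csq t) ^+ 2 by rewrite sqr_ge0.
  move: E r2; move: (csq s) (csq t) s0 t0 r => S T s0 t0 r E r2 d st.
  have : 4 * r ^+ 2 = (S + T) ^+ 2 by have -> : S + T = - (2 * r) by [lra|]; ring.
  by nra.
have r0 : r = 0.
  by apply/eqP; rewrite -sqrf_eq0 eq_le sqr_ge0 andbT (le_trans r2) // st mul0r.
split; apply/eqP; rewrite -csq_eq0; apply/eqP; lra.
Qed.

(** A null eigenvector with l != 1 would lie in the positive span of a and b, and one with l = 1
    would be orthogonal to both; neither exists. *)
Lemma bdfix_empty : H < 1 -> bdfix (crefl a * crefl b)%g = set0.
Proof.
move=> H1; apply/seteqP; split=> // p /bdfix_crefl[z [l [z0 hz _ E]]].
case/eqP: z0; have [l1|l1] := eqVneq l 1.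
  have := hermZ1 E l1 => ab.
  have e1 := congr1 (@herm R ^~ a) ab; rewrite /= !hermZl aa mulr1 in e1.
  have e2 := congr1 (@herm R ^~ b) ab; rewrite /= !hermZl bb mulr1 in e2.
  have zb : herm z b = 0.
    apply/eqP; have : herm z b * (1 - H)%:C = 0.
      by rewrite realcB mulrBr mulr1 -HE mulrA e1 -ba -e2 subrr.
    move/eqP; rewrite mulf_eq0 realc_eq0 => /orP[//|].
    by rewrite subr_eq0 eq_sym lt_eqF.
  apply: orth_ab_null => //; first by rewrite lt_eqF.
  by rewrite -e1 zb mul0r.
have := fixed_span E; set s := 2 * l * _; set t := 2 * _ => E2.
have l1' : l - 1 != 0 by rewrite subr_eq0.
apply: (scalerI l1'); rewrite scaler0 E2 -scaleNr; apply: hq_span => //.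
by rewrite scaleNr -E2 hqZ hz mulr0.
Qed.

Lemma elliptic_lt1 : H < 1 -> elliptic (crefl a * crefl b)%g.
Proof.
move=> H1; split=> [[p]|[p [q [_]]]]; rewrite bdfix_empty // => E.
  by have : set0 p by rewrite E.
by have : set0 p by rewrite E; left.
Qed.

End Pair.
End BoundaryFixedPoints.

(** * Products with one or two boundary fixed points *)

Section NonElliptic.
Variable R : realType.
Variables (x : R) (b : 'cV[R[i]]_3).
Hypotheses (b1 : hq b = 1) (b00 : b 0 0 != 0).
Let a := nvec x.
Let c := herm b a.
Let H := csq c.

Let aa : herm a a = 1. Proof. exact: nvec_unit. Qed.
Let bb : herm b b = 1. Proof. by rewrite hermE b1. Qed.
Let ba : herm a b = c^*. Proof. by rewrite /c herm_conj. Qed.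
Let HE : c * c^* = H%:C. Proof. exact: mulcJ. Qed.

(** The vectors a and b are linearly independent, as a_0 = 0 and b_0 != 0. *)
Lemma fixed_unit_orth z : herm z b *: b = herm z a *: a ->
  herm z a = 0 /\ herm z b = 0.
Proof.
move=> E; have := congr1 (fun v : 'cV_3 => v 0 0) E.
rewrite !mxE /= -[triple 0 _ _ 0]/(0 : R[i]) mulr0 => /eqP.
rewrite mulf_eq0 (negPf b00) orbF => /eqP zb; split=> //.
have := congr1 (@herm R ^~ a) E; rewrite /= !hermZl aa mulr1 zb mul0r.
by move=> <-.
Qed.

Lemma fixed_quadratic z (l : R[i]) : z != 0 -> reflv b z = l *: reflv a z -> l != 1 ->
  H != 0 -> (l + 1) ^+ 2 = 4 * H%:C * l /\
  exists2 k, k != 0 & z = k *: ((2 * l * c) *: a - (l + 1) *: b).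
Proof.
move=> z0 E l1 H0; have [e1 e2] := fixed_eqs b1 E; have E2 := fixed_span b1 E.
rewrite -/a -/c in e1 e2 E2.
have c0 : c != 0 by rewrite -csq_eq0.
have l1' : l - 1 != 0 by rewrite subr_eq0.
have two : (2 : R[i]) != 0 by rewrite pnatr_eq0.
have zbE : herm z b = (l + 1) * herm z a / (2 * c) by rewrite e1; field.
have za : herm z a != 0.
  apply: contraNneq z0 => za; move: E2; rewrite zbE za !(mulr0, mul0r) !scale0r subr0 => /eqP.
  by rewrite scaler_eq0 (negPf l1').
split.
  apply: (mulIf za); transitivity (2 * ((l + 1) * herm z b) * c).
    by rewrite zbE; field.
  by rewrite e2 -HE; ring.
exists (herm z a / (c * (l - 1))).
  by rewrite !mulf_neq0 // invr_eq0 mulf_neq0.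
apply: (scalerI l1'); rewrite E2 zbE.
apply/colP => i; rewrite !mxE; field.
by rewrite c0 l1'.
Qed.

Let w (l : R[i]) := (2 * l * c) *: a - (l + 1) *: b.

Lemma eigen_vector (l : R) : (l + 1) ^+ 2 = 4 * H * l -> 0 < l -> l != 1 ->
  [/\ w l%:C != 0, hq (w l%:C) = 0 & reflv b (w l%:C) = l%:C *: reflv a (w l%:C)].
Proof.
move=> lE l0 l1.
have wa : herm (w l%:C) a = (l%:C - 1) * c.
  by rewrite hermBl !hermZl aa -/c; ring.
have wb : 2 * herm (w l%:C) b = (l%:C + 1) * (l%:C - 1).
  rewrite hermBl !hermZl bb ba.
  transitivity ((4 * H * l)%:C - 2 * (l%:C + 1)).
    by rewrite !realcM -HE (rmorph_nat (real_complex R)); ring.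
  by rewrite -lE expr2 realcM realcD; ring.
have E : reflv b (w l%:C) = l%:C *: reflv a (w l%:C).
  rewrite !reflv_unit // wa wb; apply/colP => i; rewrite /w !mxE; ring.
split=> //.
  apply/eqP => /(congr1 (fun v : 'cV_3 => v 0 0)); rewrite !mxE /=.
  rewrite -[triple 0 _ _ 0]/(0 : R[i]) mulr0 add0r => /eqP.
  rewrite oppr_eq0 mulf_eq0 (negPf b00) orbF -(realcD l 1) realc_eq0 gt_eqF //.
  by rewrite addr_gt0.
(* Reflections preserve [hq], so hq w = l^2 hq w, where l > 0 and l != 1. *)
have := congr1 (@hq R) E; rewrite hq_reflv hqZ hq_reflv csqR => /eqP.
rewrite -subr_eq0 -[X in X - _]mul1r -mulrBl mulf_eq0 => /orP[|/eqP//].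
by rewrite subr_eq0 eq_sym sqrf_eq1 (negPf l1) /= => /eqP l2; rewrite l2 ltr0N1 in l0.
Qed.

Lemma not_elliptic_gt1 : 1 < H -> ~ elliptic (crefl a * crefl b)%g.
Proof.
move=> H1; have H0 : 0 < H by apply: lt_trans H1.
(* The roots of (l + 1)^2 = 4 H l are 2 H - 1 + 2 s and 2 H - 1 - 2 s: real, positive, distinct and
   inverse to each other. *)
pose s := Num.sqrt (H * (H - 1)).
have s0 : 0 < s by rewrite sqrtr_gt0 mulr_gt0 // subr_gt0.
have ss : s ^+ 2 = H * (H - 1) by rewrite sqr_sqrtr // ltW // mulr_gt0 // subr_gt0.
pose lp := 2 * H - 1 + 2 * s; pose lm := 2 * H - 1 - 2 * s.
have lpE : (lp + 1) ^+ 2 = 4 * H * lp.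
  transitivity (4 * H * lp + 4 * (s ^+ 2 - H * (H - 1))); first by rewrite /lp; ring.
  by rewrite ss subrr mulr0 addr0.
have lmE : (lm + 1) ^+ 2 = 4 * H * lm.
  transitivity (4 * H * lm + 4 * (s ^+ 2 - H * (H - 1))); first by rewrite /lm; ring.
  by rewrite ss subrr mulr0 addr0.
have lplm : lp * lm = 1.
  transitivity (1 - 4 * (s ^+ 2 - H * (H - 1))); first by rewrite /lp /lm; ring.
  by rewrite ss subrr mulr0 subr0.
have lp1 : 1 < lp by rewrite /lp; lra.
have lp0 : 0 < lp by apply: lt_trans lp1.
have lm0 : 0 < lm by rewrite -(pmulr_rgt0 _ lp0) lplm.
have lm1 : lm < 1 by rewrite -lplm ltr_pMl.
have lpm : lp + lm = 4 * H - 2 by rewrite /lp /lm; ring.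
have ltp : 0 < 2 * (lp - lm) by rewrite /lp /lm; lra.
clearbody lp lm.
have [wp0 hp Ep] := eigen_vector lpE lp0 (negbT (gt_eqF lp1)).
have [wm0 hm Em] := eigen_vector lmE lm0 (negbT (lt_eqF lm1)).
case=> _; apply; exists <[w lp%:C]>%VS, <[w lm%:C]>%VS; split.
  (* The factor k is constrained by the coordinate 0 and by the pairing with a: lp + 1 = k (lm + 1)
     and lp - 1 = k (lm - 1) force lp = lm. *)
  move=> /(line_eq wp0)[k _ kE].
  have e0 := congr1 (fun v : 'cV_3 => v 0 0) kE.
  rewrite !mxE /= -[triple 0 _ _ 0]/(0 : R[i]) !mulr0 !add0r mulrN in e0.
  move/oppr_inj: e0; rewrite mulrA => /(mulIf b00) e0.
  have wa l : herm (w l) a = (l - 1) * c by rewrite hermBl !hermZl aa -/c; ring.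
  have : (lp%:C - 1) * c = k * ((lm%:C - 1) * c).
    exact: etrans (esym (wa lp%:C)) (etrans (congr1 (@herm R ^~ a) kE)
      (etrans (hermZl k (w lm%:C) a) (congr1 ( *%R k) (wa lm%:C)))).
  rewrite mulrA.
  have c0 : c != 0 by rewrite -csq_eq0 gt_eqF.
  move=> /(mulIf c0) e1.
  have : (lp%:C - 1) * (lm%:C + 1) = (lm%:C - 1) * (lp%:C + 1) by rewrite e0 e1; ring.
  move=> /eqP; rewrite -subr_eq0.
  have -> : (lp%:C - 1) * (lm%:C + 1) - (lm%:C - 1) * (lp%:C + 1) =
    (2 * (lp - lm))%:C by rewrite realcM realcB (rmorph_nat (real_complex R)); ring.
  by rewrite realc_eq0 (gt_eqF ltp).
apply/seteqP; split=> p.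
  move=> /bdfix_crefl[z [l [z0 hz -> E]]].
  have [l1|l1] := eqVneq l 1.
    have [za zb] := fixed_unit_orth (hermZ1 b1 E l1).
    case/eqP: z0; apply: orth_ab_null za zb hz => //.
    by rewrite gt_eqF.
  have [lE [k k0 ->]] := fixed_quadratic z0 E l1 (negbT (gt_eqF H0)).
  rewrite line_scale // -/(w l).
  have : (l - lp%:C) * (l - lm%:C) = 0.
    transitivity ((l + 1) ^+ 2 - 4 * H%:C * l).
      have -> : (l - lp%:C) * (l - lm%:C) = l ^+ 2 - (lp + lm)%:C * l + (lp * lm)%:C.
        by rewrite realcD realcM; ring.
      rewrite lplm lpm.
      by rewrite realcB realcM !(rmorph_nat (real_complex R)); ring.
    by rewrite lE subrr.
  move/eqP; rewrite mulf_eq0 !subr_eq0 => /orP[/eqP ->|/eqP ->]; [left|right]; exact: erefl.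
move=> [->|->]; apply/bdfix_crefl.
  exists (w lp%:C), lp%:C; exact: And4 wp0 hp (erefl _) Ep.
exists (w lm%:C), lm%:C; exact: And4 wm0 hm (erefl _) Em.
Qed.

Let kb : R[i] := (lcP b * (expR x)%:C - lcQ b * (expR (- x))%:C) / 2.

(** Only the eigenvalue 1 can occur, with eigenvectors orthogonal to a and b. These form the line of
    [v], which is null because |kb| = |b_0| when H = 1. *)
Lemma not_elliptic_eq1 : H = 1 -> ~ elliptic (crefl a * crefl b)%g.
Proof.
move=> H1; pose v : 'cV[R[i]]_3 :=
  \col_i triple (- kb^* / (b 0 0)^*) (sinh x)%:C (cosh x)%:C i.
have v0 : v 0 0 = - kb^* / (b 0 0)^* by rewrite mxE.
have v1 : v 1 0 = (sinh x)%:C by rewrite mxE.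
have v2 : v 2 0 = (cosh x)%:C by rewrite mxE.
have b0J : (b 0 0)^* != 0 by rewrite -csq_eq0 csqJ csq_eq0.
have kbE : kb = b 1 0 * (sinh x)%:C - b 2 0 * (cosh x)%:C.
  rewrite /kb -coshD_sinh -coshB_sinh realcD realcB /lcP /lcQ; by field.
have va : herm v a = 0.
  by rewrite herm_conjc v1 v2 !nvecE conj0c !conjc_real; ring.
have vb : herm v b = 0.
  rewrite herm_conjc v0 v1 v2 divfK // kbE conjcB !conjcM !conjc_real; ring.
have hv : hq v = 0.
  have := csq_kb x b1; rewrite -/a -/c -/H -/kb H1 subrK => kk.
  rewrite /hq v0 v1 v2 csqM csqN csqV !csqJ kk divff ?csq_eq0 // !csqR.
  by have := cosh2_sinh2 x; lra.
have vN : v != 0.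
  apply/eqP => /(congr1 (fun v : 'cV_3 => v 2 0)); rewrite v2 mxE => /eqP.
  rewrite realc_eq0 gt_eqF // /cosh divr_gt0 // addr_gt0 // expR_gt0 //.
case=> + _; apply; exists <[v]>%VS; apply/seteqP; split=> p.
  move=> /bdfix_crefl[z [l [z0 hz -> E]]].
  have [l1|l1] := eqVneq l 1; last first.
    have H0 : H != 0 by rewrite H1 oner_neq0.
    have [lE _] := fixed_quadratic z0 E l1 H0.
    have : (l - 1) ^+ 2 = 0.
      have -> : (l - 1) ^+ 2 = (l + 1) ^+ 2 - 4 * l by ring.
      by rewrite lE H1 mulr1 subrr.
    by move/eqP; rewrite sqrf_eq0 subr_eq0 (negPf l1).
  have [za zb] := fixed_unit_orth (hermZ1 b1 E l1).
  have [e0 _] := orth_ab za zb; have [hQ hP] := orth_a_lc za.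
  rewrite -/kb in e0.
  move: (lcQ z * (expR (- x))%:C) e0 hQ hP => mu e0 hQ hP.
  have zE : z = mu *: v.
    have two : (2 : R[i]) != 0 by rewrite pnatr_eq0.
    have ent (y : 'cV[R[i]]_3) i : (z - mu *: y) i 0 = z i 0 - mu * y i 0 by rewrite !mxE.
    apply/eqP; rewrite -subr_eq0; apply/eqP; apply: col3_eq0; rewrite ent.
    - rewrite v0; apply: (mulIf b0J); rewrite mul0r mulrBl e0.
      by rewrite -mulrA divfK //; ring.
    - rewrite v1; apply: (mulfI two).
      transitivity (lcP z + lcQ z - mu * (2 * (sinh x)%:C)); first by rewrite /lcP /lcQ; ring.
      by rewrite hQ hP -(coshD_sinh x) -(coshB_sinh x) realcB realcD; ring.
    - rewrite v2; apply: (mulfI two).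
      transitivity (lcQ z - lcP z - mu * (2 * (cosh x)%:C)); first by rewrite /lcP /lcQ; ring.
      by rewrite hQ hP -(coshD_sinh x) -(coshB_sinh x) realcB realcD; ring.
  rewrite zE line_scale //; apply: contraNneq z0 => mu0.
  by rewrite zE mu0 scale0r.
move=> ->; apply/bdfix_crefl; exists v, 1; split=> //.
by rewrite !reflv_unit // va vb !mulr0 !scale0r scale1r.
Qed.

End NonElliptic.

(** * Powers of an elliptic product close to the identity *)

Section Recurrence.
Variable R : realType.

Lemma unit_recurrent (l : R[i]) (d : R) : csq l = 1 -> 0 < d ->
  exists k, (0 < k)%N /\ csq (l ^+ k - 1) < d.
Proof.
(* Pigeonhole on a grid of side 1/N: two powers in one cell differ in squared modulus by at most
   2/N^2 <= 2/N < d. *)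
move=> l1 d0; pose N := (Num.trunc (2 / d)).+1.
have Nd : 2 / d < N%:R by exact: truncnS_gt.
have N0 : 0 < N%:R :> R by rewrite ltr0n.
have N1 : 1 <= N%:R :> R by rewrite ler1n.
have lX k : csq (l ^+ k) = 1 by rewrite csqX l1 expr1n.
have bnd (x : R) : x ^+ 2 <= 1 -> 0 <= N%:R * (x + 1) < (2 * N).+1%:R.
  move=> x1; have : -1 <= x <= 1 by nra.
  move=> /andP[xm xp]; rewrite mulr_ge0 ?(ltW N0) //=; last by lra.
  by rewrite -natr1 natrM; nra.
have re1 k : Re (l ^+ k) ^+ 2 <= 1.
  by rewrite -[leRHS](lX k) /csq lerDl sqr_ge0.
have im1 k : Im (l ^+ k) ^+ 2 <= 1.
  by rewrite -[leRHS](lX k) /csq lerDr sqr_ge0.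
pose cell (x : R) := Num.trunc (N%:R * (x + 1)).
have cell_lt (x : R) : x ^+ 2 <= 1 -> (cell x < (2 * N).+1)%N.
  by move=> /bnd/andP[a b]; rewrite truncn_lt_nat.
have cell_eq (x y : R) : x ^+ 2 <= 1 -> y ^+ 2 <= 1 -> cell x = cell y ->
    (N%:R * (x - y)) ^+ 2 <= 1.
  move=> /bnd/andP[x0 _] /bnd/andP[y0 _] E.
  have /andP[xl xu] := truncn_itv x0; have /andP[yl yu] := truncn_itv y0.
  rewrite -!/(cell _) in xl xu yl yu; rewrite -E in yl yu.
  rewrite -natr1 in xu yu.
  have : -1 <= N%:R * (x - y) <= 1.
    have -> : N%:R * (x - y) = N%:R * (x + 1) - N%:R * (y + 1) by ring.
    by apply/andP; split; lra.
  move: (N%:R * (x - y)) => t /andP[t1 t2].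
  have : 0 <= (1 - t) * (1 + t) by rewrite mulr_ge0; lra.
  lra.
(* One power more than there are cells; N (x + 1) lies in [0, 2 N], whence 2 N + 1 cells for each of
   the two coordinates. *)
pose f (k : 'I_((2 * N).+1 * (2 * N).+1).+1) : 'I_(2 * N).+1 * 'I_(2 * N).+1 :=
  (Ordinal (cell_lt _ (re1 k)), Ordinal (cell_lt _ (im1 k))).
have : ~ injective f.
  by move=> /leq_card; rewrite card_prod !card_ord ltnn.
move=> /injectiveP/injectivePn[i [j ij [fr fi]]].
wlog lij : i j ij fr fi / (i < j)%N.
  move=> W; move: (ij); rewrite -val_eqE /= neq_ltn => /orP[|] h; first exact: (W i j).
  by apply: (W j i) => //; rewrite eq_sym.
exists (j - i)%N; split; first by rewrite subn_gt0.
have -> : csq (l ^+ (j - i) - 1) = csq (l ^+ j - l ^+ i).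
  have -> : l ^+ j - l ^+ i = l ^+ i * (l ^+ (j - i) - 1).
    by rewrite mulrBr mulr1 -exprD subnKC // ltnW.
  by rewrite csqM lX mul1r.
have hr := cell_eq _ _ (re1 j) (re1 i) (esym fr).
have hi := cell_eq _ _ (im1 j) (im1 i) (esym fi).
have : N%:R ^+ 2 * csq (l ^+ j - l ^+ i) <= 2.
  move: hr hi; case: (l ^+ j) (l ^+ i) => [a b] [a' b']; rewrite /csq /= => hr hi.
  have -> : N%:R ^+ 2 * ((a - a') ^+ 2 + (b - b') ^+ 2) =
    (N%:R * (a - a')) ^+ 2 + (N%:R * (b - b')) ^+ 2 by ring.
  by lra.
rewrite mulrC -ler_pdivlMr ?exprn_gt0 // => /le_lt_trans; apply.
rewrite ltr_pdivrMr ?exprn_gt0 //.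
rewrite ltr_pdivrMr // mulrC in Nd.
apply: lt_le_trans Nd _; rewrite ler_pM2l // expr2 ler_pMr //.
Qed.

Fixpoint mpow (A : 'M[R[i]]_3) k : 'M[R[i]]_3 := if k is k'.+1 then A *m mpow A k' else 1%:M.

(** Elements of finite order are included, so that rational and irrational rotation angles need not
    be told apart. *)
Definition recurrent (A : 'M[R[i]]_3) : Prop := forall e : R, 0 < e ->
  exists k, (0 < k)%N /\ forall i j, `|(mpow A k - 1%:M) i j| < e%:C.

Lemma mpow_spectral (A M1 M2 : 'M[R[i]]_3) (l m : R[i]) k :
  A *m M1 = l *: M1 -> A *m M2 = m *: M2 -> A - 1%:M = (l - 1) *: M1 + (m - 1) *: M2 ->
  mpow A k - 1%:M = (l ^+ k - 1) *: M1 + (m ^+ k - 1) *: M2.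
Proof.
move=> E1 E2 E; elim: k => [|k IH].
  by rewrite /= subrr !expr0 !subrr !scale0r addr0.
have -> : mpow A k.+1 - 1%:M = A *m (mpow A k - 1%:M) + (A - 1%:M).
  by rewrite mulmxBr mulmx1 addrA subrK.
rewrite IH E mulmxDr -!scalemxAr E1 E2 !scalerA addrACA -!scalerDl.
by congr (_ *: _ + _ *: _); rewrite exprSr; ring.
Qed.

Lemma spectral_recurrent (A M1 M2 : 'M[R[i]]_3) (l : R[i]) :
  csq l = 1 ->
  A *m M1 = l *: M1 -> A *m M2 = l^* *: M2 ->
  A - 1%:M = (l - 1) *: M1 + (l^* - 1) *: M2 ->
  recurrent A.
Proof.
move=> l1 E1 E2 E e e0.
pose C : R := 1 + \sum_i \sum_j (Num.sqrt (csq (M1 i j)) + Num.sqrt (csq (M2 i j))).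
have ge0 i j : 0 <= Num.sqrt (csq (M1 i j)) + Num.sqrt (csq (M2 i j)).
  by rewrite addr_ge0 // sqrtr_ge0.
have Cij i j : Num.sqrt (csq (M1 i j)) + Num.sqrt (csq (M2 i j)) < C.
  apply: (@le_lt_trans _ _ (\sum_j (Num.sqrt (csq (M1 i j)) + Num.sqrt (csq (M2 i j))))).
    by rewrite (bigD1 j) //= lerDl sumr_ge0.
  rewrite /C [X in _ < 1 + X](bigD1 i) //=.
  have : 0 <= \sum_(i0 < 3 | i0 != i) \sum_j
      (Num.sqrt (csq (M1 i0 j)) + Num.sqrt (csq (M2 i0 j))).
    by apply: sumr_ge0 => i0 _; apply: sumr_ge0 => j0 _.
  by move=> X0; rewrite addrCA -[ltLHS]addr0 ltrD2l ltr_wpDr.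
have C0 : 0 < C by apply: le_lt_trans (Cij 0 0).
have [k [k0 kE]] := unit_recurrent l1 (exprn_gt0 2 (divr_gt0 e0 C0)).
exists k; split=> // i j; rewrite (mpow_spectral k E1 E2 E) !mxE.
(* The two eigenvalues are conjugate, so one return time serves both. *)
have mE : (l^*) ^+ k - 1 = (l ^+ k - 1)^*.
  by rewrite conjcB [in RHS]rmorphXn conjc1.
rewrite mE; apply: le_lt_trans (ler_normD _ _) _.
rewrite !normrM !normcE_csq csqJ.
set s := Num.sqrt (csq (l ^+ k - 1)).
have s_lt : s < e / C.
  rewrite -(@ltr_pXn2r _ 2) ?nnegrE ?sqrtr_ge0 //; last by rewrite ltW // divr_gt0.
  by rewrite sqr_sqrtr // csq_ge0.
rewrite -mulrDr -realcD -realcM ltcR.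
apply: (@le_lt_trans _ _ (s * C)).
  by rewrite ler_wpM2l ?sqrtr_ge0 // ltW.
by rewrite -ltr_pdivlMr.
Qed.

Section Product.
Variables (a b : 'cV[R[i]]_3).
Hypotheses (aa : herm a a = 1) (bb : herm b b = 1).
Let c := herm b a.
Let H := csq c.
Let A := refl_mx a *m refl_mx b.
Let ba : herm a b = c^*. Proof. by rewrite /c herm_conj. Qed.
Let HE : c * c^* = H%:C. Proof. exact: mulcJ. Qed.

(** The image of A - 1 lies in the span of a and b, and A satisfies X^2 - (4 H - 2) X + 1 = 0 on
    that span. *)
Lemma cubic : (A *m A - (4 * H - 2)%:C *: A + 1%:M) *m (A - 1%:M) = 0.
Proof.
apply: mulmx_ext => z; rewrite mul0mx -mulmxA.
set B := _ + _.
have BE v : B *m v = reflv a (reflv b (reflv a (reflv b v)))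
    - (4 * H - 2)%:C *: reflv a (reflv b v) + v.
  by rewrite /B !mulmxDl mulNmx -scalemxAl mul1mx /A -!mulmxA !refl_mxE.
have Ba : B *m a = 0.
  rewrite BE !(reflv_unit _ aa) !(reflv_unit _ bb).
  rewrite !(hermDl, hermNl, hermZl) aa bb ba -/c.
  have h : (4 * H - 2)%:C = 4 * (c * c^*) - 2.
    by rewrite realcB realcM HE !(rmorph_nat (real_complex R)).
  apply/colP => i; rewrite !mxE h; ring.
have Bb : B *m b = 0.
  rewrite BE !(reflv_unit _ aa) !(reflv_unit _ bb).
  rewrite !(hermDl, hermNl, hermZl) aa bb ba -/c.
  have h : (4 * H - 2)%:C = 4 * (c * c^*) - 2.
    by rewrite realcB realcM HE !(rmorph_nat (real_complex R)).
  apply/colP => i; rewrite !mxE h; ring.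
have -> : (A - 1%:M) *m z = (2 * herm (reflv b z) a) *: a - (2 * herm z b) *: b.
  rewrite mulmxBl mul1mx /A -mulmxA !refl_mxE (reflv_unit _ aa).
  by rewrite {1}(reflv_unit _ bb); apply/colP => i; rewrite !mxE; ring.
by rewrite mulmxBr -!scalemxAr Ba Bb !scaler0 subrr.
Qed.

Lemma product_recurrent : H < 1 -> recurrent A.
Proof.
move=> H1; have H0 : 0 <= H by exact: csq_ge0.
(* For H = 0 the eigenvalues l and conj(l) would both be -1 and the denominators below would vanish;
   but then the reflections commute and A^2 = 1. *)
have [Hz|Hn] := eqVneq H 0.
  have c0 : c = 0 by apply/eqP; rewrite -csq_eq0; apply/eqP.
  have AA : A *m A = 1%:M.
    apply: mulmx_ext => z; rewrite mul1mx /A -!mulmxA !refl_mxE.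
    have comm v : reflv a (reflv b v) = reflv b (reflv a v).
      rewrite !(reflv_unit _ aa) !(reflv_unit _ bb) !(hermDl, hermNl, hermZl) ba -/c c0.
      by rewrite conj0c; apply/colP => i; rewrite !mxE; ring.
    by rewrite (comm z) reflvK reflvK.
  move=> e e0; exists 2%N; split=> // i j.
  by rewrite /= mulmx1 AA subrr mxE normr0 ltcR.
have Hp : 0 < H by rewrite lt_neqAle eq_sym Hn.
pose s := Num.sqrt (H * (1 - H)).
have s0 : 0 < s by rewrite sqrtr_gt0 mulr_gt0 // subr_gt0.
have ss : s ^+ 2 = H * (1 - H) by rewrite sqr_sqrtr // ltW // mulr_gt0 // subr_gt0.
pose l : R[i] := (2 * H - 1) +i* (2 * s).
have l1 : csq l = 1.
  transitivity (1 + 4 * (s ^+ 2 - H * (1 - H))); first by rewrite /csq /=; ring.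
  by rewrite ss subrr mulr0 addr0.
have lJ : l^* = (2 * H - 1) -i* (2 * s) by [].
have lD : l + l^* = (4 * H - 2)%:C.
  by apply/eqP; rewrite eq_complex /=; apply/andP; split; apply/eqP; ring.
have lM : l * l^* = 1 by rewrite mulcJ l1.
have lN : l - l^* != 0.
  by rewrite eq_complex /= negb_and orbC opprK -mulr2n mulrn_eq0 /= mulf_eq0 pnatr_eq0 /= gt_eqF.
have l1N : l - 1 != 0.
  by rewrite eq_complex /= negb_and orbC subr0 mulf_eq0 pnatr_eq0 /= gt_eqF.
have lJ1N : l^* - 1 != 0.
  by rewrite -csq_eq0 -[X in _ - X]conjc1 -conjcB csqJ csq_eq0.
clearbody l.
pose X := A - 1%:M.
have K (p q : R[i]) : p + q = (4 * H - 2)%:C -> p * q = 1 ->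
    A *m ((A - q%:M) *m X) = p *: ((A - q%:M) *m X).
  move=> pq pq1; apply/eqP; rewrite -subr_eq0; apply/eqP.
  transitivity ((A *m A - (p + q) *: A + (p * q)%:M) *m X).
    rewrite mulmxA scalemxAl -mulmxBl; congr (_ *m _).
    rewrite mulmxBr mul_mx_scalar scalerBr scale_scalar_mx scalerDl.
    move: (p *: A) (q *: A) ((p * q)%:M) (A *m A) => U V W Z.
    by rewrite opprB [U + V]addrC opprD !addrA [LHS]addrAC.
  by rewrite pq pq1 cubic.
have lD' : l^* + l = (4 * H - 2)%:C by rewrite addrC.
have lM' : l^* * l = 1 by rewrite mulrC.
(* Lagrange interpolation at the eigenvalues 1, l, conj(l): the spectral projections for l and
   conj(l). *)
pose M1 := ((l - 1) * (l - l^*))^-1 *: ((A - (l^*)%:M) *m X).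
pose M2 := ((l^* - 1) * (l^* - l))^-1 *: ((A - l%:M) *m X).
apply: (@spectral_recurrent A M1 M2 l) => //.
- by rewrite /M1 -scalemxAr (K l l^* lD lM) !scalerA [_^-1 * _]mulrC.
- by rewrite /M2 -scalemxAr (K l^* l lD' lM') !scalerA [_^-1 * _]mulrC.
rewrite /M1 /M2 !scalerA.
have -> : (l - 1) * ((l - 1) * (l - l^*))^-1 = (l - l^*)^-1 by field; rewrite lN l1N.
have -> : (l^* - 1) * ((l^* - 1) * (l^* - l))^-1 = - (l - l^*)^-1.
  by field; rewrite lN lJ1N -oppr_eq0 opprB lN.
rewrite scaleNr -scalerBr -mulmxBl.
have -> : A - (l^*)%:M - (A - l%:M) = (l - l^*)%:M.
  by rewrite opprB addrC addrA subrK; apply/esym; exact: raddfB.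
by rewrite mul_scalar_mx scalerA mulVf // scale1r.
Qed.

End Product.
End Recurrence.

(** * The criterion *)

Section Criterion.
Variable R : realType.
Implicit Types (z : 'cV[R[i]]_3) (u v : seq 'I_3) (x y w theta : R).

(* Gamma acts on the integers by point reflections; a product of an odd number
   of the first two generators with the third one acts as a translation. *)
Definition int_act u (k : int) : int :=
  foldr (fun (j : 'I_3) k => if j == 2 then 1 - k else - k) k u.

Lemma int_act_cat u v k : int_act (u ++ v) k = int_act u (int_act v k).
Proof. by rewrite /int_act foldr_cat. Qed.

Lemma int_act_rel u v k : Gamma_rel u v -> int_act u k = int_act v k.
Proof.
move=> uv; elim: uv k => [//|w1 w2 _ IH k|w1 w2 w3 _ IH1 _ IH2 k|u' v' j k].
- by rewrite IH.
- by rewrite IH1 IH2.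
- rewrite !int_act_cat; congr int_act; rewrite /=; case: (j == 2);
  by rewrite ?opprK // opprB addrCA subrr addr0.
Qed.

Definition rword n : seq 'I_3 := 0 :: flatten (nseq n [:: 1; 0]).

Lemma rwordS n : rword n.+1 = [:: 0, 1 & rword n]. Proof. by []. Qed.

Lemma rword_infinite_order n k : (0 < k)%N ->
  ~ Gamma_rel (flatten (nseq k (rword n ++ [:: 2]))) [::].
Proof.
move=> k0 /(@int_act_rel _ _ 0).
have r m : int_act (rword n) m = - m.
  elim: n m => // n IH m; rewrite rwordS.
  by transitivity (- - int_act (rword n) m); [by []|rewrite opprK IH].
have w m : int_act (rword n ++ [:: 2]) m = m - 1.
  by rewrite int_act_cat r; transitivity (- (1 - m)); [by []|rewrite opprB].
suff -> : int_act (flatten (nseq k (rword n ++ [:: 2]))) 0 = - (k%:Z).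
  by case: k k0.
elim: k {k0} => // k IH.
transitivity (int_act ((rword n ++ [:: 2]) ++ flatten (nseq k (rword n ++ [:: 2]))) 0).
  by [].
by rewrite int_act_cat IH w -opprD -addn1 PoszD.
Qed.

Lemma lc_ext (z1 z2 : 'cV[R[i]]_3) : z1 0 0 = z2 0 0 -> lcP z1 = lcP z2 -> lcQ z1 = lcQ z2 -> z1 = z2.
Proof.
move=> e0 eP eQ; have two : (2 : R[i]) != 0 by rewrite pnatr_eq0.
have ent i : (z1 - z2) i 0 = z1 i 0 - z2 i 0 by rewrite !mxE.
apply/eqP; rewrite -subr_eq0; apply/eqP; apply: col3_eq0; rewrite ent.
- by rewrite e0 subrr.
- apply: (mulfI two); rewrite mulr0.
  transitivity ((lcP z1 + lcQ z1) - (lcP z2 + lcQ z2)); first by rewrite /lcP /lcQ; ring.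
  by rewrite eP eQ subrr.
- apply: (mulfI two); rewrite mulr0.
  transitivity ((lcQ z1 - lcP z1) - (lcQ z2 - lcP z2)); first by rewrite /lcP /lcQ; ring.
  by rewrite eP eQ subrr.
Qed.

(** Three half-turns of an axis compose to the half-turn at the alternating sum of their centres, so
    R_1 (R_2 R_1)^n is again a reflection. *)
Lemma reflv_nvec3 x y w z :
  reflv (nvec x) (reflv (nvec y) (reflv (nvec w) z)) = reflv (nvec (x - y + w)) z.
Proof.
have [] := reflv_nvec w z; move: (reflv (nvec w) z) => z1 c0 cP cQ.
have [] := reflv_nvec y z1; move: (reflv (nvec y) z1) => z2 b0 bP bQ.
have [] := reflv_nvec x z2; move: (reflv (nvec x) z2) => z3 a0 aP aQ.
have [] := reflv_nvec (x - y + w) z; move: (reflv _ z) => z4 d0 dP dQ.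
apply: lc_ext.
- by rewrite a0 b0 c0 d0 opprK.
- rewrite aP bQ cP dP !mulrA -!realcM !opprD opprK !expRD !exprMn.
  by congr (_%:C * _); ring.
- rewrite aQ bP cQ dQ !mulrA -!realcM !expRD !exprMn.
  by congr (_%:C * _); ring.
Qed.

(** R_1 has centre [theta] and R_2 has centre 0. The initial R_1 accounts for one step and each
    further pair for another, hence n + 1. *)
Lemma evalw_rword theta (b : 'cV[R[i]]_3) n z :
  evalw (gen theta b) (rword n) z = reflv (nvec (theta * n.+1%:R)) z.
Proof.
elim: n => [|n IH]; first by rewrite mulr1.
transitivity (reflv (nvec theta) (reflv (nvec 0) (evalw (gen theta b) (rword n) z))).
  by [].
by rewrite IH reflv_nvec3 subr0 -[in RHS]natr1 mulrDr mulr1 addrC.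
Qed.

Lemma pi_wordU_cat nv u v : \pi_(PU21 R) (wordU nv (u ++ v)) =
  (\pi_(PU21 R) (wordU nv u) * \pi_(PU21 R) (wordU nv v))%g.
Proof. by rewrite wordU_cat -PU21_piM. Qed.

Lemma pi_wordU1 (nv : 'I_3 -> 'cV[R[i]]_3) j : \pi_(PU21 R) (wordU nv [:: j]) = crefl (nv j).
Proof. by rewrite /crefl /= mulg1. Qed.

Lemma word_element (nv : 'I_3 -> 'cV[R[i]]_3) n :
  (crefl (nv 0%R) * (crefl (nv 1%R) * crefl (nv 0%R)) ^+ n * crefl (nv 2%R))%g =
  \pi_(PU21 R) (wordU nv (rword n ++ [:: 2])).
Proof.
rewrite pi_wordU_cat pi_wordU1; congr (_ * _)%g.
have -> : rword n = [:: 0] ++ flatten (nseq n [:: 1; 0]) by [].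
rewrite pi_wordU_cat pi_wordU1; congr (_ * _)%g.
elim: n => [|n IH]; first by rewrite expg0.
have -> : flatten (nseq n.+1 [:: 1; 0]) =
  [:: 1] ++ ([:: 0] ++ flatten (nseq n [:: 1; 0])) :> seq 'I_3 by [].
rewrite expgS IH; apply/esym; apply: (etrans (pi_wordU_cat nv [:: 1] _)).
rewrite pi_wordU1 -mulgA; congr (_ * _)%g.
by apply: (etrans (pi_wordU_cat nv [:: 0] _)); rewrite pi_wordU1.
Qed.

Lemma word_mx theta (b : 'cV[R[i]]_3) n :
  val (wordU (gen theta b) (rword n ++ [:: 2])) =
  refl_mx (nvec (theta * n.+1%:R)) *m refl_mx b.
Proof.
apply: mulmx_ext => z; rewrite wordU_evalw /evalw foldr_cat -/(evalw _ _ _).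
by rewrite evalw_rword -mulmxA !refl_mxE.
Qed.

Lemma word_crefl theta (b : 'cV[R[i]]_3) n :
  \pi_(PU21 R) (wordU (gen theta b) (rword n ++ [:: 2])) =
  (crefl (nvec (theta * n.+1%:R)) * crefl b)%g.
Proof.
transitivity (\pi_(PU21 R) (mkU21 (refl_mx_U21 (nvec (theta * n.+1%:R))) *
    mkU21 (refl_mx_U21 b))%g); last exact: esym (PU21_piM _ _).
by apply/PU21_eqP; exists 1; rewrite oner_neq0 scale1r word_mx.
Qed.

(** A neighbourhood isolating the identity of the image pulls back to an open set of matrices around
    1. A power of the word falls into it, so its image is trivial, and faithfulness carries this
    back to Gamma. *)
Lemma recurrent_not_discrete (phi : {multiplicative Gamma -> PU21 R}) nv u :
  (forall j, phi (iota_ j) = crefl (nv j)) -> recurrent (val (wordU nv u)) ->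
  discrete_rep phi -> faithful_rep phi ->
  exists k, (0 < k)%N /\ Gamma_rel (flatten (nseq k u)) [::].
Proof.
move=> phiE rec dis inj; have phiw := morph_word phiE.
have : isolated (range phi) (phi (\pi_Gamma [::])).
  by rewrite dis; exists (\pi_Gamma [::]).
move=> [_ [V V1 VE]]; move: V1; rewrite nbhsE => -[B [oB B1] BV].
have OB : exists2 O : set 'M[R[i]]_3, open O &
    (val : U21 R -> 'M[R[i]]_3) @^-1` O = \pi_(PU21 R) @^-1` B := oB.
case: OB => O oO OE.
have O1 : O 1%:M.
  have : (\pi_(PU21 R) @^-1` B) (1%g : U21 R) by rewrite /= -[1%g]/(wordU nv [::]) -phiw.
  by rewrite -OE.
have : nbhs (1%:M : 'M[R[i]]_3) O by apply: open_nbhs_nbhs.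
move/(@nbhs_ballP R[i]) => [e /= e0 eO].
have eR : e = (Re e)%:C by rewrite RRe_real // gtr0_real.
have [|k [k0 kE]] := rec (Re e); first by rewrite -ltcR -eR.
exists k; split=> //; apply/Gamma_eqP; apply: inj.
have mE : val (wordU nv (flatten (nseq k u))) = mpow (val (wordU nv u)) k.
  by elim: k {k0 kE} => //= k IH; rewrite wordU_cat /= IH.
have Vk : V (phi (\pi_Gamma (flatten (nseq k u)))).
  apply: BV; rewrite phiw.
  suff : (\pi_(PU21 R) @^-1` B) (wordU nv (flatten (nseq k u))) by [].
  rewrite -OE /= mE; apply: eO; split=> // i j.
  by rewrite /ball /= distrC eR; have := kE i j; rewrite !mxE.
have : [set phi (\pi_Gamma [::])] (phi (\pi_Gamma (flatten (nseq k u)))).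
  by rewrite -VE; split=> //; exists (\pi_Gamma (flatten (nseq k u))).
by move=> ->.
Qed.

(** The product is conjugation-free: it is literally a product of two reflections, and it is
    elliptic exactly when their polar vectors pair to a modulus below 1. Separation is only assumed
    in the other case. *)
Lemma discrete_faithful_iff theta (b : 'cV[R[i]]_3) n (phi : {multiplicative Gamma -> PU21 R}) :
  hq b = 1 ->
  (1 <= csq (herm b (nvec (theta * n.+1%:R))) -> well_separated theta b) ->
  (forall j, phi (iota_ j) = crefl (gen theta b j)) ->
  let R1 := crefl (gen theta b 0) in
  let R2 := crefl (gen theta b 1) in
  let R3 := crefl (gen theta b 2) in
  discrete_rep phi /\ faithful_rep phi <-> ~ elliptic (R1 * (R2 * R1) ^+ n * R3)%g.
Proof.
move=> b1 sep phiE R1 R2 R3; rewrite word_element word_crefl.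
have bb : herm b b = 1 by rewrite hermE b1.
set h := csq _ in sep.
have [h1|h1] := ltP h 1.
  split=> [[dis faith]|]; last by case; exact: elliptic_lt1.
  have rec : recurrent (val (wordU (gen theta b) (rword n ++ [:: 2]))).
    by rewrite word_mx; apply: product_recurrent => //; exact: nvec_unit.
  have [k [k0 kE]] := recurrent_not_discrete phiE rec dis faith.
  by case: (rword_infinite_order k0 kE).
have ws := sep h1; split=> _; last exact: discrete_faithful ws phiE.
have b00 : b 0 0 != 0.
  by have [_ _ e1 _ _] := ws; rewrite -csq_eq0 gt_eqF // (lt_le_trans ltr01).
move: h1; rewrite le_eqVlt => /orP[/eqP/esym h1|h1].
  exact: not_elliptic_eq1.
exact: not_elliptic_gt1.
Qed.

End Criterion.

(** * Separation on the sets K_n *)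

Section PolarVectors.
Variable R : realType.
Variables (theta r1 r2 al : R).
Let r3 := cosh theta.
Let s3 := sinh theta.
Let E := expR theta.
Let E' := expR (- theta).
Let c := cos al.
Hypothesis theta0 : 0 < theta.
Hypothesis dom : domain r1 r2 r3 al.

Let r3E : r3 = (E + E') / 2. Proof. by []. Qed.
Let s3E : s3 = (E - E') / 2. Proof. by []. Qed.
Let EE' : E * E' = 1. Proof. by rewrite -expRD subrr expR0. Qed.
Let E1 : 1 < E. Proof. by rewrite /E -expR0 ltr_expR. Qed.
Let E'0 : 0 < E'. Proof. exact: expR_gt0. Qed.
Let E'1 : E' < 1. Proof. by rewrite /E' -expR0 ltr_expR oppr_lt0. Qed.
Let rs : r3 ^+ 2 - s3 ^+ 2 = 1. Proof. exact: cosh2_sinh2. Qed.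

Lemma sinh_gt0 : 0 < s3. Proof. by rewrite s3E divr_gt0 // subr_gt0 (lt_trans E'1). Qed.
Let s30 := sinh_gt0.

Let r3_gt1 : 1 < r3. Proof. by case: dom. Qed.
Let r2_ge : r3 <= r2. Proof. by case: dom. Qed.
Let r1_ge : r2 <= r1. Proof. by case: dom. Qed.
Let r2_gt1 : 1 < r2. Proof. exact: lt_le_trans r2_ge. Qed.
Let r1_gt1 : 1 < r1. Proof. exact: lt_le_trans r1_ge. Qed.
Let r2_gt0 : 0 < r2. Proof. exact: lt_trans r2_gt1. Qed.
Let r1_gt0 : 0 < r1. Proof. exact: lt_trans r1_gt1. Qed.
Let r3_gt0 : 0 < r3. Proof. exact: lt_trans r3_gt1. Qed.
Let c_le1 : c <= 1. Proof. exact: cos_le1. Qed.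

Definition n3vec : 'cV[R[i]]_3 := polar_vec r1 r2 r3 s3 al 2.
Let b := beta r1 r2 r3 s3 al.

Lemma n3_0 : n3vec 0 0 = (Num.sqrt (csq b - r1 ^+ 2 + 1))%:C.
Proof. by rewrite mxE csqE_normc. Qed.
Lemma n3_1 : n3vec 1 0 = r1%:C. Proof. by rewrite mxE. Qed.
Lemma n3_2 : n3vec 2 0 = b. Proof. by rewrite mxE. Qed.

Lemma betaE : b = ((r1 * r3 - r2 * c) / s3) +i* (r2 * sin al / s3).
Proof.
rewrite /b /beta; apply/eqP; rewrite eq_complex /=; apply/andP; split; apply/eqP.
  by rewrite -/c; field; exact: lt0r_neq0.
by field; exact: lt0r_neq0.
Qed.

Let s30' : s3 != 0. Proof. exact: lt0r_neq0. Qed.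

Lemma csq_beta : csq b = (r1 ^+ 2 * r3 ^+ 2 + r2 ^+ 2 - 2 * r1 * r2 * r3 * c) / s3 ^+ 2.
Proof.
transitivity (((r1 * r3 - r2 * c) ^+ 2 + r2 ^+ 2 * sin al ^+ 2) / s3 ^+ 2).
  by rewrite betaE /csq /=; field.
by rewrite sin2cos2 -/c; field.
Qed.

Let e := (r1 ^+ 2 + r2 ^+ 2 + r3 ^+ 2 - 1 - 2 * r1 * r2 * r3 * c) / s3 ^+ 2.

Lemma zeta_sq : csq b - r1 ^+ 2 + 1 = e.
Proof.
have r3s : r3 ^+ 2 = 1 + s3 ^+ 2 by rewrite -rs subrK.
by rewrite csq_beta /e r3s; field.
Qed.

Lemma e_ge0 : 0 <= e.
Proof.
have p0 : 0 < 2 * r1 * r2 * r3 := mulr_gt0 (mulr_gt0 (mulr_gt0 (ltr0Sn R 1) r1_gt0) r2_gt0) r3_gt0.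
case: dom => _ _ _ _; rewrite -/c (ler_pdivlMr _ _ p0) => h.
apply: divr_ge0; last exact: sqr_ge0.
by rewrite subr_ge0 mulrC.
Qed.

Lemma csq_n3_0 : csq (n3vec 0 0) = e.
Proof. by rewrite n3_0 csqR zeta_sq sqr_sqrtr // e_ge0. Qed.

Lemma n3_unit : hq n3vec = 1.
Proof. by rewrite /hq csq_n3_0 n3_1 n3_2 csqR -zeta_sq; ring. Qed.

Let E'E : E' = r3 - s3. Proof. by rewrite r3E s3E; field. Qed.
Let EE : E = r3 + s3. Proof. by rewrite r3E s3E; field. Qed.

Lemma csqP_n3 : csq (lcP n3vec) = (r1 ^+ 2 * E' ^+ 2 + r2 ^+ 2 - 2 * r1 * r2 * E' * c) / s3 ^+ 2.
Proof.
rewrite /lcP n3_1 n3_2 E'E.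
transitivity (((r1 * (s3 - r3) + r2 * c) ^+ 2 + r2 ^+ 2 * sin al ^+ 2) / s3 ^+ 2).
  by rewrite betaE /csq /=; field.
by rewrite sin2cos2 -/c; field.
Qed.

Lemma csqQ_n3 : csq (lcQ n3vec) = (r1 ^+ 2 * E ^+ 2 + r2 ^+ 2 - 2 * r1 * r2 * E * c) / s3 ^+ 2.
Proof.
rewrite /lcQ n3_1 n3_2 EE.
transitivity (((r1 * (s3 + r3) - r2 * c) ^+ 2 + r2 ^+ 2 * sin al ^+ 2) / s3 ^+ 2).
  by rewrite betaE /csq /=; field.
by rewrite sin2cos2 -/c; field.
Qed.

Let F k := csq (lcP n3vec) * expk theta k + csq (lcQ n3vec) * expk theta (- k).

(** Expanding the pairing in null coordinates leaves the cross term 2 Re(lcP conj(lcQ)) = 2 (1 - e),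
    a consequence of <n_3, n_3> = 1. *)
Lemma csq_herm_n3 (j : nat) :
  4 * (csq (herm n3vec (nvec (theta * j%:R))) - 1) = F j - 2 * (1 + e).
Proof.
have h := herm_nvec n3vec (theta * j%:R).
have c4 : csq (2 * herm n3vec (nvec (theta * j%:R))) = 4 * csq (herm n3vec (nvec (theta * j%:R))).
  by rewrite csqM; congr (_ * _); rewrite /csq /=; ring.
have ab : expR (theta * j%:R) * expR (- (theta * j%:R)) = 1 :> R.
  by rewrite -expRD subrr expR0.
have aE : expk theta j = expR (theta * j%:R) ^+ 2.
  by rewrite expr2 -expRD /expk; congr expR; rewrite -[j%:~R]/(j%:R : R); ring.
have bE : expk theta (- (j : int)) = expR (- (theta * j%:R)) ^+ 2.
  by rewrite expr2 -expRD /expk; congr expR; rewrite rmorphN /= -[j%:~R]/(j%:R : R); ring.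
rewrite mulrBr -c4 h /F aE bE.
have q := n3_unit; rewrite hq_qL qL_lc csq_n3_0 in q.
move: (expR (theta * j%:R)) (expR (- (theta * j%:R))) ab => A B AB.
rewrite csqD !csqM !csqR.
have -> : Re (lcP n3vec * A%:C * (lcQ n3vec * B%:C)^*) =
  (A * B) * Re (lcP n3vec * (lcQ n3vec)^*).
  by case: (lcP n3vec) (lcQ n3vec) => [p p'] [u u'] /=; ring.
by rewrite AB; lra.
Qed.

(** The bracket in the denominator of t_j, equal to 4 sinh(j theta) sinh((j + 1) theta); it vanishes
    at j = 0. *)
Definition Dn (j : nat) : R := E ^+ (2 * j + 1) + E' ^+ (2 * j + 1) - 2 * r3.

Lemma DnE j : Dn j = (E ^+ j) ^+ 2 * E + (E' ^+ j) ^+ 2 * E' - (E + E').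
Proof. by rewrite /Dn !addn1 !exprSr ![(2 * j)%N]mulnC !exprM r3E; field. Qed.

Lemma Dn_gt0 j : (0 < j)%N -> 0 < Dn j.
Proof.
move=> j0; have xx : E ^+ j * E' ^+ j = 1 by rewrite -exprMn EE' expr1n.
have x1 : 1 < E ^+ j by rewrite exprn_egt1 // -lt0n.
have x'1 : E' ^+ j < 1 by rewrite exprn_ilt1 // ?ltW // -lt0n.
have x'0 : 0 < E' ^+ j by rewrite exprn_gt0.
have -> : Dn j = (E ^+ j - E' ^+ j) * (E ^+ j * E - E' ^+ j * E').
  by rewrite DnE -[E + E']mul1r -xx; ring.
rewrite mulr_gt0 // subr_gt0; first exact: lt_trans x1.
by apply: (@lt_trans _ _ 1); [exact: mulr_ilt1 (ltW x'0) (ltW E'0) x'1 E'1|exact: mulr_egt1 x1 E1].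
Qed.

Let EN : E != 0. Proof. by rewrite gt_eqF // (lt_trans ltr01). Qed.
Let E'V : E' = E^-1. Proof. by rewrite -[RHS]mulr1 -EE' mulKf. Qed.
Let EEN : E * E - 1 != 0.
Proof. by rewrite -EE' -mulrBr mulf_neq0 // gt_eqF // subr_gt0 (lt_trans E'1). Qed.

(** The origin of t_j: the left side is affine in cos alpha with negative slope, and t_j is its
    zero. With [csq_herm_n3] at j + 1, non-ellipticity becomes cos alpha <= t_j. *)
Lemma F_tn (j : nat) : (0 < j)%N ->
  F j.+1%:Z - 2 * (1 + e) = 2 * r1 * r2 * Dn j / s3 ^+ 2 * (t_ r1 r2 r3 s3 j - c).
Proof.
move=> j0; have D0 := lt0r_neq0 (Dn_gt0 j0).
have xx : E ^+ j * E' ^+ j = 1 by rewrite -exprMn EE' expr1n.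
have tE : 2 * r1 * r2 * Dn j / s3 ^+ 2 * t_ r1 r2 r3 s3 j =
    (A0 r1 r2 r3 s3 j + A1 r1 r2 r3 s3 j + A2 r1 r2 r3 s3) / s3 ^+ 3.
  rewrite /t_ -EE -E'E -/(Dn j); field.
  by rewrite D0 s30' (lt0r_neq0 r1_gt0) (lt0r_neq0 r2_gt0).
rewrite mulrBr tE /A0 /A1 /A2 -EE -E'E.
have aE : expk theta j.+1%:Z = (E ^+ j * E) ^+ 2.
  rewrite /expk -[j.+1%:~R]/(j.+1%:R : R) -exprSr -expRM_natl -expRM_natl; congr expR; ring.
have bE : expk theta (- j.+1%:Z) = (E' ^+ j * E') ^+ 2.
  rewrite /expk rmorphN /= -[j.+1%:~R]/(j.+1%:R : R) -exprSr -expRM_natl -expRM_natl; congr expR; ring.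
rewrite /F aE bE csqP_n3 csqQ_n3 DnE /e.
have -> : (2 * j + 2 = j.+1 * 2)%N by rewrite mulnC mulSn addnC.
rewrite !exprM !exprSr.
move: (E ^+ j) (E' ^+ j) xx => x x' xx.
have x0' : x != 0 by apply/eqP => h; move: xx; rewrite h mul0r => /eqP; rewrite eq_sym oner_eq0.
have x'V : x' = x^-1 by rewrite -[RHS]mulr1 -xx mulKf.
rewrite r3E s3E x'V E'V.
field.
by rewrite EN EEN x0'.
Qed.

Lemma expk_nat (j : nat) : expk theta j = (E ^+ j) ^+ 2.
Proof.
by rewrite /expk -[j%:~R]/(j%:R : R) -expRM_natl -expRM_natl; congr expR; ring.
Qed.

(** The ordering r_2 <= r_1 enters here; it keeps F from dropping below F(0) at negative k. *)
Lemma csqQ_ge_csqP : csq (lcP n3vec) <= csq (lcQ n3vec).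
Proof.
rewrite csqP_n3 csqQ_n3 -subr_ge0 -mulrBl divr_ge0 ?sqr_ge0 //.
have -> : r1 ^+ 2 * E ^+ 2 + r2 ^+ 2 - 2 * r1 * r2 * E * c
    - (r1 ^+ 2 * E' ^+ 2 + r2 ^+ 2 - 2 * r1 * r2 * E' * c)
    = r1 * (4 * s3) * (r1 * r3 - r2 * c) by rewrite EE E'E; ring.
have h1 : r2 * c <= r2 by rewrite ler_piMr // ltW.
have h2 : r1 <= r1 * r3 by rewrite ler_peMr // ltW.
have h3 : 0 <= r1 * r3 - r2 * c by have := r1_ge; lra.
apply: mulr_ge0 h3; apply: mulr_ge0; first exact: ltW.
by rewrite mulr_ge0 // ltW.
Qed.

(** With u = [expk theta k] <= 1, F(k) - F(0) = (1/u - 1) (Q - P u) is nonnegative, and F(0) - 2 (1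
    + e) = 4 (r_1^2 - 1) since |<n_3, n_2>| = r_1. *)
Lemma F_npos k : k <= 0 -> 2 * (1 + e) <= F k.
Proof.
move=> k0; have u1 : expk theta k <= 1.
  by rewrite -(expk0 theta) ler_expR ler_pM2l ?mulr_gt0 // ler_int.
have u0 := expk_gt0 theta k; have uv := expkNK theta k.
have := csqQ_ge_csqP; have P0 := csq_ge0 (lcP n3vec).
have F0 : csq (lcP n3vec) + csq (lcQ n3vec) - 2 * (1 + e) = 4 * (r1 ^+ 2 - 1).
  rewrite -csq_n3_0; have := n3_unit; rewrite /hq n3_1 csqR n3_2.
  have -> : csq (lcP n3vec) + csq (lcQ n3vec) = 2 * (r1 ^+ 2 + csq b).
    rewrite /lcP /lcQ n3_1 n3_2; case: b => p q; rewrite /csq /=; ring.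
  lra.
have r11 : 0 <= r1 ^+ 2 - 1 by rewrite subr_ge0 exprn_ege1 // ltW.
rewrite /F; move: (csq (lcP n3vec)) (csq (lcQ n3vec)) (expk theta k) (expk theta (- k)) u0 u1 uv P0 F0.
move=> P Q u v u0 u1 uv P0 F0 PQ.
have v1 : 1 <= v by nra.
have : 0 <= (v - 1) * (Q - P * u) by rewrite mulr_ge0 ?subr_ge0 //; nra.
have : P * u * v = P by rewrite -mulrA uv mulr1.
nra.
Qed.

(** The excess is 4 (r_2^2 - 1), since |<n_3, n_1>| = r_2. [F_tn] does not reach this case: t_0 has
    denominator 0. *)
Lemma F1 : 2 * (1 + e) <= F 1.
Proof.
rewrite /F expk1 expkN1 -/E -/E' csqP_n3 csqQ_n3 -subr_ge0.
have r21 : 0 <= r2 ^+ 2 - 1 by rewrite subr_ge0 exprn_ege1 // ltW.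
suff -> : (r1 ^+ 2 * E' ^+ 2 + r2 ^+ 2 - 2 * r1 * r2 * E' * c) / s3 ^+ 2 * E ^+ 2 +
  (r1 ^+ 2 * E ^+ 2 + r2 ^+ 2 - 2 * r1 * r2 * E * c) / s3 ^+ 2 * E' ^+ 2 - 2 * (1 + e) =
  4 * (r2 ^+ 2 - 1) by rewrite mulr_ge0.
rewrite /e r3E s3E E'V; field.
by rewrite EN EEN.
Qed.

Hypothesis Qp : 0 <= r1 ^+ 2 + r2 ^+ 2 - 2 * r1 * r2 * r3 * c.

Lemma e_ge1 : 1 <= e.
Proof.
rewrite /e ler_pdivlMr ?exprn_gt0 // mul1r.
by have := Qp; have := rs; lra.
Qed.

(** P u + Q/u is nondecreasing once P u^2 >= Q, which the second hypothesis states at k1. *)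
Lemma F_large (k1 k : int) : k1 <= k ->
  csq (lcQ n3vec) <= csq (lcP n3vec) * expk theta k1 ^+ 2 -> F k1 <= F k.
Proof.
move=> kk QP; rewrite /F.
have w1 : 1 <= expk theta (k - k1).
  by rewrite -(expk0 theta) ler_expR ler_pM2l ?mulr_gt0 // ler_int subr_ge0.
have kE : expk theta k = expk theta k1 * expk theta (k - k1).
  by rewrite -expkD [k1 + _]addrC subrK.
have kNE : expk theta (- k) = expk theta (- k1) * expk theta (- (k - k1)).
  by rewrite -expkD -opprD [k1 + _]addrC subrK.
rewrite kE kNE; have uv := expkNK theta k1; have wt := expkNK theta (k - k1).
have u0 := expk_gt0 theta k1; have v0 := expk_gt0 theta (- k1).
have t0 := expk_gt0 theta (- (k - k1)).
have := csq_ge0 (lcP n3vec).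
move: (csq (lcP n3vec)) (csq (lcQ n3vec)) (expk theta k1) (expk theta (- k1))
  (expk theta (k - k1)) (expk theta (- (k - k1))) QP w1 uv wt u0 v0 t0.
move=> P Q u v w t QP w1 uv wt u0 v0 t0 P0.
have t1 : t <= 1 by rewrite -wt ler_peMl // ltW.
have Qv : Q * v <= P * u.
  have : Q * v <= P * u ^+ 2 * v := ler_wpM2r (ltW v0) QP.
  have -> // : P * u ^+ 2 * v = P * u.
  by rewrite -[in RHS](mulr1 u) -uv; ring.
have Pu : P * u <= P * u * w by rewrite ler_peMr // mulr_ge0 // ltW.
rewrite -subr_ge0.
have -> : P * (u * w) + Q * (v * t) - (P * u + Q * v) = (1 - t) * (P * u * w - Q * v).
  have Puwt : P * u * w * t = P * u by rewrite -mulrA wt mulr1.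
  transitivity (P * (u * w) + Q * (v * t) - (P * u * w * t + Q * v)); last by ring.
  by rewrite Puwt.
by rewrite mulr_ge0 ?subr_ge0 // (le_trans Qv).
Qed.

(** Here v_J = tanh(J theta) and f(cos alpha) is the quotient of sqrt Q - sqrt P by sqrt Q + sqrt P,
    so v_J >= f(cos alpha) would mean Q <= P e^(4 J theta). Condition (iv) gives the inequality at
    cos alpha = 1, from which the actual value follows. *)
Lemma csqQ_le_csqP (J : nat) : (0 < J)%N -> 0 <= v_ r3 s3 J - f_ r1 r2 r3 s3 1 ->
  csq (lcQ n3vec) <= csq (lcP n3vec) * expk theta J ^+ 2.
Proof.
move=> J0; rewrite /v_ /f_ -EE -E'E /x0 /x1 /y0 /y1 -EE -E'E !mulr1.
have -> : r1 ^+ 2 * E ^+ 2 + r2 ^+ 2 - 2 * r1 * r2 * E = (r1 * E - r2) ^+ 2 by ring.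
have -> : r1 ^+ 2 * E' ^+ 2 + r2 ^+ 2 - 2 * r1 * r2 * E' = (r1 * E' - r2) ^+ 2 by ring.
rewrite !sqrtr_sqr expk_nat csqP_n3 csqQ_n3.
have xx : E ^+ J * E' ^+ J = 1 by rewrite -exprMn EE' expr1n.
have Ex : E <= E ^+ J by rewrite -{1}[E]expr1 ler_weXn2l // ltW.
have x'0 : 0 < E' ^+ J by rewrite exprn_gt0.
move: (E ^+ J) (E' ^+ J) xx Ex x'0 => x x' xx Ex x'0.
have E0 : 0 < E by apply: lt_trans E1.
have xp : 0 < x by apply: lt_le_trans Ex.
have X0 : 0 < r1 * E - r2.
  by rewrite subr_gt0 (le_lt_trans r1_ge) // ltr_pMr.
rewrite (gtr0_norm X0); set Y := `|r1 * E' - r2|.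
have Y0 : 0 <= Y by rewrite normr_ge0.
have YY : Y ^+ 2 = (r1 * E' - r2) ^+ 2 by rewrite /Y real_normK ?num_real.
have s1 : 0 < (r1 * E - r2) + Y by rewrite ltr_wpDr.
have s2 : 0 < x + x' by rewrite addr_gt0.
rewrite subr_ge0 (ler_pdivrMr _ _ s1) mulrAC (ler_pdivlMr _ _ s2) => h.
have h1 : (r1 * E - r2) * x' <= Y * x by lra.
have h2 : r1 * E - r2 <= Y * x ^+ 2.
  have : (r1 * E - r2) * x' * x <= Y * x * x by rewrite ler_pM2r.
  by rewrite -mulrA [x' * x]mulrC xx mulr1 -mulrA -expr2.
have h3 : (r1 * E - r2) ^+ 2 <= Y ^+ 2 * x ^+ 2 ^+ 2.
  by rewrite -exprMn ler_sqr // nnegrE ?(ltW X0) // mulr_ge0 // sqr_ge0.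
rewrite YY in h3.
rewrite [leRHS]mulrAC ler_pM2r ?invr_gt0 ?exprn_gt0 //.
have xE : E <= x ^+ 2 ^+ 2 * E'.
  have EE2 : E * E <= x * x by rewrite ler_pM // ltW.
  have x1 : 1 <= x by apply: le_trans Ex; exact: ltW.
  have : E * E * E' <= x ^+ 2 ^+ 2 * E'.
    rewrite ler_pM2r // (le_trans EE2) // -!expr2 ler_peMr ?sqr_ge0 //.
    by rewrite exprn_ege1.
  by rewrite -mulrA EE' mulr1.
move: (x ^+ 2 ^+ 2) h3 xE => w h3 xE.
(* Passing from cosine 1 to c adds 2 r1 r2 (1 - c) E on the left and w E' times the same factor in
   place of E on the right; [xE] compares them. *)
have d : 0 <= 2 * r1 * r2 * (1 - c) * (w * E' - E).
  by rewrite !mulr_ge0 // ?subr_ge0 // ltW.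
by rewrite -subr_ge0; lra.
Qed.

(** The difference of the two sides is 16/s_3^2 times q(c), q(t) = a_2 t^2 + a_1 t + a_0. Condition
    (ii) says q'(t) <= 0 and (iii) says q(t) >= 0; as q is convex, q(c) >= q(t) for c <= t. *)
Lemma product_bound (t : R) : c <= t ->
  2 * r3 ^+ 2 * (r1 ^+ 2 + r2 ^+ 2) - 4 * r1 * r2 * r3 * t - 1 >= 0 ->
  a2 r1 r2 r3 * t ^+ 2 + a1 r1 r2 r3 * t + a0 r1 r2 r3 >= 0 ->
  16 * e <= (expk theta 1 - expk theta (- 1)) ^+ 2 * csq (lcP n3vec) * csq (lcQ n3vec).
Proof.
move=> ct h2 h3; rewrite expk1 expkN1 -/E -/E'.
have mono : 0 <= a2 r1 r2 r3 * c ^+ 2 + a1 r1 r2 r3 * c + a0 r1 r2 r3.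
  apply: le_trans h3 _; rewrite -subr_ge0.
  have -> : a2 r1 r2 r3 * c ^+ 2 + a1 r1 r2 r3 * c + a0 r1 r2 r3 -
    (a2 r1 r2 r3 * t ^+ 2 + a1 r1 r2 r3 * t + a0 r1 r2 r3) =
    (t - c) * (2 * r1 * r2 * r3) * ((2 * r3 ^+ 2 * (r1 ^+ 2 + r2 ^+ 2) - 4 * r1 * r2 * r3 * t - 1)
      + 2 * r1 * r2 * r3 * (t - c)).
    by rewrite /a2 /a1; ring.
  have p0 : 0 <= 2 * r1 * r2 * r3 by rewrite !mulr_ge0 // ltW.
  have tc : 0 <= t - c by rewrite subr_ge0.
  exact: mulr_ge0 (mulr_ge0 tc p0) (addr_ge0 h2 (mulr_ge0 p0 tc)).
have -> : (E ^+ 2 - E' ^+ 2) ^+ 2 * csq (lcP n3vec) * csq (lcQ n3vec) =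
  16 * e + 16 * (a2 r1 r2 r3 * c ^+ 2 + a1 r1 r2 r3 * c + a0 r1 r2 r3) / s3 ^+ 2.
  rewrite csqP_n3 csqQ_n3 /e /a2 /a1 /a0 r3E s3E E'V; field.
  by rewrite EN EEN.
by rewrite lerDl divr_ge0 ?sqr_ge0 // mulr_ge0.
Qed.

End PolarVectors.

(** Non-ellipticity of the n-th word gives cos alpha <= t_n, and the minimality of t_n spreads this
    bound to all t_j with j <= k_0 + 1. *)
Lemma K_well_separated (R : realType) (m3 : R) (k0 n : nat) (p : 'rV[R]_3) :
  0 < m3 -> (1 <= n <= k0)%N -> K m3 k0 n p ->
  let n3 := polar_of m3 p 2 in
  1 <= csq (herm n3 (nvec (m3 / 2 * n.+1%:R))) -> well_separated (m3 / 2) n3.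
Proof.
move=> m30 /andP[n0 nk] [_ _ [dom [tk [hi hii hiii hiv]]]] n3 h.
have th0 : 0 < m3 / 2 by rewrite divr_gt0.
set r1 := cosh (p 0 0 / 2) in dom tk hi hii hiii hiv.
set r2 := cosh (p 0 1 / 2) in dom tk hi hii hiii hiv.
have [[_ r31 r32 r21 _] s0] := (dom, sinh_gt0 th0).
have r1p : 0 < r1 by rewrite (lt_trans ltr01) // (lt_le_trans r31) // (le_trans r32).
have r2p : 0 < r2 by rewrite (lt_trans ltr01) // (lt_le_trans r31).
have Fpos j : (0 < j)%N ->
    0 < 2 * r1 * r2 * Dn (m3 / 2) j / sinh (m3 / 2) ^+ 2.
  move=> j0; exact: divr_gt0 (mulr_gt0 (mulr_gt0 (mulr_gt0 (ltr0Sn R 1) r1p) r2p)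
    (Dn_gt0 th0 j0)) (exprn_gt0 2 s0).
have tn : cos (p 0 2) <= t_ r1 r2 (cosh (m3 / 2)) (sinh (m3 / 2)) n.
  have := csq_herm_n3 th0 dom n.+1; rewrite (F_tn th0 dom n0) => hE.
  rewrite -subr_ge0 -(pmulr_rge0 _ (Fpos n n0)) -hE mulr_ge0 // subr_ge0.
  exact: h.
have tj j : (1 <= j <= k0.+1)%N -> cos (p 0 2) <= t_ r1 r2 (cosh (m3 / 2)) (sinh (m3 / 2)) j.
  move=> jk; have [->//|jn] := eqVneq j n.
  exact: le_trans tn (tk j jk jn).
have Qp : 0 <= r1 ^+ 2 + r2 ^+ 2 - 2 * r1 * r2 * cosh (m3 / 2) * cos (p 0 2).
  have r3p : 0 < cosh (m3 / 2) by apply: lt_trans r31.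
  apply: le_trans hi _; rewrite lerD2l lerN2 ler_pM2l //.
  exact: mulr_gt0 (mulr_gt0 (mulr_gt0 (ltr0Sn R 1) r1p) r2p) r3p.
have Fj (j : nat) : (1 <= j <= k0.+1)%N ->
    2 * (1 + csq (n3 0 0)) <= csq (lcP n3) * expk (m3 / 2) j.+1
      + csq (lcQ n3) * expk (m3 / 2) (- j.+1%:Z).
  move=> jk; rewrite -subr_ge0 -[csq (n3 0 0)]/(csq (n3vec (m3 / 2) r1 r2 (p 0 2) 0 0)).
  rewrite (csq_n3_0 th0 dom) (F_tn th0 dom); last by case/andP: jk.
  rewrite mulr_ge0 ?subr_ge0 ?tj // ltW // Fpos //; by case/andP: jk.
split=> //.
- exact: (n3_unit th0 dom).
- rewrite -[csq _]/(csq (n3vec (m3 / 2) r1 r2 (p 0 2) 0 0)) (csq_n3_0 th0 dom).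
  by apply: e_ge1.
(* The half-turn k = j + 2 belongs to t_(j+1), so the last index controlled by some t is k_0 + 2;
   beyond it (iv) takes over. *)
- case=> [[|[|j]]|j].
  + by have := F_npos th0 dom (lexx 0); rewrite -(csq_n3_0 th0 dom).
  + by have := F1 th0 dom; rewrite -(csq_n3_0 th0 dom).
  + have [jk|jk] := leqP j.+1 k0.+1; first exact: Fj.
    apply: le_trans (Fj k0.+1 _) _; first by rewrite leqnn.
    apply: (F_large th0 (r1 := r1) (r2 := r2) (al := p 0 2)); first by rewrite lez_nat ltnW.
    rewrite addn2 in hiv; exact: (csqQ_le_csqP th0 dom (ltn0Sn _) hiv).
  + by have := F_npos th0 dom (k := Negz j) isT; rewrite -(csq_n3_0 th0 dom).
- rewrite -[csq (n3 0 0)]/(csq (n3vec (m3 / 2) r1 r2 (p 0 2) 0 0)) (csq_n3_0 th0 dom).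
  exact: (product_bound th0 dom tn hii hiii).
Qed.

(** * Distances of complex geodesics *)

Section Distance.
Variable R : realType.
Implicit Types (z w n y : 'cV[R[i]]_3) (x d q : R) (p : pline R).

Lemma cosh_lt x d : 0 <= x -> x < d -> cosh x < cosh d.
Proof.
move=> x0 xd; rewrite -subr_gt0.
have -> : cosh d - cosh x = (expR d - expR x) * (1 - expR (- (x + d))) / 2.
  have h1 : expR d * expR (- (x + d)) = expR (- x) by rewrite -expRD; congr expR; ring.
  have h2 : expR x * expR (- (x + d)) = expR (- d) by rewrite -expRD; congr expR; ring.
  by rewrite /cosh -h1 -h2; field.
rewrite divr_gt0 // mulr_gt0 // subr_gt0 ?ltr_expR //.
by rewrite -expR0 ltr_expR oppr_lt0; lra.
Qed.

Lemma cosh_le x d : 0 <= x -> 0 <= d -> (cosh x <= cosh d) = (x <= d).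
Proof.
move=> x0 d0; apply/idP/idP => h.
  by rewrite leNgt; apply/negP => /(cosh_lt d0); rewrite ltNge h.
by move: h; rewrite le_eqVlt => /orP[/eqP ->//|/(cosh_lt x0)/ltW].
Qed.

Lemma cosh_ge1 x : 1 <= cosh x.
Proof.
have ab : expR x * expR (- x) = 1 by rewrite -expRD subrr expR0.
have := expR_gt0 x; have := expR_gt0 (- x).
have := sqr_ge0 (expR x - 1).
by rewrite /cosh; nra.
Qed.

Lemma cosh_surj q : 1 <= q -> exists2 d, 0 <= d & cosh (d / 2) ^+ 2 = q.
Proof.
(* a and b will be cosh(d/2) and sinh(d/2), so that d/2 = ln(a + b). *)
move=> q1; pose a := Num.sqrt q; pose b := Num.sqrt (q - 1).
have q0 : 0 <= q by apply: le_trans q1.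
have aa : a ^+ 2 = q by rewrite sqr_sqrtr.
have bb : b ^+ 2 = q - 1 by rewrite sqr_sqrtr // subr_ge0.
have a1 : 1 <= a by rewrite -(@ler_sqr R) ?nnegrE ?sqrtr_ge0 // aa expr1n.
have b0 : 0 <= b by rewrite sqrtr_ge0.
have ab1 : 1 <= a + b by rewrite -[leLHS]addr0 lerD.
have ab0 : 0 < a + b by apply: lt_le_trans ab1.
exists (2 * ln (a + b)); first by rewrite mulr_ge0 // ln_ge0.
have -> : 2 * ln (a + b) / 2 = ln (a + b) by field.
rewrite /cosh expRN lnK ?posrE //.
have -> : (a + b)^-1 = a - b.
  apply: (mulfI (lt0r_neq0 ab0)); rewrite mulfV ?lt0r_neq0 //.
  by rewrite mulrC -subr_sqr aa bb; ring.
by rewrite -aa; field.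
Qed.

Lemma hq_neg_neq0 z : hq z < 0 -> z != 0.
Proof. by move=> zn; apply/eqP => z0; rewrite z0 hq0 ltxx in zn. Qed.

Lemma vpick_line z : z != 0 -> exists2 c, c != 0 & vpick <[z]>%VS = c *: z.
Proof.
move=> z0; have /vlineP[c cE] := memv_pick <[z]>%VS; exists c => //.
have : vpick <[z]>%VS != 0 by rewrite vpick0 -subv0 -memvE memv0.
by rewrite cE; apply: contraNneq => ->; rewrite scale0r.
Qed.

(** The quotient is unchanged under rescaling of the representatives and is at least 1 by
    [reverse_cauchy_schwarz], so [xget] finds a solution. *)
Lemma rhoP z w : hq z < 0 -> hq w < 0 ->
  0 <= rho <[z]> <[w]> /\
  cosh (rho <[z]> <[w]> / 2) ^+ 2 = csq (herm z w) / (hq z * hq w).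
Proof.
move=> zn wn; have [c c0 cE] := vpick_line (hq_neg_neq0 zn).
have [d d0 dE] := vpick_line (hq_neg_neq0 wn).
rewrite /rho cE dE.
have -> : herm (c *: z) (d *: w) * herm (d *: w) (c *: z) /
    (herm (c *: z) (c *: z) * herm (d *: w) (d *: w)) =
    (csq (herm z w) / (hq z * hq w))%:C.
  rewrite -(herm_conj (c *: z)) mulcJ !hermE !hqZ hermZl hermZr !csqM csqJ.
  rewrite -realcM -realcV -realcM; congr (_%:C).
  have cN : csq c != 0 by rewrite csq_eq0.
  have dN : csq d != 0 by rewrite csq_eq0.
  by field; rewrite cN dN !lt_eqF.
have q1 : 1 <= csq (herm z w) / (hq z * hq w).
  by rewrite ler_pdivlMr ?mul1r ?reverse_cauchy_schwarz // nmulr_rgt0.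
set S := [set _ | _].
suff [] : S (xget 0 S) by move=> ? /complexI.
have [t t0 tE] := cosh_surj q1.
by apply: xgetPex; exists t; split=> //; rewrite tE.
Qed.

Lemma cgeodP n p : cgeod n p <-> exists z, [/\ hq z < 0, herm z n = 0 & p = <[z]>%VS].
Proof.
split=> [[[z zn <-] [w [w0 wn] wE]]|[z [zn zz ->]]].
  have zn' : hq z < 0 by move: zn; rewrite /= hermE -[0]/(0%:C) ltcR.
  exists z; split=> //; have [c c0 cE] := line_eq w0 wE.
  move: wn; rewrite cE hermZl => /eqP; rewrite mulf_eq0 (negPf c0) /= => /eqP//.
split; first by exists z => //=; rewrite hermE -[0]/(0%:C) ltcR.
by exists z => //=; rewrite hq_neg_neq0.
Qed.

Lemma hq_sub_proj n w : herm n n = 1 -> hq (w - herm w n *: n) = hq w - csq (herm w n).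
Proof.
move=> n1; have : herm (w - herm w n *: n) (w - herm w n *: n) =
    herm w w - herm w n * (herm w n)^*.
  by rewrite !(hermBl, hermBr, hermZl, hermZr) n1 -(herm_conj w n); ring.
by rewrite mulcJ !hermE -realcB => -[].
Qed.

Section Pair.
Variables n n' : 'cV[R[i]]_3.
Hypotheses (n1 : herm n n = 1) (n1' : herm n' n' = 1).
Hypothesis c1 : 1 < csq (herm n n').

(** The feet of the common perpendicular: y on the geodesic of n', y' on that of n. *)
Let y := n - herm n n' *: n'.
Let y' := n' - herm n' n *: n.

Lemma foot_neg : hq y < 0.
Proof. by rewrite hq_sub_proj // (_ : hq n = 1) ?subr_lt0 //; move: n1; rewrite hermE => -[]. Qed.
Lemma foot_neg' : hq y' < 0.
Proof.
by rewrite hq_sub_proj // (_ : hq n' = 1) ?subr_lt0 1?csq_hermC //; move: n1'; rewrite hermE => -[].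
Qed.

Lemma foot_orth : herm y n' = 0.
Proof. by rewrite hermBl hermZl n1' mulr1 subrr. Qed.
Lemma foot_orth' : herm y' n = 0.
Proof. by rewrite hermBl hermZl n1 mulr1 subrr. Qed.

Lemma closure_line m p : cgeod_closure m p ->
  exists z, [/\ z != 0, hq z <= 0, herm z m = 0 & p = <[z]>%VS].
Proof.
move=> [pH [w [w0 wn] wE]]; exists w; split=> //.
have [z z0 zw] : exists2 z, hq z <= 0 & <[z]>%VS = p.
  case: pH => [[z zn <-]|[z [_ zn] <-]]; exists z => //.
    by move: zn; rewrite /= hermE -[0]/(0%:C) ltcR => /ltW.
  by move: zn; rewrite hermE => -[->].
have [c c0 ->] := line_eq w0 (etrans wE (esym zw)).
by rewrite hqZ mulr_ge0_le0 // csq_ge0.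
Qed.

(** A common point would be orthogonal to n and n', hence to the negative vector y, and so would be
    positive. *)
Lemma far_ultra_parallel : ultra_parallel n n'.
Proof.
apply/seteqP; split=> // p [/closure_line[z [z0 zn zo ->]] /closure_line[w [w0 _ wo wE]]].
have [c c0 cE] := line_eq w0 (esym wE).
have zo' : herm z n' = 0.
  by move: wo; rewrite cE hermZl => /eqP; rewrite mulf_eq0 (negPf c0) /= => /eqP.
have : 0 < hq z.
  apply: (herm_orth_neg foot_neg) => //.
  by rewrite hermBr hermZr zo zo' mulr0 subrr.
by rewrite ltNge zn.
Qed.

Lemma far_cgeod_neq : cgeod n <> cgeod n'.
Proof.
move=> E; have yn' : cgeod n' <[y]>%VS.
  by apply/cgeodP; exists y; split=> //; [exact: foot_neg|exact: foot_orth].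
have yn : cgeod n <[y]>%VS by rewrite E.
have sub m p : cgeod m p -> cgeod_closure m p by move=> [h1 h2]; split=> //; left.
have : (cgeod_closure n `&` cgeod_closure n') <[y]>%VS by split; exact: sub.
by rewrite far_ultra_parallel.
Qed.

(** Two reverse Cauchy-Schwarz inequalities: z against the projection of w to the complement of n,
    then w against y to bound |<w, n>|^2 from below. *)
Lemma far_distance_lb z w : hq z < 0 -> hq w < 0 -> herm z n = 0 -> herm w n' = 0 ->
  csq (herm n n') <= csq (herm z w) / (hq z * hq w).
Proof.
move=> zn wn zo wo; rewrite ler_pdivlMr ?nmulr_rgt0 //.
have h1 := reverse_cauchy_schwarz (w - herm w n *: n) zn.
have zw' : herm z (w - herm w n *: n) = herm z w.
  by rewrite hermBr hermZr zo mulr0 subr0.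
rewrite zw' hq_sub_proj // in h1.
have h2 := reverse_cauchy_schwarz y wn.
have wy : herm w y = herm w n by rewrite hermBr hermZr wo mulr0 subr0.
have hy : hq y = 1 - csq (herm n n').
  by rewrite hq_sub_proj // (_ : hq n = 1) //; move: n1; rewrite hermE => -[].
rewrite wy hy in h2.
by apply: le_trans h1; nra.
Qed.

(** The lower bound is attained at the feet y' and y. *)
Lemma far_set_dist (m : R) : 0 < m -> csq (herm n n') = cosh (m / 2) ^+ 2 ->
  set_dist (cgeod n) (cgeod n') = m.
Proof.
move=> m0 cE.
have coshsq x d : 0 <= x -> 0 <= d -> cosh (x / 2) ^+ 2 <= cosh (d / 2) ^+ 2 -> x <= d.
  move=> x0 d0; rewrite ler_sqr ?nnegrE ?(le_trans ler01 (cosh_ge1 _)) //.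
  by rewrite cosh_le ?divr_ge0 // ler_pM2r // invr_gt0.
have [ry0 ryE] := rhoP foot_neg' foot_neg.
have cd : csq (herm y' y) / (hq y' * hq y) = csq (herm n n').
  have hyy : herm y' y = herm n' n * (csq (herm n n') - 1)%:C.
    have cc : herm n' n * herm n n' = (csq (herm n n'))%:C.
      by rewrite -(herm_conj n n') mulrC mulcJ.
    have -> : herm y' y = herm y' n - (herm n n')^* * herm y' n'.
      by rewrite hermBr hermZr.
    rewrite foot_orth' sub0r herm_conj hermBl hermZl n1' cc realcB.
    by rewrite -mulrN opprB.
  rewrite hyy csqM csqR csq_hermC !hq_sub_proj //.
  have [-> ->] : hq n = 1 /\ hq n' = 1.
    by split; [move: n1|move: n1']; rewrite hermE => -[].
  rewrite (csq_hermC n' n).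
  have N : 1 - csq (herm n n') != 0 by rewrite lt_eqF // subr_lt0.
  by field.
rewrite cd cE in ryE.
have rm : rho <[y']> <[y]> = m.
  by apply/le_anti/andP; split; apply: coshsq; rewrite ?ryE // ltW.
pose A := [set rho p q | p in cgeod n & q in cgeod n'].
have Am : A m.
  exists <[y']>%VS; first by apply/cgeodP; exists y'; split=> //; [exact: foot_neg'|exact: foot_orth'].
  exists <[y]>%VS; last exact: rm.
  by apply/cgeodP; exists y; split=> //; [exact: foot_neg|exact: foot_orth].
have Alb : lbound A m.
  move=> _ [p /cgeodP[z [zn zo ->]] [q /cgeodP[w [wn wo ->]] <-]].
  have [r0 rE] := rhoP zn wn; apply: coshsq => //; first exact: ltW.
  by rewrite rE -cE far_distance_lb.
apply/le_anti/andP; split.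
  by apply: ge_inf => //; exists m.
by apply: lb_le_inf => //; exists m.
Qed.

End Pair.
End Distance.

(** * The representation attached to a point of K_n *)

Section TriangleRepresentation.
Variables (R : realType) (m3 : R) (k0 n : nat) (p : 'rV[R]_3).
Hypotheses (m30 : 0 < m3) (pK : K m3 k0 n p).
Let nv := polar_of m3 p.
Let r1 := cosh (p 0 0 / 2).
Let r2 := cosh (p 0 1 / 2).
Let r3 := cosh (m3 / 2).
Let s3 := sinh (m3 / 2).
Let th0 : 0 < m3 / 2. Proof. by rewrite divr_gt0. Qed.
Let dom : domain r1 r2 r3 (p 0 2). Proof. by case: pK => _ _ []. Qed.
Let s30 : 0 < s3. Proof. exact: sinh_gt0 th0. Qed.

Lemma I3P (j : 'I_3) : [\/ j = 0, j = 1 | j = 2].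
Proof.
by case: j => -[|[|[|//]]] lti; [apply: Or31|apply: Or32|apply: Or33]; apply: val_inj.
Qed.

Lemma polar_ofE : nv = gen (m3 / 2) (nv 2).
Proof.
apply/funext => j; have [->|->|->] := I3P j; [by []| |by []].
apply/colP => i; have [->|->|->] := I3P i; rewrite !mxE //.
  by rewrite /cosh oppr0 expR0 /=; congr (_%:C); field.
by rewrite /sinh oppr0 expR0 /= subrr mul0r.
Qed.

Lemma polar_unit j : herm (nv j) (nv j) = 1.
Proof.
have [->|->|->] := I3P j.
- exact: nvec_unit.
- by rewrite polar_ofE; exact: nvec_unit.
- by rewrite hermE (n3_unit th0 dom).
Qed.

(** The choice of beta makes this pairing r_2 e^(i alpha). The other two are the positive reals r_3
    and r_1, so the triple product has argument alpha. *)
Lemma herm02 : herm (nv 0) (nv 2) = r2%:C * (cos (p 0 2) +i* sin (p 0 2)).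
Proof.
transitivity ((r1 * r3)%:C - s3%:C * (beta r1 r2 r3 s3 (p 0 2))^*).
  rewrite -[nv 0]/(nvec (m3 / 2)) -[nv 2]/(n3vec (m3 / 2) r1 r2 (p 0 2)) herm_conjc.
  by rewrite !nvecE n3_1 n3_2 mul0r add0r conjc_real realcM mulrC.
rewrite (betaE _ _ _ th0) -/r3 -/s3; apply/eqP; rewrite eq_complex /=.
by apply/andP; split; apply/eqP; field; exact: lt0r_neq0.
Qed.

Let n20 : nv 1 0 0 = 0. Proof. by rewrite mxE. Qed.
Let n21 : nv 1 1 0 = 1. Proof. by rewrite mxE. Qed.
Let n22 : nv 1 2 0 = 0. Proof. by rewrite mxE. Qed.

Lemma herm10 : herm (nv 1) (nv 0) = r3%:C.
Proof.
rewrite -[nv 0]/(nvec (m3 / 2)) herm_conjc n20 n21 n22 !nvecE !conjc_real.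
by rewrite !mul0r mul1r add0r subr0.
Qed.

Lemma herm21 : herm (nv 2) (nv 1) = r1%:C.
Proof.
rewrite -[nv 2]/(n3vec (m3 / 2) r1 r2 (p 0 2)) herm_conjc n20 n21 n22 n3_1.
by rewrite conj0c conjc1 !mulr0 mulr1 add0r subr0.
Qed.

Let r3_gt1 : 1 < r3. Proof. by case: dom. Qed.
Let r2_gt1 : 1 < r2. Proof. by case: dom => _ _ h _ _; exact: lt_le_trans h. Qed.
Let r1_gt1 : 1 < r1. Proof. by case: dom => _ _ _ h _; exact: lt_le_trans h. Qed.

Lemma csq02 : csq (herm (nv 0) (nv 2)) = r2 ^+ 2.
Proof.
by rewrite herm02 csqM csqR /csq /= cos2Dsin2 mulr1.
Qed.

Lemma polar_far j k : j != k -> 1 < csq (herm (nv j) (nv k)).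
Proof.
have sq (r : R) : 1 < r -> 1 < r ^+ 2 by move=> h; rewrite exprn_egt1.
have h02 : 1 < csq (herm (nv 0) (nv 2)) by rewrite csq02; exact: sq.
have h10 : 1 < csq (herm (nv 1) (nv 0)) by rewrite herm10 csqR; exact: sq.
have h21 : 1 < csq (herm (nv 2) (nv 1)) by rewrite herm21 csqR; exact: sq.
have [->|->|->] := I3P j; have [->|->|->] := I3P k => // _; by [|rewrite csq_hermC].
Qed.

Lemma polar_angular : angular_invariant nv (p 0 2).
Proof.
have [/andP[al0 alpi] _ _ _ _] := dom.
have r1p : 0 < r1 by apply: lt_trans r1_gt1.
have r2p : 0 < r2 by apply: lt_trans r2_gt1.
have r3p : 0 < r3 by apply: lt_trans r3_gt1.
rewrite /angular_invariant herm02 herm10 herm21.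
set a := p 0 2; pose u : R[i] := cos a +i* sin a.
have u1 : csq u = 1 by rewrite /csq /= cos2Dsin2.
have -> : r2%:C * (cos a +i* sin a) * r3%:C * r1%:C = (r1 * r2 * r3)%:C * u.
  by rewrite !realcM /u; ring.
have rp : 0 < r1 * r2 * r3 by rewrite pmulr_rgt0 // pmulr_rgt0.
have nE : `|(r1 * r2 * r3)%:C * u| = (r1 * r2 * r3)%:C.
  by rewrite normcE_csq csqM csqR u1 mulr1 sqrtr_sqr gtr0_norm.
split.
- by rewrite -csq_eq0 csqM csqR u1 mulr1 expf_neq0 // gt_eqF.
- rewrite alpi andbT (lt_le_trans _ al0) // oppr_lt0; exact: pi_gt0.
- by rewrite nE.
Qed.

Lemma cosh_half_le (x y : R) : 0 <= x -> 0 <= y -> cosh (x / 2) <= cosh (y / 2) -> x <= y.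
Proof.
by move=> x0 y0; rewrite cosh_le ?divr_ge0 // ler_pM2r // invr_gt0.
Qed.

Lemma polar_triangle_rep :
  exists phi : {multiplicative Gamma -> PU21 R},
    triangle_rep (triple (p 0 0) (p 0 1) m3) nv phi.
Proof.
have [phi phiE] := rep_exists nv; exists phi.
have [p00 p01 _] := pK; have [_ _ r32 r21 _] := dom.
have m2 : m3 <= p 0 1 by apply: cosh_half_le r32 => //; exact: ltW.
have m1 : p 0 1 <= p 0 0 by exact: cosh_half_le r21.
split=> //.
- by split=> //; exact: ltW.
- by move=> j; rewrite polar_unit ltr01.
- move=> j k /polar_far jk; split; first exact: (far_cgeod_neq (polar_unit j) (polar_unit k) jk).
  by left; exact: (far_ultra_parallel (polar_unit j) (polar_unit k) jk).
move=> j; have [->|->|->] := I3P j.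
- have -> : (0 - 1 : 'I_3) = 2 by apply: val_inj.
  rewrite add0r; apply: (far_set_dist (polar_unit 2) (polar_unit 1) (polar_far _)) => //.
    exact: lt_le_trans (le_trans m2 m1).
  by rewrite herm21 csqR.
- have -> : (1 + 1 : 'I_3) = 2 by apply: val_inj.
  rewrite subrr; apply: (far_set_dist (polar_unit 0) (polar_unit 2) (polar_far _)) => //.
    exact: lt_le_trans m2.
  by rewrite csq02.
- have -> : (2 + 1 : 'I_3) = 0 by apply: val_inj.
  have -> : (2 - 1 : 'I_3) = 1 by apply: val_inj.
  apply: (far_set_dist (polar_unit 1) (polar_unit 0) (polar_far _)) => //.
  by rewrite herm10 csqR.
Qed.

Lemma polar_criterion (phi : {multiplicative Gamma -> PU21 R}) :
  (1 <= n <= k0)%N -> (forall j, phi (iota_ j) = crefl (nv j)) ->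
  discrete_rep phi /\ faithful_rep phi <->
  ~ elliptic (crefl (nv 0%R) * (crefl (nv 1%R) * crefl (nv 0%R)) ^+ n * crefl (nv 2%R))%g.
Proof.
move=> nk phiE; have b1 : hq (nv 2) = 1 by exact: (n3_unit th0 dom).
have ws := K_well_separated m30 nk pK.
rewrite polar_ofE in phiE *.
exact: (discrete_faithful_iff b1 ws phiE).
Qed.

End TriangleRepresentation.

(** * Semianalyticity *)

Section PowerSeries.
Variable R : realType.
Implicit Types (h : R -> R) (a s t : R) (N k : nat).

(** Convergence is asked for every t: the functions of one variable used here are entire, and no
    radius has to be tracked. *)
Definition power_series_at h a := exists c : nat -> R, forall t,
  (exists M : R, forall N, \sum_(k < N) `|c k * (t - a) ^+ k| <= M) /\
  (fun N => \sum_(k < N) c k * (t - a) ^+ k) @ \oo --> h t.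

Lemma sum_exp_coeff_le (y : R) N : \sum_(k < N) exp_coeff `|y| k <= expR `|y|.
Proof.
have -> : \sum_(k < N) exp_coeff `|y| k = series (exp_coeff `|y|) N.
  by rewrite seriesEord.
apply: nondecreasing_cvgn_le; last exact: is_cvg_series_exp_coeff.
apply/nondecreasing_seqP => m; rewrite seriesSr lerDl.
exact: exp_coeff_ge0.
Qed.

Lemma power_series_expR s a : power_series_at (fun t => expR (s * t)) a.
Proof.
exists (fun k => expR (s * a) * s ^+ k / k`!%:R) => t.
have E k : expR (s * a) * s ^+ k / k`!%:R * (t - a) ^+ k =
    expR (s * a) * exp_coeff (s * (t - a)) k.
  by rewrite /exp_coeff /= exprMn; ring.
split.
  exists (expR (s * a) * expR `|s * (t - a)|) => N.
  apply: le_trans (_ : expR (s * a) * \sum_(k < N) exp_coeff `|s * (t - a)| k <= _).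
    rewrite mulr_sumr; apply: ler_sum => k _; rewrite E normrM gtr0_norm ?expR_gt0 //.
    rewrite ler_pM2l ?expR_gt0 // /exp_coeff /= normrM normfV normrX.
    by rewrite [`|_%:R|]ger0_norm.
  by rewrite ler_pM2l ?expR_gt0 // sum_exp_coeff_le.
have -> : expR (s * t) = expR (s * a) * expR (s * (t - a)).
  by rewrite -expRD; congr expR; ring.
under eq_fun do under eq_bigr do rewrite E.
under eq_fun do rewrite -mulr_sumr.
apply: cvgM; first exact: cvg_cst.
by have := is_cvg_series_exp_coeff (s * (t - a)); rewrite /expR seriesEord.
Qed.

Lemma power_series_id a : power_series_at id a.
Proof.
exists (fun k => if k == 0%N then a else if k == 1%N then 1 else 0) => t.
split.
  exists (`|a| + `|t - a|) => -[|[|N]].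
  + by rewrite big_ord0 addr_ge0.
  + by rewrite big_ord_recl big_ord0 /= expr0 mulr1 addr0 lerDl.
  + rewrite big_ord_recl big_ord_recl /= big1 => [|k _]; last by rewrite mul0r normr0.
    by rewrite expr0 mulr1 mul1r expr1 addr0.
have sumE m : (1 < m)%N -> \sum_(k < m)
    (if (k : nat) == 0%N then a else if (k : nat) == 1%N then 1 else 0) * (t - a) ^+ k = t.
  case: m => [|[|m]] // _.
  rewrite big_ord_recl big_ord_recl /= big1 => [|k _]; last by rewrite mul0r.
  by rewrite expr0 mulr1 mul1r expr1 addr0 addrC subrK.
apply: cvg_near_cst; near=> N.
by apply: sumE; near: N; exact: nbhs_infty_gt.
Unshelve. all: by end_near. Qed.

Lemma cos_coeff_le (y : R) k : `|cos_coeff y k| <= exp_coeff `|y| k.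
Proof.
rewrite /exp_coeff /cos_coeff /= !normrM normfV !normr_nat !normrX normrN normr1 expr1n mulr1.
by case: odd; [rewrite !mul0r divr_ge0 // exprn_ge0|rewrite mul1r].
Qed.

Lemma sin_coeff_le (y : R) k : `|sin_coeff y k| <= exp_coeff `|y| k.
Proof.
rewrite /exp_coeff /sin_coeff /= !normrM normfV !normr_nat !normrX normrN normr1 expr1n mulr1.
by case: odd; [rewrite mul1r|rewrite !mul0r divr_ge0 // exprn_ge0].
Qed.

Lemma power_series_cos a : power_series_at cos a.
Proof.
exists (fun k => cos a * cos_coeff 1 k - sin a * sin_coeff 1 k) => t.
have E k : (cos a * cos_coeff 1 k - sin a * sin_coeff 1 k) * (t - a) ^+ k =
    cos a * cos_coeff (t - a) k - sin a * sin_coeff (t - a) k.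
  by rewrite /cos_coeff /sin_coeff /= expr1n; ring.
split.
  exists ((`|cos a| + `|sin a|) * expR `|t - a|) => N.
  apply: le_trans (_ : (`|cos a| + `|sin a|) * \sum_(k < N) exp_coeff `|t - a| k <= _).
    rewrite mulr_sumr; apply: ler_sum => k _; rewrite E.
    apply: le_trans (ler_normB _ _) _; rewrite (normrM (cos a)) (normrM (sin a)) mulrDl.
    apply: lerD; apply: ler_wpM2l => //; [exact: cos_coeff_le|exact: sin_coeff_le].
  by rewrite ler_wpM2l ?sum_exp_coeff_le // addr_ge0.
have -> : cos t = cos a * cos (t - a) - sin a * sin (t - a).
  by rewrite -cosD addrC subrK.
under eq_fun do under eq_bigr do rewrite E.
under eq_fun do rewrite sumrB -!mulr_sumr.
apply: cvgB; apply: cvgM; try exact: cvg_cst.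
  by have := @is_cvg_series_cos_coeff R (t - a); rewrite cos.unlock seriesEord.
by have := @is_cvg_series_sin_coeff R (t - a); rewrite sin.unlock seriesEord.
Qed.

End PowerSeries.

(** * Analytic functions of several variables and sign conditions *)

Section Analytic.
Variables (R : realType) (d : nat).
Implicit Types (f g : 'rV[R]_d -> R) (a x : 'rV[R]_d).

Lemma analytic_add f g a : analytic_at f a -> analytic_at g a ->
  analytic_at (fun x => f x + g x) a.
Proof.
move=> [c cP] [c' cP']; exists (fun nu => c nu + c' nu) => term.
apply: filterS2 cP cP' => x /= [[M MP] cv] [[M' MP'] cv'].
have E nu : term x nu = c nu * \prod_(i < d) (x 0 i - a 0 i) ^+ nu i
    + c' nu * \prod_(i < d) (x 0 i - a 0 i) ^+ nu i by rewrite /term mulrDl.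
split.
  exists (M + M') => N; apply: le_trans (lerD (MP N) (MP' N)).
  by rewrite /boxsum -big_split /=; apply: ler_sum => nu _; rewrite E ler_normD.
have -> : boxsum (term x) = (fun N =>
    boxsum (fun nu => c nu * \prod_(i < d) (x 0 i - a 0 i) ^+ nu i) N +
    boxsum (fun nu => c' nu * \prod_(i < d) (x 0 i - a 0 i) ^+ nu i) N).
  by apply/funext => N; rewrite /boxsum -big_split /=; apply: eq_bigr => nu _; rewrite E.
exact: (@cvgD R R^o).
Qed.

(** Over a box the sum of products is the product of the one-variable partial sums, so the bound and
    the limit are both inherited. *)
Lemma analytic_product (h : 'I_d -> R -> R) a :
  (forall i, power_series_at (h i) (a 0 i)) ->
  analytic_at (fun x => \prod_i h i (x 0 i)) a.
Proof.
move=> /choice[c cP]; exists (fun nu => \prod_i c i (nu i)) => term.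
apply: (@filterE _ (nbhs a) (nbhs_filter a)) => x /=.
have E nu : term x nu = \prod_i (c i (nu i) * (x 0 i - a 0 i) ^+ nu i).
  by rewrite big_split.
split.
  have /choice[M MP] : forall i, exists M : R, forall N,
      \sum_(k < N) `|c i k * (x 0 i - a 0 i) ^+ k| <= M.
    by move=> i; case: (cP i (x 0 i)).
  exists (\prod_i M i) => N.
  apply: le_trans (_ : \prod_i \sum_(k < N) `|c i k * (x 0 i - a 0 i) ^+ k| <= _).
    rewrite bigA_distr_bigA /boxsum; apply: ler_sum => nu _.
    by rewrite E normr_prod.
  by apply: ler_prod => i _; rewrite MP sumr_ge0.
have -> : boxsum (term x) = (fun N => \prod_i \sum_(k < N) c i k * (x 0 i - a 0 i) ^+ k).
  apply/funext => N; rewrite bigA_distr_bigA /boxsum; apply: eq_bigr => nu _.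
  exact: E.
apply: (cvg_big (@mul_continuous R)) => i _.
by case: (cP i (x 0 i)).
Qed.

Lemma analytic_ext f g a : f =1 g -> analytic_at f a -> analytic_at g a.
Proof. by move=> /funext ->. Qed.

Lemma analytic_scale (r : R) f a : analytic_at f a -> analytic_at (fun x => r * f x) a.
Proof.
move=> [c cP]; exists (fun nu => r * c nu) => term.
apply: filterS cP => x /= [[M MP] cv].
have E nu : term x nu = r * (c nu * \prod_(i < d) (x 0 i - a 0 i) ^+ nu i).
  by rewrite /term mulrA.
split.
  exists (`|r| * M) => N; apply: le_trans (ler_wpM2l (normr_ge0 r) (MP N)).
  by rewrite /boxsum mulr_sumr; apply: ler_sum => nu _; rewrite E normrM.
have -> : boxsum (term x) = (fun N => r *
    boxsum (fun nu => c nu * \prod_(i < d) (x 0 i - a 0 i) ^+ nu i) N).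
  by apply/funext => N; rewrite /boxsum mulr_sumr; apply: eq_bigr => nu _; rewrite E.
by apply: cvgM => //; exact: cvg_cst.
Qed.

Lemma In_nth (T : Type) (t0 t : T) (s : seq T) :
  List.In t s <-> exists2 j, (j < size s)%N & nth t0 s j = t.
Proof.
elim: s => [|t' s IH] /=; first by split=> // -[].
split=> [[->|/IH[j js jE]]|[[|j] js jE]]; [by exists 0%N|by exists j.+1|by left|].
by right; apply/IH; exists j.
Qed.

(** The conditions are global, so U is the whole space. Each g >= 0 splits into g = 0 or g > 0, and
    the union runs over all patterns of choices. *)
Lemma semianalytic_nonneg (X : set 'rV[R]_d) (gs : seq ('rV[R]_d -> R)) :
  (forall g, List.In g gs -> forall a, analytic_at g a) ->
  (forall x, X x <-> forall g, List.In g gs -> 0 <= g x) ->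
  semianalytic X.
Proof.
move=> ga XP a; pose q := size gs; pose g (j : 'I_q) := nth (fun=> 0) gs j.
have gin (j : 'I_q) : List.In (g j) gs by apply/(In_nth (fun=> 0)); exists j.
have gout f : List.In f gs -> exists j, g j = f.
  by move=> /(In_nth (fun=> 0))[j jq <-]; exists (Ordinal jq).
pose T := {ffun 'I_q -> bool}.
exists setT, #|T|, q, (fun i j => (enum_val i : T) j), (fun _ j => g j).
split=> //; first exact: openT.
  by move=> _ j x _; exact: ga.
move=> x _; rewrite XP; split=> [pos|[i iP] f /gout[j <-]].
  exists (enum_rank ([ffun j => g j x == 0] : T)) => j; rewrite enum_rankK ffunE.
  by case: eqP => // /eqP gN; rewrite lt_neqAle eq_sym gN pos.
by have := iP j; case: ifP => _; [move=> ->|exact: ltW].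
Qed.

End Analytic.

Section ExponentialSums.
Variable R : realType.
Implicit Types (f g : R -> R -> R) (h : R -> R).

(** Closed under products, these sums make every polynomial in cosh(m_1/2) and cosh(m_2/2) analytic
    without multiplying power series in several variables. *)
Definition exp_sum f := exists s : seq (R * R * R), forall u v,
  f u v = \sum_(k <- s) k.1.1 * (expR (k.1.2 * u) * expR (k.2 * v)).

Lemma exp_sum_const (r : R) : exp_sum (fun _ _ => r).
Proof. by exists [:: (r, 0, 0)] => u v; rewrite big_seq1 /= !mul0r expR0 !mulr1. Qed.

Lemma exp_sumD f g : exp_sum f -> exp_sum g -> exp_sum (fun u v => f u v + g u v).
Proof. by move=> [s sE] [t tE]; exists (s ++ t) => u v; rewrite big_cat sE tE. Qed.

Lemma exp_sumM f g : exp_sum f -> exp_sum g -> exp_sum (fun u v => f u v * g u v).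
Proof.
move=> [s sE] [t tE].
exists [seq (k.1.1 * l.1.1, k.1.2 + l.1.2, k.2 + l.2) | k <- s, l <- t] => u v.
rewrite big_allpairs_dep sE tE mulr_suml; apply: eq_bigr => k _.
rewrite mulr_sumr; apply: eq_bigr => l _ /=.
by rewrite !mulrDl !expRD; ring.
Qed.

Lemma exp_sumN f : exp_sum f -> exp_sum (fun u v => - f u v).
Proof.
move=> sf; have -> : (fun u v => - f u v) = (fun u v => -1 * f u v).
  by apply/funext => u; apply/funext => v; rewrite mulN1r.
by apply: exp_sumM => //; exact: exp_sum_const.
Qed.

Lemma exp_sumX f k : exp_sum f -> exp_sum (fun u v => f u v ^+ k).
Proof.
move=> sf; elim: k => [|k IH].
  by under eq_fun do under eq_fun do rewrite expr0; exact: exp_sum_const.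
under eq_fun do under eq_fun do rewrite exprS.
exact: exp_sumM.
Qed.

Lemma exp_sum_cosh1 : exp_sum (fun u _ => cosh (u / 2)).
Proof.
exists [:: (2^-1, 2^-1, 0); (2^-1, - 2^-1, 0)] => u v.
rewrite big_cons big_seq1 /= !mul0r expR0 !mulr1 /cosh mulrDl mulNr.
by rewrite [2^-1 * u]mulrC; ring.
Qed.

Lemma exp_sum_cosh2 : exp_sum (fun _ v => cosh (v / 2)).
Proof.
exists [:: (2^-1, 0, 2^-1); (2^-1, 0, - 2^-1)] => u v.
rewrite big_cons big_seq1 /= !mul0r expR0 !mul1r /cosh mulrDl mulNr.
by rewrite [2^-1 * v]mulrC; ring.
Qed.

Lemma power_series_one (a : R) : power_series_at (fun=> 1) a.
Proof.
have -> : (fun=> 1) = (fun t : R => expR (0 * t)).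
  by apply/funext => t; rewrite mul0r expR0.
exact: power_series_expR.
Qed.

Lemma analytic_triple (h0 h1 h2 : R -> R) (a : 'rV[R]_3) :
  power_series_at h0 (a 0 0) -> power_series_at h1 (a 0 1) -> power_series_at h2 (a 0 2) ->
  analytic_at (fun x => h0 (x 0 0) * h1 (x 0 1) * h2 (x 0 2)) a.
Proof.
move=> H0 H1 H2; apply: analytic_ext (analytic_product (h := triple h0 h1 h2) _).
  move=> x; rewrite !big_ord_recl big_ord0 mulr1 mulrA.
  have -> : lift ord0 ord0 = 1 :> 'I_3 by apply: val_inj.
  by have -> : lift ord0 (lift ord0 ord0) = 2 :> 'I_3 by apply: val_inj.
by move=> i; have [->|->|->] := I3P i.
Qed.

Lemma analytic_exp_sum f h (a : 'rV[R]_3) : exp_sum f -> power_series_at h (a 0 2) ->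
  analytic_at (fun x => f (x 0 0) (x 0 1) * h (x 0 2)) a.
Proof.
move=> [s sE] hP.
have -> : (fun x : 'rV[R]_3 => f (x 0 0) (x 0 1) * h (x 0 2)) = (fun x =>
    \sum_(k <- s) k.1.1 * (expR (k.1.2 * x 0 0) * expR (k.2 * x 0 1) * h (x 0 2))).
  apply/funext => x; rewrite sE mulr_suml; apply: eq_bigr => k _.
  by rewrite !mulrA.
have ak (k : R * R * R) : analytic_at
    (fun x : 'rV[R]_3 => expR (k.1.2 * x 0 0) * expR (k.2 * x 0 1) * h (x 0 2)) a.
  apply: (analytic_triple (h0 := fun t => expR (k.1.2 * t)) (h1 := fun t => expR (k.2 * t))) => //;
  exact: power_series_expR.
elim: s {sE} => [|k s IH].
  apply: analytic_ext (analytic_scale 0 (ak (0, 0, 0))) => x.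
  by rewrite mul0r big_nil.
apply: analytic_ext (analytic_add (analytic_scale k.1.1 (ak k)) IH) => x.
by rewrite big_cons.
Qed.

Lemma analytic_exp_sum1 f (a : 'rV[R]_3) : exp_sum f ->
  analytic_at (fun x => f (x 0 0) (x 0 1)) a.
Proof.
move=> fP; have := analytic_exp_sum fP (power_series_one (a 0 2)).
by apply: analytic_ext => x /=; rewrite mulr1.
Qed.

Lemma analytic_coord0 (a : 'rV[R]_3) : analytic_at (fun x : 'rV[R]_3 => x 0 0) a.
Proof.
have := analytic_triple (power_series_id (a 0 0)) (power_series_one (a 0 1))
  (power_series_one (a 0 2)); apply: analytic_ext => x /=.
by rewrite !mulr1.
Qed.

Lemma analytic_coord1 (a : 'rV[R]_3) : analytic_at (fun x : 'rV[R]_3 => x 0 1) a.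
Proof.
have := analytic_triple (power_series_one (a 0 0)) (power_series_id (a 0 1))
  (power_series_one (a 0 2)); apply: analytic_ext => x /=.
by rewrite mul1r mulr1.
Qed.

End ExponentialSums.

Lemma In_cat (T : Type) (t : T) (s1 s2 : seq T) :
  List.In t (s1 ++ s2) <-> List.In t s1 \/ List.In t s2.
Proof. exact: List.in_app_iff. Qed.

Lemma In_map (S T : Type) (f : S -> T) (s : seq S) (t : T) :
  List.In t [seq f x | x <- s] <-> exists x, f x = t /\ List.In x s.
Proof. exact: List.in_map_iff. Qed.

(** * K_n cut out by entire functions *)

Section KSemianalytic.
Variables (R : realType) (m3 : R) (k0 n : nat).
Hypotheses (m30 : 0 < m3) (nk : (1 <= n <= k0)%N).
Let r3 := cosh (m3 / 2).
Let s3 := sinh (m3 / 2).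
Let th0 : 0 < m3 / 2. Proof. by rewrite divr_gt0. Qed.

(* 2 r1 r2 t_k, which is a polynomial in r1 and r2. *)
Definition Tn (r1 r2 : R) k : R :=
  (A0 r1 r2 r3 s3 k + A1 r1 r2 r3 s3 k + A2 r1 r2 r3 s3) *
  (s3 * ((r3 + s3) ^+ (2 * k + 1) + (r3 - s3) ^+ (2 * k + 1) - 2 * r3))^-1.

Lemma Tn_t (r1 r2 : R) k : t_ r1 r2 r3 s3 k = Tn r1 r2 k / (2 * r1 * r2).
Proof. by rewrite /t_ /Tn -[RHS]mulrA -invfM; congr (_ * _^-1); ring. Qed.

(** The inequalities with denominators and square roots removed: t_n enters through 2 r1 r2 t_n, and
    (iv) through its squared form. *)
Definition K_aux (r1 r2 : R) : seq R :=
  let T := Tn r1 r2 in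
  let v := v_ r3 s3 (k0 + 2) in
  [:: r2 - r3; r1 - r2;
   r1 ^+ 2 + r2 ^+ 2 - r3 * T n;
   2 * r3 ^+ 2 * (r1 ^+ 2 + r2 ^+ 2) - 2 * r3 * T n - 1;
   r3 ^+ 2 * T n ^+ 2 + r3 * (1 - 2 * r3 ^+ 2 * (r1 ^+ 2 + r2 ^+ 2)) * T n + a0 r1 r2 r3;
   (1 + v) ^+ 2 * (r1 * (r3 - s3) - r2) ^+ 2 - (1 - v) ^+ 2 * (r1 * (r3 + s3) - r2) ^+ 2].

(** At t = 1 both radicands are squares, of X = r1 (r3 + s3) - r2 > 0 and of r1 (r3 - s3) - r2, with
    absolute value Y. The inequality reads (1 - v) X <= (1 + v) Y, whose sides are nonnegative and
    can be squared, which removes the absolute value. *)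
Lemma f_v_iff (r1 r2 : R) : 0 < r2 -> r2 <= r1 ->
  let v := v_ r3 s3 (k0 + 2) in
  (0 <= v - f_ r1 r2 r3 s3 1) =
  (0 <= (1 + v) ^+ 2 * (r1 * (r3 - s3) - r2) ^+ 2 - (1 - v) ^+ 2 * (r1 * (r3 + s3) - r2) ^+ 2).
Proof.
move=> r20 r21 v; have r10 : 0 < r1 by apply: lt_le_trans r21.
have EE' : (r3 + s3) * (r3 - s3) = 1 by rewrite mulrC -subr_sqr cosh2_sinh2.
have E1 : 1 < r3 + s3 by rewrite coshD_sinh expR_gt1.
have E'0 : 0 < r3 - s3 by rewrite coshB_sinh expR_gt0.
rewrite /f_ /x0 /x1 /y0 /y1 !mulr1.
set E := r3 + s3 in EE' E1 *; set E' := r3 - s3 in EE' E'0 *.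
have -> : r1 ^+ 2 * E ^+ 2 + r2 ^+ 2 - 2 * r1 * r2 * E = (r1 * E - r2) ^+ 2 by ring.
have -> : r1 ^+ 2 * E' ^+ 2 + r2 ^+ 2 - 2 * r1 * r2 * E' = (r1 * E' - r2) ^+ 2 by ring.
rewrite !sqrtr_sqr.
have xp : 0 < E ^+ (k0 + 2) by rewrite exprn_gt0 // (lt_trans ltr01).
have x'p : 0 < E' ^+ (k0 + 2) by rewrite exprn_gt0.
have vE : v = (E ^+ (k0 + 2) - E' ^+ (k0 + 2)) / (E ^+ (k0 + 2) + E' ^+ (k0 + 2)) by [].
have v1 : 0 <= 1 - v.
  by rewrite subr_ge0 vE ler_pdivrMr ?addr_gt0 // mul1r; lra.
have v2 : 0 <= 1 + v.
  have : -1 <= v by rewrite vE ler_pdivlMr ?addr_gt0 //; lra.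
  by lra.
have X0 : 0 < r1 * E - r2.
  by rewrite subr_gt0 (le_lt_trans r21) // ltr_pMr.
rewrite (gtr0_norm X0) -(@real_normK _ (r1 * E' - r2)) ?num_real //.
set Y := `|r1 * E' - r2|; have Y0 : 0 <= Y by rewrite normr_ge0.
rewrite -!exprMn !subr_ge0 ler_sqr ?nnegrE ?mulr_ge0 // ?(ltW X0) //.
have s1 : 0 < (r1 * E - r2) + Y by rewrite ltr_wpDr.
rewrite (ler_pdivrMr _ _ s1); clearbody v Y.
by apply/idP/idP; lra.
Qed.

Lemma K_auxP (p : 'rV[R]_3) : K m3 k0 n p <->
  let r1 := cosh (p 0 0 / 2) in let r2 := cosh (p 0 1 / 2) in
  [/\ 0 <= p 0 0 /\ 0 <= p 0 1, 0 <= p 0 2 /\ 0 <= pi - p 0 2,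
    0 <= (r1 ^+ 2 + r2 ^+ 2 + r3 ^+ 2 - 1) + - (2 * r3 * r1 * r2) * cos (p 0 2),
    forall x, List.In x (K_aux r1 r2) -> 0 <= x &
    forall k, (1 <= k <= k0.+1)%N -> 0 <= Tn r1 r2 k - Tn r1 r2 n].
Proof.
pose r1 := cosh (p 0 0 / 2); pose r2 := cosh (p 0 1 / 2).
have r1p : 0 < r1 by apply: lt_le_trans (cosh_ge1 _); exact: ltr01.
have r2p : 0 < r2 by apply: lt_le_trans (cosh_ge1 _); exact: ltr01.
have r3_gt1 : 1 < r3.
  have -> : 1 = cosh 0 :> R by rewrite /cosh oppr0 expR0; field.
  exact: cosh_lt.
have r3p : 0 < r3 by apply: lt_trans r3_gt1.
have p2 : 0 < 2 * r1 * r2 := mulr_gt0 (mulr_gt0 (ltr0Sn R 1) r1p) r2p.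
have p3 : 0 < 2 * r1 * r2 * r3 := mulr_gt0 p2 r3p.
have tT k : 2 * r1 * r2 * t_ r1 r2 r3 s3 k = Tn r1 r2 k.
  by rewrite Tn_t mulrC divfK // gt_eqF.
have e1 : r1 ^+ 2 + r2 ^+ 2 - 2 * r1 * r2 * r3 * t_ r1 r2 r3 s3 n =
    r1 ^+ 2 + r2 ^+ 2 - r3 * Tn r1 r2 n by rewrite -tT; ring.
have e2 : 2 * r3 ^+ 2 * (r1 ^+ 2 + r2 ^+ 2) - 4 * r1 * r2 * r3 * t_ r1 r2 r3 s3 n - 1 =
    2 * r3 ^+ 2 * (r1 ^+ 2 + r2 ^+ 2) - 2 * r3 * Tn r1 r2 n - 1 by rewrite -tT; ring.
have e3 : a2 r1 r2 r3 * t_ r1 r2 r3 s3 n ^+ 2 + a1 r1 r2 r3 * t_ r1 r2 r3 s3 n + a0 r1 r2 r3 =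
    r3 ^+ 2 * Tn r1 r2 n ^+ 2 + r3 * (1 - 2 * r3 ^+ 2 * (r1 ^+ 2 + r2 ^+ 2)) * Tn r1 r2 n
    + a0 r1 r2 r3 by rewrite -tT /a2 /a1; ring.
have tle k : (t_ r1 r2 r3 s3 n <= t_ r1 r2 r3 s3 k) = (0 <= Tn r1 r2 k - Tn r1 r2 n).
  by rewrite subr_ge0 -!tT ler_pM2l.
have dE : (cos (p 0 2) <= (r1 ^+ 2 + r2 ^+ 2 + r3 ^+ 2 - 1) / (2 * r1 * r2 * r3)) =
    (0 <= (r1 ^+ 2 + r2 ^+ 2 + r3 ^+ 2 - 1) + - (2 * r3 * r1 * r2) * cos (p 0 2)).
  rewrite (ler_pdivlMr _ _ p3) -subr_ge0; congr (0 <= _); ring.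
rewrite /K /in_K /= -/r1 -/r2 -/r3 -/s3; split.
  move=> [p0 p1 [[/andP[al0 alp] _ r32 r21 dc] [tk [h1 h2 h3 h4]]]].
  split=> //; first by rewrite subr_ge0.
  - by rewrite -dE.
  - move=> x /= [<-|[<-|[<-|[<-|[<-|[<-|[]]]]]]]; rewrite ?subr_ge0 //.
    + by rewrite -subr_ge0 -e1.
    + by rewrite -subr_ge0 -e2.
    + by rewrite -e3.
    + by rewrite -subr_ge0 -f_v_iff.
  - move=> k kk; rewrite -tle; have [->//|kn] := eqVneq k n; exact: tk.
move=> [[p0 p1] [al0 alp] dc aux tk].
have a1' := aux _ (or_introl erefl).
have a2' := aux _ (or_intror (or_introl erefl)).
have a3' := aux _ (or_intror (or_intror (or_introl erefl))).
have a4' := aux _ (or_intror (or_intror (or_intror (or_introl erefl)))).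
have a5' := aux _ (or_intror (or_intror (or_intror (or_intror (or_introl erefl))))).
have a6' := aux _ (or_intror (or_intror (or_intror (or_intror (or_intror (or_introl erefl)))))).
split=> //; split; last split.
- by split; rewrite ?dE ?al0 // -subr_ge0.
- by move=> k kk _; rewrite tle; exact: tk.
- split; [by rewrite e1|by rewrite e2|by rewrite e3|].
  by rewrite f_v_iff // -subr_ge0.
Qed.

Lemma exp_sum_Tn k : exp_sum (fun u v => Tn (cosh (u / 2)) (cosh (v / 2)) k).
Proof.
rewrite /Tn /A0 /A1 /A2.
by repeat first [exact: exp_sum_const | exact: exp_sum_cosh1 | exact: exp_sum_cosh2
  | apply: exp_sumX | apply: exp_sumN | apply: exp_sumD | apply: exp_sumM].
Qed.

Lemma exp_sum_K_aux (i : nat) : exp_sum (fun u v => nth 0 (K_aux (cosh (u / 2)) (cosh (v / 2))) i).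
Proof.
case: i => [|[|[|[|[|[|i]]]]]] /=; last by rewrite nth_nil; exact: exp_sum_const.
all: rewrite /a0; by repeat first [exact: exp_sum_const | exact: exp_sum_cosh1
  | exact: exp_sum_cosh2 | exact: exp_sum_Tn
  | apply: exp_sumX | apply: exp_sumN | apply: exp_sumD | apply: exp_sumM].
Qed.

Lemma K_semianalytic : semianalytic (K m3 k0 n).
Proof.
pose r1 (x : 'rV[R]_3) := cosh (x 0 0 / 2); pose r2 (x : 'rV[R]_3) := cosh (x 0 1 / 2).
pose gs : seq ('rV[R]_3 -> R) :=
  [:: (fun x : 'rV[R]_3 => x 0 0); (fun x : 'rV[R]_3 => x 0 1); (fun x : 'rV[R]_3 => x 0 2);
   (fun x : 'rV[R]_3 => pi - x 0 2);
   (fun x : 'rV[R]_3 =>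
     (r1 x ^+ 2 + r2 x ^+ 2 + r3 ^+ 2 - 1) + - (2 * r3 * r1 x * r2 x) * cos (x 0 2))]
  ++ [seq (fun x => nth 0 (K_aux (r1 x) (r2 x)) i) | i <- iota 0 6]
  ++ [seq (fun x => Tn (r1 x) (r2 x) k - Tn (r1 x) (r2 x) n) | k <- iota 1 k0.+1].
have an2 (a : 'rV[R]_3) : analytic_at (fun x => x 0 2) a.
  have := analytic_exp_sum (exp_sum_const 1) (power_series_id (a 0 2)).
  apply: analytic_ext => x /=.
  by rewrite mul1r.
apply: (@semianalytic_nonneg _ _ _ gs).
  move=> g /In_cat[|/In_cat[|]].
  - move=> /= [<-|[<-|[<-|[<-|[<-|[]]]]]] a.
    + exact: analytic_coord0.
    + exact: analytic_coord1.
    + exact: an2.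
    + have := analytic_add (analytic_exp_sum1 a (exp_sum_const pi)) (analytic_scale (-1) (an2 a)).
      by apply: analytic_ext => x /=; rewrite mulN1r.
    + apply: (analytic_add (f := fun x => r1 x ^+ 2 + r2 x ^+ 2 + r3 ^+ 2 - 1)
        (g := fun x => - (2 * r3 * r1 x * r2 x) * cos (x 0 2))).
        apply: (@analytic_exp_sum1 _ (fun u v => cosh (u / 2) ^+ 2 + cosh (v / 2) ^+ 2 + r3 ^+ 2 - 1)).
        by repeat first [exact: exp_sum_const | exact: exp_sum_cosh1 | exact: exp_sum_cosh2
          | apply: exp_sumX | apply: exp_sumN | apply: exp_sumD | apply: exp_sumM].
      apply: (@analytic_exp_sum _ (fun u v => - (2 * r3 * cosh (u / 2) * cosh (v / 2))) cos);
        last exact: power_series_cos.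
      by repeat first [exact: exp_sum_const | exact: exp_sum_cosh1 | exact: exp_sum_cosh2
        | apply: exp_sumX | apply: exp_sumN | apply: exp_sumD | apply: exp_sumM].
  - move=> /In_map[i [<- _]] a.
    exact: (analytic_exp_sum1 a (exp_sum_K_aux i)).
  - move=> /In_map[k [<- _]] a.
    apply: (@analytic_exp_sum1 _ (fun u v => Tn (cosh (u / 2)) (cosh (v / 2)) k
      - Tn (cosh (u / 2)) (cosh (v / 2)) n)).
    by apply: exp_sumD; [|apply: exp_sumN]; exact: exp_sum_Tn.
have in_iota m l k : List.In k (iota m l) <-> (m <= k < m + l)%N.
  rewrite -mem_iota; elim: (iota m l) => //= j s IH; rewrite inE.
  by split=> [[->|/IH ->]|/orP[/eqP ->|/IH]]; rewrite ?eqxx ?orbT //; [left|right].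
move=> x; rewrite K_auxP; split.
  move=> [[h0 h1] [h2 h3] h4 h5 h6] g /In_cat[|/In_cat[|]].
  - by move=> /= [<-|[<-|[<-|[<-|[<-|[]]]]]].
  - move=> /In_map[i [<- /in_iota /= i6]]; apply: h5; apply/(In_nth 0).
    by exists i.
  - by move=> /In_map[k [<- /in_iota kk]]; apply: h6; rewrite add1n in kk.
move=> H.
have H1 g : List.In g (take 5 gs) -> 0 <= g x.
  by move=> gi; apply: H; apply/In_cat; left.
split.
- by split; [apply: (H1 (fun x => x 0 0)); left|apply: (H1 (fun x => x 0 1)); right; left].
- split; first by apply: (H1 (fun x => x 0 2)); do 2 right; left.
  by apply: (H1 (fun x => pi - x 0 2)); do 3 right; left.
- by apply: (H1 (fun x => (r1 x ^+ 2 + r2 x ^+ 2 + r3 ^+ 2 - 1)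
    + - (2 * r3 * r1 x * r2 x) * cos (x 0 2))); do 4 right; left.
- move=> y /(In_nth 0)[i i6 <-]; apply: (H (fun x => nth 0 (K_aux (r1 x) (r2 x)) i)).
  apply/In_cat; right; apply/In_cat; left.
  by apply/In_map; exists i; split=> //; apply/in_iota.
- move=> k kk; apply: (H (fun x => Tn (r1 x) (r2 x) k - Tn (r1 x) (r2 x) n)).
  apply/In_cat; right; apply/In_cat; right.
  by apply/In_map; exists k; split=> //; apply/in_iota; rewrite add1n.
Qed.

End KSemianalytic.

(** * The list of 4 + k_0 inequalities *)

Section KInequalities.
Variables (R : realType) (k0 n : nat).

Lemma size_K_lhs (r1 r2 r3 s3 : R) : (1 <= n <= k0)%N ->
  size (K_lhs r1 r2 r3 s3 k0 n) = (4 + k0)%N.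
Proof.
move=> nk; rewrite size_cat size_map size_filter addnC; congr (_ + _)%N.
have nin : n \in iota 1 k0.+1 by rewrite mem_iota; lia.
have := count_predC (pred1 n) (iota 1 k0.+1).
rewrite (count_uniq_mem _ (iota_uniq _ _)) nin size_iota add1n => -[cE].
by rewrite -[RHS]cE; apply: eq_count.
Qed.

Lemma K_lhsP (m3 : R) (p : 'rV[R]_3) :
  let r1 := cosh (p 0 0 / 2) in let r2 := cosh (p 0 1 / 2) in
  let r3 := cosh (m3 / 2) in let s3 := sinh (m3 / 2) in
  K m3 k0 n p <->
  [/\ 0 <= p 0 0, 0 <= p 0 1, domain r1 r2 r3 (p 0 2) &
      all (fun x => 0 <= x) (K_lhs r1 r2 r3 s3 k0 n)].
Proof.
move=> r1 r2 r3 s3; rewrite /K_lhs all_cat all_map all_filter.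
split.
  move=> [p0 p1 [dom [tk [h1 h2 h3 h4]]]]; split=> //.
  apply/andP; split; last by apply/and5P; split.
  apply/allP => k; rewrite mem_iota => kk; apply/implyP => kn /=.
  by rewrite subr_ge0; apply: tk => //; rewrite add1n ltnS in kk.
move=> [p0 p1 dom /andP[/allP tk /and5P[h1 h2 h3 h4 _]]].
split=> //; split=> //; split=> // k kk kn.
have := tk k; rewrite mem_iota add1n ltnS kk => /(_ isT)/implyP/(_ kn) /=.
by rewrite subr_ge0.
Qed.

End KInequalities.

Theorem theorem1p1 (R : realType) (m3 : R) (k0 : nat) :
  0 < m3 -> (0 < k0)%N ->
  forall n : nat, (1 <= n <= k0)%N ->
  [/\ semianalytic (K m3 k0 n),
      (forall p : 'rV[R]_3, K m3 k0 n p ->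
        let nv := polar_of m3 p in
        [/\ forall j : 'I_3, herm (nv j) (nv j) = 1,
            angular_invariant nv (p 0 2) &
            exists phi : {multiplicative Gamma -> PU21 R},
              triangle_rep (triple (p 0 0) (p 0 1) m3) nv phi]),
      (forall p : 'rV[R]_3,
        let r1 := cosh (p 0 0 / 2) in
        let r2 := cosh (p 0 1 / 2) in
        let r3 := cosh (m3 / 2) in
        let s3 := sinh (m3 / 2) in
        size (K_lhs r1 r2 r3 s3 k0 n) = (4 + k0)%N /\
        (K m3 k0 n p <->
          [/\ 0 <= p 0 0, 0 <= p 0 1, domain r1 r2 r3 (p 0 2) &
              all (fun x => 0 <= x) (K_lhs r1 r2 r3 s3 k0 n)])) &
      (forall (p : 'rV[R]_3) (phi : {multiplicative Gamma -> PU21 R}),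
        K m3 k0 n p ->
        let nv := polar_of m3 p in
        let R1 := crefl (nv 0) in
        let R2 := crefl (nv 1) in
        let R3 := crefl (nv 2) in
        triangle_rep (triple (p 0 0) (p 0 1) m3) nv phi ->
        (discrete_rep phi /\ faithful_rep phi <->
         ~ elliptic (R1 * (R2 * R1) ^+ n * R3)%g))].
Proof.
move=> m30 _ n nk; split.
- exact: K_semianalytic.
- move=> p pK nv; split.
  + exact: (polar_unit m30 pK).
  + exact: (polar_angular m30 pK).
  + exact: (polar_triangle_rep m30 pK).
- move=> p r1 r2 r3 s3; split; first exact: size_K_lhs.
  exact: K_lhsP.
- move=> p phi pK nv R1 R2 R3 [_ _ phiE _ _].
  exact: (polar_criterion m30 pK nk phiE).
Qed.
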